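(* Let $x>0$. Then, for either choice of the sign $\pm$, $$\left.\frac{\partial \mathrm{W}_{\kappa,\pm1/2}(x)}{\partial\kappa}\right|_{\kappa=0}=e^{-x/2}\left\{\ln x+\frac{1}{4\sqrt{\pi}}\left[G_{2,4}^{3,1}\left(\frac{x^2}{4}\left|\begin{array}{c}\frac12,1\\ 0,0,\frac12,-\frac12\end{array}\right.\right)-\left(e^x-1\right)G_{1,3}^{3,0}\left(\frac{x^2}{4}\left|\begin{array}{c}1\\ -\frac12,0,0\end{array}\right.\right)\right]\right\}.$$
   Context: For $x>0$, the Whittaker function is $\mathrm{W}_{\kappa,\mu}(x)=e^{-x/2}x^{\mu+1/2}\,\mathrm{U}\left(\frac12+\mu-\kappa,1+2\mu,x\right)$, where $\mathrm{U}$ is the Tricomi confluent hypergeometric function. $G_{p,q}^{m,n}$ denotes the Meijer G-function in its standard normalization, $G_{p,q}^{m,n}\left(z\left|\begin{array}{c}a_1,\ldots,a_p\\ b_1,\ldots,b_q\end{array}\right.\right)=\frac{1}{2\pi i}\int_L\frac{\prod_{\ell=1}^m\Gamma(b_\ell-s)\prod_{\ell=1}^n\Gamma(1-a_\ell+s)}{\prod_{\ell=m+1}^{q}\Gamma(1-b_\ell+s)\prod_{\ell=n+1}^{p}\Gamma(a_\ell-s)}z^s\,ds$, where the contour $L$ separates the poles of the factors $\Gamma(b_\ell-s)$ from those of the factors $\Gamma(1-a_\ell+s)$. *)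

(* Defs.v *)
(* MathComp-Analysis; complex numbers are R[i] from mathcomp.real_closed *)
From HB Require Import structures.
From mathcomp Require Import all_boot all_order all_algebra.
From mathcomp Require Import complex.
From mathcomp Require Import all_classical all_reals all_analysis.

Set Implicit Arguments.
Unset Strict Implicit.
Unset Printing Implicit Defensive.

Import Order.TTheory GRing.Theory Num.Theory.
Import numFieldNormedType.Exports.

Local Open Scope classical_set_scope.
Local Open Scope complex_scope.
Local Open Scope ring_scope.

Section Tricomi.
Context {R : realType}.
Implicit Types (a b kappa mu x : R) (f : R -> R).

(* Kummer's equation  x f'' + (b - x) f' - a f = 0  on the positive half-line *)
Definition kummer_solution a b f : Prop :=
  forall x, 0 < x ->
    [/\ derivable f x 1, derivable (derive1 f) x 1
      & x * derive1n 2 f x + (b - x) * derive1 f x - a * f x = 0].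

(* The Tricomi function U(a, b, .) is the solution of Kummer's equation with
   U(a, b, x) ~ x^(-a) as x -> +oo. The solutions not proportional to it grow
   like e^x x^(a - b), so this determines U on x > 0 for all real a and b,
   including integer b and a <= 0; for x <= 0 the value is unspecified. *)
Definition is_tricomi a b f : Prop :=
  kummer_solution a b f /\ f x * x `^ a @[x --> +oo] --> (1 : R).

Definition tricomiU a b : R -> R :=
  xget (fun=> 0) [set f | is_tricomi a b f].

Definition whittakerW kappa mu x : R :=
  expR (- x / 2) * x `^ (mu + 2^-1)
  * tricomiU (2^-1 + mu - kappa) (1 + 2 * mu) x.

End Tricomi.

Section MeijerG.
Context {R : realType}.
Implicit Types (t z : R) (s p v : R[i]) (a b : seq R[i]) (gam : R -> R[i]).

Definition cintegrable (D : set R) (F : R -> R[i]) : Prop :=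
  lebesgue_measure.-integrable D (fun t => (complex.Re (F t))%:E) /\
  lebesgue_measure.-integrable D (fun t => (complex.Im (F t))%:E).

Definition cintegral (D : set R) (F : R -> R[i]) : R[i] :=
  (\int[lebesgue_measure]_(t in D) complex.Re (F t))
  +i* (\int[lebesgue_measure]_(t in D) complex.Im (F t)).

(* t^s = e^(s ln t), for t > 0 *)
Definition cpower t s : R[i] :=
  (expR (complex.Re s * ln t))%:C
  * (cos (complex.Im s * ln t) +i* sin (complex.Im s * ln t)).

Definition euler_integral s : R[i] :=
  cintegral `]0, +oo[ (fun t => cpower t (s - 1) * (expR (- t))%:C).

(* Euler's integral, continued to Re s <= 0 by
   Gamma(s) = Gamma(s + N) / (s (s + 1) ... (s + N - 1)), where N >= 1 is
   large enough for Re (s + N) > 0. At the poles, division by zero gives the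
   value 0, which makes (cGamma s)^-1 the entire function 1 / Gamma. *)
Definition cGamma s : R[i] :=
  let N := (Num.truncn (- complex.Re s)).+1 in
  euler_integral (s + N%:R) / \prod_(k < N) (s + k%:R).

Definition velocity gam t : R[i] :=
  derive1 (fun u => complex.Re (gam u)) t
  +i* derive1 (fun u => complex.Im (gam u)) t.

(* C^1 paths from -i oo to +i oo with bounded real part. The velocity may
   vanish, so paths with corners are included. *)
Definition is_contour gam : Prop :=
  [/\ (forall t, derivable (fun u => complex.Re (gam u)) t 1) /\
      (forall t, derivable (fun u => complex.Im (gam u)) t 1),
      continuous (fun t => complex.Re (velocity gam t)) /\
      continuous (fun t => complex.Im (velocity gam t)),
      exists M : R, forall t, `|complex.Re (gam t)| <= M,
      complex.Im (gam t) @[t --> -oo] --> -oo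
    & complex.Im (gam t) @[t --> +oo] --> +oo].

(* delta, restricted to [0, 1], is a path in the plane that avoids gam *)
Definition avoiding_path gam (delta : R -> R[i]) : Prop :=
  [/\ {within `[0, 1], continuous (fun u => complex.Re (delta u))},
      {within `[0, 1], continuous (fun u => complex.Im (delta u))}
    & forall u t, 0 <= u <= 1 -> delta u <> gam t].

(* p lies in the component of the complement of gam containing a half-plane
   Re s > M, respectively Re s < - M, with M bounding |Re| on gam. *)
Definition right_of gam p : Prop :=
  exists2 delta, avoiding_path gam delta &
    delta 0 = p /\ forall t, complex.Re (gam t) < complex.Re (delta 1).

Definition left_of gam p : Prop :=
  exists2 delta, avoiding_path gam delta &
    delta 0 = p /\ forall t, complex.Re (delta 1) < complex.Re (gam t).

(* The poles of Gamma(beta - s) are s = beta + k, and those of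
   Gamma(1 - alpha + s) are s = alpha - 1 - k. With gam directed upwards the
   former lie on its right and the latter on its left. *)
Definition separates_poles (m n : nat) a b gam : Prop :=
  (forall beta (k : nat), beta \in take m b -> right_of gam (beta + k%:R)) /\
  (forall alpha (k : nat), alpha \in take n a ->
     left_of gam (alpha - 1 - k%:R)).

Definition meijer_integrand (m n : nat) a b z s : R[i] :=
  (\prod_(beta <- take m b) cGamma (beta - s))
  * (\prod_(alpha <- take n a) cGamma (1 - alpha + s))
  / ((\prod_(beta <- drop m b) cGamma (1 - beta + s))
     * (\prod_(alpha <- drop n a) cGamma (alpha - s)))
  * cpower z s.

(* v is the value at z > 0 of the G-function with m, n as upper indices,
   p = size a, q = size b, upper parameters a and lower parameters b, given by
   an absolutely convergent integral. By Cauchy's theorem v does not depend on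
   gam when p + q < 2 (m + n), as the integrand then decays exponentially in
   |Im s|, locally uniformly in Re s. *)
Definition is_meijerG (m n : nat) a b z v : Prop :=
  exists gam,
    let F := fun t => meijer_integrand m n a b z (gam t) * velocity gam t in
    [/\ is_contour gam, separates_poles m n a b gam, cintegrable setT F
      & v = (0 +i* (2 * pi))^-1 * cintegral setT F].

End MeijerG.

(* Main.v *)
(* With [s = - w / 2], the duplication formula turns the two Meijer integrands
   into [8 sqrt(pi) Gamma(w) x^(-w)] times [1 / (w (1 - w))] on [Re w = 1/2],
   respectively [1 / (w (w - 1))] on [Re w = 3/2]. Insert Euler's integral for
   [Gamma(w)] and exchange the integrals: Fourier inversion of the rational
   factors leaves [4 sqrt(pi) A1] and [4 sqrt(pi) A2], where [A1 + A2 = 1 / x]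
   and [e^x A2 = 1 / x - I] with [I] the integral of [e^(-v) / (x + v)].
   Gauss's product for [Gamma] yields both the duplication formula and the
   non-vanishing of [Gamma], needed to cancel factors.

   On the other side, [W_(k, 1/2)(x) = W_(k, -1/2)(x)] is
   [e^(-x/2) / Gamma(1 - k)] times the integral of [e^(-u) (1 + x/u)^k], because
   the latter solves Kummer's equation with the prescribed behaviour at
   infinity. Two such solutions have Wronskian [C e^x x^(-b)], and [C <> 0]
   would make the derivative of their quotient, which tends to [1], blow up.
   Differentiating under the integral at [k = 0] gives [e^(-x/2) (ln x + I)]. *)
Require Import Defs.
From mathcomp Require Import all_boot all_order all_algebra.
From mathcomp Require Import complex.
From mathcomp Require Import all_classical all_reals all_analysis.
From mathcomp Require Import measurable_realfun.
From mathcomp Require Import ring lra.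
Import Order.TTheory GRing.Theory Num.Theory.
Import numFieldNormedType.Exports.
Local Open Scope classical_set_scope.
Local Open Scope complex_scope.
Local Open Scope ring_scope.

(** Up to sign both G-functions have the integrand [Gamma(w) x^(-w) / (w (1 - w))]; they differ by
    the strip. For the first, the contour passes between the poles [s = -1/2] and [s = 0], so
    [0 < Re w < 1]; for the second it stays left of the pole [s = -1/2], so [Re w > 1]. Between the
    two lines lies the pole [w = 1], whose residue accounts for [1 / x]. Once a single [Gamma(w)] is
    left, absolute convergence is visible: the rational factor is of order [t^(-2)] on the line, and
    Euler's integral has a majorant independent of [t]. Hence the effort spent on duplication and
    non-vanishing, which reduce the quotient of gamma values to that form. On the Whittaker side the
    obstacle is that [U(-k, 0, x)] has a first parameter of either sign, and its Euler integral
    diverges for [k >= 0]. Its multiple [U(1 - k, 2, x) = U(-k, 0, x) / x] has first parameter near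
    [1]; scaling the variable of its Euler integral by [x] gives the integral of
    [e^(-u) u^(-k) (x + u)^k], which works for all small [k]. *)

#[local] Notation mu := (@lebesgue_measure _).
#[local] Notation integ D f := (lebesgue_measure.-integrable D (EFin \o f)).

(** * Integration and differentiation on the line *)

Lemma measurable_fun_patch {R : realType} (D A : set R) (f : R -> R) :
  measurable D -> measurable A -> measurable_fun D f -> measurable_fun D (f \_ A).
Proof.
move=> mD mA mf; apply/(measurable_restrict _ mA) => //.
by apply: measurable_funS mf => //; exact: subIsetl.
Qed.

Lemma measurable_fun_EFin {R : realType} (D : set R) (f : R -> R) :
  measurable_fun D f -> measurable_fun (T := measurableTypeR R) D (EFin \o f).
Proof. by move=> mf; apply/measurable_EFinP; exact: mf. Qed.

Lemma integrable_measurable_fun {R : realType} (D : set R) (f : R -> R) :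
  integ D f -> measurable_fun D f.
Proof. by move=> /(measurable_int lebesgue_measure) h; apply/measurable_EFinP; exact: h. Qed.

Lemma Rintegral_dominated {R : realType} (D : set R) (f_ : nat -> R -> R) (f g : R -> R) :
  measurable D -> (forall n, measurable_fun D (f_ n)) ->
  (forall x, D x -> f_ ^~ x @ \oo --> f x) ->
  integ D g -> (forall n x, D x -> `|f_ n x| <= g x) ->
  integ D f /\ \int[mu]_(x in D) f_ n x @[n --> \oo] --> \int[mu]_(x in D) f x.
Proof.
move=> mD mf ff ig fg.
have mf' : measurable_fun D f.
  apply: (measurable_fun_cvg mf) => x Dx; exact: ff.
have [] := @dominated_convergence _ _ _ lebesgue_measure D mD
  (fun n => EFin \o f_ n) (EFin \o f) (EFin \o g).
- by move=> n; exact: measurable_fun_EFin.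
- exact: measurable_fun_EFin.
- by apply/aeW => x Dx; apply/cvg_EFin; [exact: nearW|exact: ff].
- by [].
- by apply/aeW => x n Dx; rewrite lee_fin fg.
- move=> fi _ h; split => //.
  apply: fine_cvg; rewrite fineK//.
  exact: integrable_fin_num.
Qed.

Lemma integrable_dominated {R : realType} (D : set R) (f g : R -> R) :
  measurable D -> measurable_fun D f -> integ D g ->
  (forall x, D x -> `|f x| <= g x) -> integ D f.
Proof.
move=> mD mf ig fg; apply: (@le_integrable _ (measurableTypeR R) R lebesgue_measure D mD (EFin \o f) (EFin \o g)) ig; first exact: measurable_fun_EFin.
by move=> x Dx /=; rewrite lee_fin (le_trans (fg _ Dx))// ler_norm.
Qed.

Lemma FTC2_closed {R : realType} (f F : R -> R) (a b : R) : a < b ->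
  (forall x, x \in `[a, b] -> is_derive x 1 F (f x)) ->
  (forall x, x \in `[a, b] -> {for x, continuous f}) ->
  (\int[mu]_(x in `[a, b]) (f x)%:E = (F b - F a)%:E)%E.
Proof.
move=> ab dF cf.
have cF x : x \in `[a, b] -> {for x, continuous F}.
  move=> xab; apply: differentiable_continuous; apply/derivable1_diffP.
  by have [] := dF _ xab.
rewrite (@continuous_FTC2 _ f F)//.
- by apply: continuous_in_subspaceT => x /set_mem xab; exact: cf.
- split.
  + move=> x xab; have xab' : x \in `[a, b] by apply: subset_itv_oo_cc.
    by have [] := dF _ xab'.
  + apply: cvg_at_right_filter; apply: cF.
    by rewrite in_itv/= lexx ltW.
  + apply: cvg_at_left_filter; apply: cF.
    by rewrite in_itv/= lexx ltW.
- move=> x xab; have xab' : x \in `[a, b] by apply: subset_itv_oo_cc.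
  by rewrite derive1E; have [_ ->] := dF _ xab'.
Qed.

Lemma patch_cvg {R : realType} (D : set R) (A : nat -> set R) (f : R -> R) (x : R) :
  (\forall n \near \oo, A n x) -> (f \_ (A n)) x @[n --> \oo] --> f x.
Proof.
move=> An; apply: cvg_near_cst.
by near do (rewrite patchE mem_set//).
Unshelve. all: by end_near. Qed.

(** Fatou's lemma, applied to the truncations of [f] to [[a n, b n]], whose integrals are the
    increments [F (b n) - F (a n)], bounds the integral by [L]. One statement thus serves open and
    half-open intervals. *)
Lemma ge0_FTC2_exhaust {R : realType} (D : set R) (f F : R -> R) (a b : nat -> R) (L : R) :
  measurable D -> measurable_fun D f -> (forall x, D x -> 0 <= f x) ->
  (forall n, a n < b n) -> (forall n, `[a n, b n] `<=` D) ->
  (forall x, D x -> \forall n \near \oo, x \in `[a n, b n]) ->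
  (forall x, D x -> is_derive x 1 F (f x)) ->
  (forall x, D x -> {for x, continuous f}) ->
  F (b n) - F (a n) @[n --> \oo] --> L ->
  integ D f.
Proof.
move=> mD mf f0 ab abD nab dF cf FL.
apply/integrableP; split; first exact: measurable_fun_EFin.
apply: (@le_lt_trans _ _ L%:E); last exact: ltry.
pose f_ n := EFin \o (f \_ `[a n, b n]).
have f_cvg x : D x -> f_ n x @[n --> \oo] --> `|(f x)%:E|%E.
  move=> Dx; rewrite gee0_abs ?lee_fin ?f0//; apply/cvg_EFin; first exact: nearW.
  by apply: (patch_cvg D); apply: nab.
rewrite (@eq_integral _ (measurableTypeR R) R _ _ (fun x => limn_einf (fun n => f_ n x))); last first.
  by move=> x /set_mem Dx; rewrite (cvg_limn_einf_sup (f_cvg x Dx)).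
apply: le_trans.
  apply: fatou => //.
  - move=> n; apply: measurable_fun_EFin; exact: measurable_fun_patch.
  - move=> n x Dx; rewrite /f_ /= lee_fin patchE; case: ifPn => // _; exact: f0.
have E n : (\int[mu]_(x in D) f_ n x = (F (b n) - F (a n))%:E)%E.
  rewrite -(@FTC2_closed _ f F (a n) (b n) (ab n) (fun x xab => dF x (abD n x xab)) (fun x xab => cf x (abD n x xab))).
  rewrite /f_ -restrict_EFin -integral_mkcondr; congr (integral _ _ _).
    by rewrite setIC; apply/setIidPl.
under [X in limn_einf X]eq_fun do rewrite E.
rewrite (cvg_limn_einf_sup (l := L%:E))//.
by apply/cvg_EFin => //; exact: nearW.
Qed.

(** Once [f] is integrable, [|f|] dominates its truncations, so their integrals tend to that of [f]
    as well as to [L]. *)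
Lemma FTC2_exhaust {R : realType} (D : set R) (f F : R -> R) (a b : nat -> R) (L : R) :
  measurable D -> integ D f ->
  (forall n, a n < b n) -> (forall n, `[a n, b n] `<=` D) ->
  (forall x, D x -> \forall n \near \oo, x \in `[a n, b n]) ->
  (forall x, D x -> is_derive x 1 F (f x)) ->
  (forall x, D x -> {for x, continuous f}) ->
  F (b n) - F (a n) @[n --> \oo] --> L ->
  \int[mu]_(x in D) f x = L.
Proof.
move=> mD fi ab abD nab dF cf FL.
have mf : measurable_fun D f by exact: integrable_measurable_fun.
have [||||_] := @Rintegral_dominated _ D (fun n => f \_ `[a n, b n]) f (Num.norm \o f) mD.
- move=> n; exact: measurable_fun_patch.
- by move=> x Dx; apply: (patch_cvg D); apply: nab.
- by move/integrable_norm : fi.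
- by move=> n x Dx; rewrite patchE; case: ifPn => //= _; rewrite normr0.
have E n : \int[mu]_(x in D) (f \_ `[a n, b n]) x = F (b n) - F (a n).
  rewrite -Rintegral_mkcondr /Rintegral -[RHS]/(fine (F (b n) - F (a n))%:E) -(@FTC2_closed _ f F (a n) (b n) (ab n) (fun x xab => dF x (abD n x xab)) (fun x xab => cf x (abD n x xab))).
  congr (fine (integral _ _ _)).
    by rewrite setIC; apply/setIidPl.
under eq_fun do rewrite E.
by move=> h; rewrite -(cvg_lim _ h)//; exact: cvg_lim.
Qed.

Section oy.
Context {R : realType} (a : R).
Let lo (n : nat) : R := a + n.+1%:R^-1.
(** The [n.+2] keeps [lo n < hi n] at [n = 0], where [lo 0 = a + 1]. *)
Let hi (n : nat) : R := a + n.+2%:R.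

Let lohi n : lo n < hi n.
Proof.
rewrite ltrD2l (@le_lt_trans _ _ 1)//; last by rewrite ltr1n.
by rewrite invf_le1// ler1n.
Qed.

Let lohi_sub n : `[lo n, hi n] `<=` `]a, +oo[.
Proof.
move=> x /=; rewrite !in_itv/= andbT => /andP[+ _]; apply: lt_le_trans.
by rewrite ltrDl.
Qed.

Let lo_cvg : lo n @[n --> \oo] --> a.
Proof.
rewrite -[X in _ --> X]addr0; apply: cvgD; first exact: cvg_cst.
exact: cvg_harmonic.
Qed.

Let hi_cvg : hi n @[n --> \oo] --> +oo.
Proof.
apply/cvgryPge => A; near=> n.
rewrite -lerBlDl (@le_trans _ _ n%:R)//; last by rewrite ler_nat ltnW.
by near: n; apply: nbhs_infty_ger.
Unshelve. all: by end_near. Qed.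

Let lohi_near x : `]a, +oo[%classic x -> \forall n \near \oo, x \in `[lo n, hi n].
Proof.
rewrite /= in_itv/= andbT => ax; near=> n; rewrite in_itv/=; apply/andP; split.
  by near: n; move/cvgr_le : lo_cvg; apply.
by near: n; move/cvgryPge : hi_cvg; apply.
Unshelve. all: by end_near. Qed.

Lemma ge0_FTC2_oy (f F : R -> R) (A B : R) :
  (forall x, a < x -> 0 <= f x) ->
  (forall x, a < x -> is_derive x 1 F (f x)) ->
  (forall x, a < x -> {for x, continuous f}) ->
  F x @[x --> a^'+] --> A -> F x @[x --> +oo] --> B ->
  integ `]a, +oo[ f.
Proof.
move=> f0 dF cf FA FB.
have D x : `]a, +oo[%classic x -> a < x by rewrite /= in_itv/= andbT.
apply: (@ge0_FTC2_exhaust _ _ f F lo hi (B - A)) => //.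
- by apply: open_continuous_measurable_fun => // x /set_mem/D; exact: cf.
- by move=> x /D; exact: f0.
- by move=> x /D; exact: dF.
- by move=> x /D; exact: cf.
- apply: cvgB; first by move/cvg_pinftyP : FB; apply.
  by move/cvg_at_rightP : FA; apply; split=> // n; rewrite ltrDl.
Qed.

Lemma FTC2_oy (f F : R -> R) (A B : R) :
  integ `]a, +oo[ f ->
  (forall x, a < x -> is_derive x 1 F (f x)) ->
  (forall x, a < x -> {for x, continuous f}) ->
  F x @[x --> a^'+] --> A -> F x @[x --> +oo] --> B ->
  \int[mu]_(x in `]a, +oo[) f x = B - A.
Proof.
move=> fi dF cf FA FB.
have D x : `]a, +oo[%classic x -> a < x by rewrite /= in_itv/= andbT.
apply: (@FTC2_exhaust _ _ f F lo hi (B - A)) => //.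
- by move=> x /D; exact: dF.
- by move=> x /D; exact: cf.
- apply: cvgB; first by move/cvg_pinftyP : FB; apply.
  by move/cvg_at_rightP : FA; apply; split=> // n; rewrite ltrDl.
Qed.

End oy.

(** * Differentiation rules and the tactics built on them *)

Section derive_rules.
Context {R : realType}.
Implicit Types (f g : R -> R) (x a b : R).

Lemma derD f g x a b : is_derive x 1 f a -> is_derive x 1 g b ->
  is_derive x 1 (fun y => f y + g y) (a + b).
Proof. by move=> fa gb; exact: is_deriveD. Qed.

Lemma derN f x a : is_derive x 1 f a -> is_derive x 1 (fun y => - f y) (- a).
Proof. by move=> fa; exact: is_deriveN. Qed.

Lemma derM f g x a b : is_derive x 1 f a -> is_derive x 1 g b ->
  is_derive x 1 (fun y => f y * g y) (a * g x + f x * b).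
Proof.
move=> fa gb; apply: (is_derive_eq (is_deriveM fa gb)).
by rewrite /GRing.scale/=; ring.
Qed.

Lemma derC x c : is_derive x 1 (fun=> c) (0 : R).
Proof. exact: is_derive_cst. Qed.

Lemma derI x : is_derive x 1 (fun y => y) (1 : R).
Proof. exact: is_derive_id. Qed.

Lemma derV f x a : f x != 0 -> is_derive x 1 f a ->
  is_derive x 1 (fun y => (f y)^-1) (- a / f x ^+ 2).
Proof.
move=> fx fa; apply: (is_derive_eq (is_deriveV fx fa)).
by rewrite /GRing.scale/= mulrC mulrN mulNr.
Qed.

Lemma der_expR g x b : is_derive x 1 g b ->
  is_derive x 1 (fun y => expR (g y)) (expR (g x) * b).
Proof. by move=> gb; exact: (is_derive1_comp (is_derive_expR (g x)) gb). Qed.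

Lemma der_ln g x b : 0 < g x -> is_derive x 1 g b ->
  is_derive x 1 (fun y => ln (g y)) ((g x)^-1 * b).
Proof. by move=> g0 gb; exact: (is_derive1_comp (is_derive1_ln g0) gb). Qed.

Lemma der_cos g x b : is_derive x 1 g b ->
  is_derive x 1 (fun y => cos (g y)) (- sin (g x) * b).
Proof. by move=> gb; exact: (is_derive1_comp (is_derive_cos (g x)) gb). Qed.

Lemma der_sin g x b : is_derive x 1 g b ->
  is_derive x 1 (fun y => sin (g y)) (cos (g x) * b).
Proof. by move=> gb; exact: (is_derive1_comp (is_derive_sin (g x)) gb). Qed.

Lemma is_derive_continuous f x a : is_derive x 1 f a -> {for x, continuous f}.
Proof.
by case=> df _; apply: differentiable_continuous; exact/derivable1_diffP.
Qed.

End derive_rules.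

Lemma derX {R : realType} (f : R -> R) (n : nat) (x a : R) : is_derive x 1 f a ->
  is_derive x 1 (fun y => f y ^+ n) (n%:R * f x ^+ n.-1 * a).
Proof.
move=> fa; elim: n => [|n IH].
  by apply: (is_derive_eq (derC x 1)); rewrite !mul0r.
rewrite (_ : (fun y => _) = fun y => f y * f y ^+ n); last first.
  by apply/funext => y; rewrite exprS.
apply: (is_derive_eq (derM _ _ _ _ _ fa IH)); case: n {IH} => [|n] /=.
  by rewrite expr0; ring.
by rewrite exprS -[n.+2%:R]natr1; ring.
Qed.

(** The value of the derivative stays an existential variable and is compared with the wanted one
    afterwards by [ring] or [field]. Side conditions, [f x != 0] for inverses and [0 < g x] for
    logarithms, are taken from the context; this is why proofs put such facts there before calling
    [derive_auto] or [cont_auto]. *)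
Ltac derive_step := first [eassumption | lazymatch goal with
  | |- is_derive _ _ (fun _ => ?c) _ => apply: derC
  | |- is_derive _ _ (fun y => y) _ => apply: derI
  | |- is_derive _ _ (fun y => GRing.add (@?f y) (@?g y)) _ => eapply (@derD _ f g)
  | |- is_derive _ _ (fun y => GRing.mul (@?f y) (@?g y)) _ => eapply (@derM _ f g)
  | |- is_derive _ _ (fun y => GRing.opp (@?f y)) _ => eapply (@derN _ f)
  | |- is_derive _ _ (fun y => GRing.inv (@?f y)) _ => eapply (@derV _ f)
  | |- is_derive _ _ (fun y => GRing.exp (@?f y) ?n) _ => eapply (@derX _ f n)
  | |- is_derive _ _ (fun y => expR (@?f y)) _ => eapply (@der_expR _ f)
  | |- is_derive _ _ (fun y => cos (@?f y)) _ => eapply (@der_cos _ f)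
  | |- is_derive _ _ (fun y => sin (@?f y)) _ => eapply (@der_sin _ f)
  | |- is_derive _ _ (fun y => ln (@?f y)) _ => eapply (@der_ln _ f)
  end].
Ltac derive_auto := eapply is_derive_eq; [by repeat derive_step | ].
Ltac cont_auto := eapply is_derive_continuous; by repeat derive_step.

(** In the integrands below [u^s] is always written [expR (s * ln u)], a form that the derivative
    and measurability tactics can traverse. *)
Lemma is_derive_pow {R : realType} (s u : R) : 0 < u ->
  is_derive u 1 (fun u => expR (s * ln u)) (s * expR ((s - 1) * ln u)).
Proof.
move=> u0; derive_auto.
rewrite mulrBl mul1r expRB lnK ?posrE//.
by field; exact: lt0r_neq0.
Qed.

Section integrable_rules.
Context {R : realType}.
Implicit Types (D : set R) (f g : R -> R) (c : R).

Lemma integZ D f c : measurable D -> integ D f -> integ D (fun x => c * f x).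
Proof.
by move=> mD fi; exact: (@integrableZl _ (measurableTypeR R) R lebesgue_measure D mD c (EFin \o f) fi).
Qed.

Lemma integD D f g : measurable D -> integ D f -> integ D g ->
  integ D (fun x => f x + g x).
Proof.
by move=> mD fi gi; exact: (@integrableD _ (measurableTypeR R) R lebesgue_measure D mD (EFin \o f) (EFin \o g) fi gi).
Qed.

Lemma integB D f g : measurable D -> integ D f -> integ D g ->
  integ D (fun x => f x - g x).
Proof.
by move=> mD fi gi; exact: (@integrableB _ (measurableTypeR R) R lebesgue_measure D mD (EFin \o f) (EFin \o g) fi gi).
Qed.

Lemma eq_integ D f g : measurable D -> (forall x, D x -> f x = g x) ->
  integ D f -> integ D g.
Proof.
move=> mD fg fi.
apply: (@eq_integrable _ (measurableTypeR R) R lebesgue_measure D mD (EFin \o f) (EFin \o g)) => // x /set_mem Dx.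
by rewrite /= fg.
Qed.

Lemma eq_Rint D f g : (forall x, D x -> f x = g x) ->
  \int[mu]_(x in D) f x = \int[mu]_(x in D) g x.
Proof. by move=> fg; apply: eq_Rintegral => x /set_mem/fg. Qed.

End integrable_rules.

Lemma expRln_cvg0 {R : realType} (s : R) : 0 < s ->
  expR (s * ln u) @[u --> 0^'+] --> (0 : R).
Proof.
move=> s0; have := powR_cvg0 s0; apply: cvg_trans; apply: near_eq_cvg.
near=> u; rewrite /powR; case: eqP => [u0|//].
by have : 0 < u by []; rewrite u0 ltxx.
Unshelve. all: by end_near. Qed.

Lemma expRln_cvgy {R : realType} (s : R) : 0 < s ->
  expR (s * ln u) @[u --> +oo] --> +oo.
Proof.
move=> s0; apply/cvgryPge => A; near=> u.
have u0 : 0 < u by near: u; exact: nbhs_pinfty_gt.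
rewrite (@le_trans _ _ (expR A))//.
  by rewrite (le_trans _ (expR_ge1Dx _))// lerDr.
by rewrite ler_expR -ler_pdivrMl// -ler_expR lnK ?posrE//.
Unshelve. all: by end_near. Qed.

(** [u^m e^(-u)] is largest at [u = m]; the inequality is [ln z <= z - 1] at [z = u / m], multiplied
    by [m]. *)
Lemma expRln_le {R : realType} (m u : R) : 0 < m -> 0 < u ->
  expR (m * ln u) <= expR (m * ln m - m) * expR u.
Proof.
move=> m0 u0; rewrite -expRD ler_expR.
have um : 0 < u / m by rewrite divr_gt0.
have : ln (1 + (u / m - 1)) <= u / m - 1 by apply: le_ln1Dx; lra.
rewrite addrC subrK ln_div ?posrE// -(ler_pM2l m0) !mulrBr mulr1 mulrCA divff ?gt_eqF// mulr1.
by lra.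
Qed.

(** The integrand [e^(-u) u^(s-1)] of Euler's integral at a real argument. *)
Definition gammad {R : realType} (s u : R) : R := expR (- u) * expR ((s - 1) * ln u).

Lemma gammad_ge0 {R : realType} (s u : R) : 0 <= gammad s u.
Proof. by rewrite mulr_ge0 ?expR_ge0. Qed.

Lemma measurable_expRM_ln {R : realType} (s : R) (D : set R) :
  measurable_fun D (fun u => expR (s * ln u)).
Proof.
apply: measurable_funTS; apply: measurableT_comp => //.
by apply: measurable_funM => //; exact: measurable_ln.
Qed.

Lemma measurable_gammad {R : realType} (s : R) (D : set R) :
  measurable_fun D (gammad s).
Proof.
apply: measurable_funM; last exact: measurable_expRM_ln.
by apply: measurable_funTS; apply: measurableT_comp => //; exact: measurable_oppr.
Qed.

(** The comparison function [h] is the derivative of [- 1 / (1 + u^s)], which has limits at both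
    ends. It behaves like [u^(s-1)] at [0], so a single majorant covers the whole half-line. *)
Lemma integrable_gammad {R : realType} (s : R) : 0 < s ->
  integ `]0, +oo[ (gammad s).
Proof.
move=> s0.
pose h (u : R) := s * expR ((s - 1) * ln u) / (1 + expR (s * ln u)) ^+ 2.
pose F (u : R) := - (1 + expR (s * ln u))^-1.
have D_gt0 (u : R) : 0 < 1 + expR (s * ln u) by rewrite addr_gt0 ?expR_gt0.
have D_neq0 (u : R) : 1 + expR (s * ln u) != 0 by rewrite gt_eqF.
have hi : integ `]0, +oo[ h.
  apply: (@ge0_FTC2_oy _ 0 h F (- (1 + 0)^-1) (- 0)).
  - by move=> u u0; rewrite divr_ge0 ?exprn_ge0// ?ltW// mulr_gt0 ?expR_gt0.
  - move=> u u0; have dp := @is_derive_pow _ s u u0.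
    rewrite /F; derive_auto.
    by rewrite /h; field.
  - move=> u u0; have dp := @is_derive_pow _ s u u0.
    have dp' := @is_derive_pow _ (s - 1) u u0.
    have D2_neq0 : (1 + expR (s * ln u)) ^+ 2 != 0 by rewrite expf_neq0.
    by rewrite /h; cont_auto.
  - apply: cvgN; apply: cvgV; first by rewrite addr0 oner_neq0.
    by apply: cvgD; [exact: cvg_cst|exact: expRln_cvg0].
  - apply: cvgN; apply/gtr0_cvgV0; first by near=> u; exact: D_gt0.
    have /cvgryPge sy := expRln_cvgy s s0.
    apply/cvgryPge => A; apply: filterS (sy A) => u Au.
    by rewrite (le_trans Au)// lerDr.
(* What is needed is [(1 + u^s)^2 <= K e^u]. It follows from [(1 + p)^2 <= 2 + 2 p^2], [1 <= e^u]
   and [expRln_le] for [p^2 = u^(2s)]. *)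
pose K := 2 + 2 * expR (2 * s * ln (2 * s) - 2 * s).
apply: (@integrable_dominated _ _ _ (fun u => K / s * h u)) => //.
- exact: measurable_gammad.
- exact: integZ.
- move=> u; rewrite /= in_itv/= andbT => u0; rewrite ger0_norm ?gammad_ge0//.
  rewrite /gammad /h.
  have := expRln_le (2 * s) u (mulr_gt0 (ltr0Sn R 1) s0) u0.
  set C := expR (2 * s * ln (2 * s) - 2 * s); set q := expR ((s - 1) * ln u).
  rewrite (_ : 2 * s * ln u = s * ln u *+ 2); last by ring.
  rewrite -mulr_natl expRM_natl; have := D_neq0 u; have := D_gt0 u.
  have : 0 < q by exact: expR_gt0.
  set p := expR (s * ln u) => q0 p0 pn0 pC.
  rewrite (_ : K / s * (s * q / (1 + p) ^+ 2) = q * (K / (1 + p) ^+ 2)); last first.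
    by field; rewrite pn0 gt_eqF.
  rewrite mulrC ler_pM2l// ler_pdivlMr ?exprn_gt0// expRN.
  have e0 : 1 <= expR u by rewrite -expR0 ler_expR ltW.
  rewrite ler_pdivrMl ?expR_gt0//.
  have p0' : 0 < p by exact: expR_gt0.
  have : 0 <= (1 - p) ^+ 2 by exact: sqr_ge0.
  rewrite /K -/C => ?; nra.
Unshelve. all: by end_near. Qed.

(** * Fubini's theorem for kernels dominated by a product *)

Section fubini_product.
Context {R : realType}.
Context (D1 D2 : set R) (h : R -> R -> R) (g1 g2 : R -> R).
Local Notation T := (measurableTypeR R).
Context (mD1 : measurable D1).
Context (mD2 : measurable D2).
Context (mh : measurable_fun [set: T * T] (fun z => h z.1 z.2)).
Context (g1i : integ D1 g1).
Context (g2i : integ D2 g2).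
Context (hg : forall t u, D1 t -> D2 u -> `|h t u| <= g1 t * g2 u).

(** Extending the kernel by zero moves the problem to the whole plane; [k1] and [k2] extend [|g1|]
    and [|g2|] likewise, so that the product bound holds everywhere. *)
Let H (z : T * T) : R := h z.1 z.2 * \1_D1 z.1 * \1_D2 z.2.

Let mH : measurable_fun [set: T * T] H.
Proof.
apply: measurable_funM; first apply: measurable_funM => //.
- by apply: (measurableT_comp (measurable_indic mD1)); exact: measurable_fst.
- by apply: (measurableT_comp (measurable_indic mD2)); exact: measurable_snd.
Qed.

Let k1 := (Num.norm \o g1) \_ D1.
Let k2 := (Num.norm \o g2) \_ D2.

Let k1i : integ setT k1.
Proof.
rewrite -restrict_EFin.
by apply/(integrable_mkcond _ _).1 => //; exact: integrable_norm.
Qed.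

Let k2i : integ setT k2.
Proof.
rewrite -restrict_EFin.
by apply/(integrable_mkcond _ _).1 => //; exact: integrable_norm.
Qed.

Let k_ge0 (g : R -> R) D u : 0 <= ((Num.norm \o g) \_ D) u.
Proof. by rewrite patchE; case: ifP => //= _; rewrite normr_ge0. Qed.

Let Hk t u : `|H (t, u)| <= k1 t * k2 u.
Proof.
rewrite /H /= /k1 /k2 !patchE !indicE.
case: (boolP (t \in D1)) => [/set_mem D1t|_]; last first.
  by rewrite mulr0 mul0r normr0 mul0r.
case: (boolP (u \in D2)) => [/set_mem D2u|_]; last by rewrite mulr0 normr0 mulr0.
by rewrite !mulr1 /= -normrM (le_trans (hg _ _ D1t D2u))// ler_norm.
Qed.

Let Hi : (lebesgue_measure \x lebesgue_measure)%E.-integrable [set: T * T] (EFin \o H).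
Proof.
apply/integrable12ltyP; first by apply/measurable_EFinP; exact: mH.
have K2 : (\int[mu]_u (k2 u)%:E = (\int[mu]_u k2 u)%:E)%E.
  by rewrite fineK//; exact: integrable_fin_num.
apply: (@le_lt_trans _ _ (\int[mu]_t ((\int[mu]_u k2 u) * k1 t)%:E)%E); last first.
  have /(integrable_fin_num measurableT) : integ setT (fun t => (\int[mu]_u k2 u) * k1 t) by exact: integZ.
  by rewrite fin_numE => /andP[_]; rewrite -ltey.
apply: ge0_le_integral => //.
- by move=> t _; exact: integral_ge0.
- apply: (@measurable_fun_fubini_tonelli_F _ _ _ _ _ _ (fun z => `|(EFin \o H) z|%E)) => //.
  apply: measurableT_comp => //; apply/measurable_EFinP; exact: mH.
- by apply: measurable_fun_EFin; apply: measurable_funM => //; exact: integrable_measurable_fun.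
- move=> t _.
  apply: (@le_trans _ _ (\int[mu]_u (k1 t * k2 u)%:E)%E).
    apply: ge0_le_integral => //.
    + apply: measurableT_comp => //; apply/measurable_EFinP.
      by apply: (measurableT_comp mH); exact: pair1_measurable.
    + by apply: measurable_fun_EFin; apply: measurable_funM => //; exact: integrable_measurable_fun.
    + by move=> u _; rewrite lee_fin; exact: Hk.
  under eq_integral do rewrite EFinM.
  by rewrite integralZl// K2 -EFinM mulrC.
Qed.

Let hi1 t : D1 t -> integ D2 (h t).
Proof.
move=> D1t; apply: (@integrable_dominated _ _ _ (fun u => g1 t * g2 u)) => //.
- by apply: measurable_funTS; apply: (measurableT_comp mh (pair1_measurable t)).
- exact: integZ.
- by move=> u; exact: hg.
Qed.

Let hi2 u : D2 u -> integ D1 (h ^~ u).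
Proof.
move=> D2u; apply: (@integrable_dominated _ _ _ (fun t => g2 u * g1 t)) => //.
- by apply: measurable_funTS; apply: (measurableT_comp mh (pair2_measurable u)).
- exact: integZ.
- by move=> t D1t; rewrite mulrC; exact: hg.
Qed.

Let inner1 t : (\int[mu]_u (H (t, u))%:E)%E =
  (((fun t => \int[mu]_(u in D2) h t u) \_ D1) t)%:E.
Proof.
rewrite patchE; case: ifPn => D1t.
  rewrite fineK; last by apply: integrable_fin_num => //; apply: hi1; exact: set_mem.
  rewrite [RHS]integral_mkcond; apply: eq_integral => u _.
  by rewrite /H/= indicE D1t mulr1 patchE indicE; case: ifP => _; rewrite ?mulr1 ?mulr0.
rewrite integral0_eq// => u _.
by rewrite /H/= indicE (negbTE D1t) mulr0 mul0r.
Qed.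

Let inner2 u : (\int[mu]_t (H (t, u))%:E)%E =
  (((fun u => \int[mu]_(t in D1) h t u) \_ D2) u)%:E.
Proof.
rewrite patchE; case: ifPn => D2u.
  rewrite fineK; last by apply: integrable_fin_num => //; apply: hi2; exact: set_mem.
  rewrite [RHS]integral_mkcond; apply: eq_integral => t _.
  by rewrite /H/= [X in _ * X]indicE D2u mulr1 patchE indicE; case: ifP => _; rewrite ?mulr1 ?mulr0.
rewrite integral0_eq// => t _.
by rewrite /H/= [X in _ * X]indicE (negbTE D2u) mulr0.
Qed.

Lemma integrable_fubini_product : integ D1 (fun t => \int[mu]_(u in D2) h t u).
Proof.
apply: (@integrable_mkcond _ T R lebesgue_measure D1 _ mD1).2; rewrite restrict_EFin.
apply: eq_integrable (integrable_fubini_F Hi) => // t _.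
by rewrite /fubini_F /= inner1.
Qed.

Lemma Rintegral_fubini_product :
  \int[mu]_(t in D1) \int[mu]_(u in D2) h t u =
  \int[mu]_(u in D2) \int[mu]_(t in D1) h t u.
Proof.
rewrite Rintegral_mkcond [RHS]Rintegral_mkcond /Rintegral.
under eq_integral do rewrite -inner1.
under [in RHS]eq_integral do rewrite -inner2.
by rewrite (Fubini Hi).
Qed.

End fubini_product.

(** * Folding an integral over the line onto the half-line *)

Section fold_line.
Context {R : realType}.
Implicit Types (h k : R -> R).

Let ge0_oppr k : continuous k -> (forall t, 0 <= k t) ->
  (\int[mu]_(t in `]-oo, 0%R]) (k t)%:E = \int[mu]_(t in `[0%R, +oo[) (k (- t))%:E)%E.
Proof.
move=> ck k0; rewrite -[X in `]-oo, X]]oppr0 ge0_integration_by_substitutionNy//.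
exact: continuous_subspaceT.
Qed.

Let integ_oppr h : continuous h -> integ setT h -> integ `[0, +oo[ (fun t => h (- t)).
Proof.
move=> ch hi.
have ch' : continuous (fun t => h (- t)) by move=> t; apply: continuous_comp; [exact: opp_continuous|exact: ch].
have cn : continuous (fun t => `|h t|) by move=> t; apply: continuous_comp; [exact: ch|exact: norm_continuous].
apply/integrableP; split.
  by apply: measurable_fun_EFin; apply: measurable_funTS; exact: continuous_measurable_fun.
rewrite -(ge0_oppr (fun t => `|h t|))//.
have : integ `]-oo, 0] h by apply: integrableS hi.
by move/integrableP => -[].
Qed.

(** The substitution [t -> - t] is first established for non-negative functions;
    [h = (|h| + h) - |h|] writes [h] as a difference of two continuous ones. *)
Let Rint_oppr h : continuous h -> integ setT h ->
  \int[mu]_(t in `]-oo, 0]) h t = \int[mu]_(t in `[0, +oo[) h (- t).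
Proof.
move=> ch hi.
have cn : continuous (fun t => `|h t|) by move=> t; apply: continuous_comp; [exact: ch|exact: norm_continuous].
have ni : integ setT (fun t => `|h t|) by exact: (integrable_norm hi).
have mN : measurable `]-oo, (0:R)] by [].
have mP : measurable `[(0:R), +oo[ by [].
have E k : continuous k -> (forall t, 0 <= k t) ->
    \int[mu]_(t in `]-oo, 0]) k t = \int[mu]_(t in `[0, +oo[) k (- t).
  by move=> ck k0; rewrite /Rintegral ge0_oppr.
have NS k : integ setT k -> integ `]-oo, 0] k by move=> ki; apply: integrableS ki.
have -> : h = fun t => (`|h t| + h t) - `|h t|.
  by apply/funext => t; rewrite addrC addKr.
have ci : continuous (fun t => `|h t| + h t).
  by move=> t; apply: cvgD; [exact: cn|exact: ch].
have ii : integ setT (fun t => `|h t| + h t) by exact: integD.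
rewrite RintegralB//; [|exact: NS|exact: NS].
rewrite (E _ cn) ?(E _ ci)//; last by move=> t; rewrite -lerBlDl sub0r lerNl ler_normr lexx orbT.
rewrite -RintegralB//.
- exact: (integ_oppr _ ci ii).
- exact: (integ_oppr _ cn ni).
Qed.

Lemma Rintegral_fold h : continuous h -> integ setT h ->
  \int[mu]_t h t = \int[mu]_(t in `]0, +oo[) (h t + h (- t)).
Proof.
move=> ch hi.
have oi := integ_oppr _ ch hi.
have oi' : integ `]0, +oo[ (fun t => h (- t)).
  by apply: integrableS oi => //; apply: subset_itvr; rewrite bnd_simp.
rewrite RintegralD//; last by apply: integrableS hi.
rewrite addrC (Rintegral_itv_obnd_cbnd oi') -Rint_oppr//.
rewrite -Rintegral_setU//.
- by congr (Rintegral _ _ _); rewrite -setCitvl setUv.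
- by rewrite -setCitvl setUv.
- by apply/disj_setPS => x [/=]; rewrite !in_itv/= andbT => x0; rewrite ltNge x0.
Qed.

End fold_line.

Section measurable_rules.
Context {R : realType} {d} {T : measurableType d} {D : set T}.
Implicit Types (f g : T -> R).

Lemma mfD f g : measurable_fun D f -> measurable_fun D g -> measurable_fun D (fun z => f z + g z).
Proof. exact: measurable_funD. Qed.

Lemma mfM f g : measurable_fun D f -> measurable_fun D g -> measurable_fun D (fun z => f z * g z).
Proof. exact: measurable_funM. Qed.

Lemma mfX f n : measurable_fun D f -> measurable_fun D (fun z => f z ^+ n).
Proof. exact: measurable_funX. Qed.

Lemma mfC (c : R) : measurable_fun D (fun=> c).
Proof. exact: measurable_cst. Qed.

Lemma mf_continuous (h : R -> R) f : continuous h ->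
  measurable_fun D f -> measurable_fun D (fun z => h (f z)).
Proof. by move=> ch mf; exact: (measurableT_comp (continuous_measurable_fun ch) mf). Qed.

Lemma mfN f : measurable_fun D f -> measurable_fun D (fun z => - f z).
Proof. by move=> mf; apply: (mf_continuous (fun r => - r)) => //; exact: opp_continuous. Qed.

Lemma mf_expR f : measurable_fun D f -> measurable_fun D (fun z => expR (f z)).
Proof. exact: (mf_continuous _ _ (@continuous_expR R)). Qed.

Lemma mf_cos f : measurable_fun D f -> measurable_fun D (fun z => cos (f z)).
Proof. exact: (mf_continuous _ _ (@continuous_cos R)). Qed.

Lemma mf_sin f : measurable_fun D f -> measurable_fun D (fun z => sin (f z)).
Proof. exact: (mf_continuous _ _ (@continuous_sin R)). Qed.

Lemma mf_ln f : measurable_fun D f -> measurable_fun D (fun z => ln (f z)).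
Proof. by move=> mf; exact: (measurableT_comp (@measurable_ln R) mf). Qed.

End measurable_rules.
Ltac meas_step := first [eassumption | lazymatch goal with
  | |- measurable_fun _ (fun _ => ?c) => apply: mfC
  | |- measurable_fun _ (fun y => y) => apply: measurable_id
  | |- measurable_fun _ (fun y => fst y) => apply: measurable_funTS; apply: measurable_fst
  | |- measurable_fun _ (fun y => snd y) => apply: measurable_funTS; apply: measurable_snd
  | |- measurable_fun _ (fun y => GRing.add (@?f y) (@?g y)) => eapply (@mfD _ _ _ _ f g)
  | |- measurable_fun _ (fun y => GRing.mul (@?f y) (@?g y)) => eapply (@mfM _ _ _ _ f g)
  | |- measurable_fun _ (fun y => GRing.opp (@?f y)) => eapply (@mfN _ _ _ _ f)
  | |- measurable_fun _ (fun y => GRing.exp (@?f y) ?n) => eapply (@mfX _ _ _ _ f n)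
  | |- measurable_fun _ (fun y => expR (@?f y)) => eapply (@mf_expR _ _ _ _ f)
  | |- measurable_fun _ (fun y => cos (@?f y)) => eapply (@mf_cos _ _ _ _ f)
  | |- measurable_fun _ (fun y => sin (@?f y)) => eapply (@mf_sin _ _ _ _ f)
  | |- measurable_fun _ (fun y => ln (@?f y)) => eapply (@mf_ln _ _ _ _ f)
  end].
Ltac meas_auto := by repeat meas_step.

Lemma measurable_oy {R : realType} (a : R) : measurable `]a, +oo[.
Proof. by []. Qed.

Lemma expR_cvg0 {R : realType} (e : R) : 0 < e -> expR (- (e * t)) @[t --> +oo] --> (0 : R).
Proof.
move=> e0; apply/cvgrPdist_le => d d0; near=> t.
rewrite sub0r normrN ger0_norm ?expR_ge0//.
rewrite -[leRHS]lnK ?posrE// ler_expR lerNl -ler_pdivrMl//.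
Unshelve. all: by end_near. Qed.

Lemma cvg_bounded_expR {R : realType} (e M : R) (g : R -> R) : 0 < e ->
  (forall t, `|g t| <= M) -> expR (- (e * t)) * g t @[t --> +oo] --> (0 : R).
Proof.
move=> e0 gM; have h : M * expR (- (e * t)) @[t --> +oo] --> (0 : R).
  by rewrite -[X in _ --> X](mulr0 M); apply: cvgM; [exact: cvg_cst|exact: expR_cvg0].
apply: norm_cvg0; apply: squeeze_cvgr (cvg_cst _) h.
near=> t; rewrite normr_ge0/= normrM ger0_norm ?expR_ge0// mulrC.
by rewrite ler_wpM2r ?expR_ge0.
Unshelve. all: by end_near. Qed.

Section laplace.
Context {R : realType} (e : R).
Context (e0 : 0 < e).

Lemma integrable_expRN : integ `]0, +oo[ (fun t => expR (- (e * t))).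
Proof.
have en0 : e != 0 by rewrite gt_eqF.
have dF (x : R) : is_derive x 1 (fun t => - (expR (- (e * t)) / e)) (expR (- (e * x))).
  by derive_auto; field.
apply: (@ge0_FTC2_oy _ 0 _ (fun t => - (expR (- (e * t)) / e)) (- (expR (- (e * 0)) / e)) (- (0 / e))).
- by move=> x _; rewrite expR_ge0.
- by move=> x _; cont_auto.
- by apply: cvg_at_right_filter; exact: (is_derive_continuous _ _ _ (dF 0)).
- by apply: cvgN; apply: cvgM; [exact: expR_cvg0|exact: cvg_cst].
Qed.

Lemma integrable_expRN_M (g : R -> R) : continuous g -> (forall t, `|g t| <= 1) ->
  integ `]0, +oo[ (fun t => expR (- (e * t)) * g t).
Proof.
move=> cg g1; apply: (integrable_dominated _ _ _ _ _ integrable_expRN) => //.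
  have mg : measurable_fun `](0:R), +oo[ g by apply: measurable_funTS; exact: continuous_measurable_fun.
  by meas_auto.
by move=> t _; rewrite normrM ger0_norm ?expR_ge0// ler_piMr ?expR_ge0.
Qed.

Lemma integrable_laplace_cos (k : R) : integ `]0, +oo[ (fun t => expR (- (e * t)) * cos (k * t)).
Proof.
apply: integrable_expRN_M => [t|t]; last exact: cos_max.
by cont_auto.
Qed.

Lemma integrable_laplace_sin (k : R) : integ `]0, +oo[ (fun t => expR (- (e * t)) * sin (k * t)).
Proof.
apply: integrable_expRN_M => [t|t]; last exact: sin_max.
by cont_auto.
Qed.

Let ek0 (k : R) : e ^+ 2 + k ^+ 2 != 0.
Proof. by rewrite gt_eqF// ltr_wpDr ?sqr_ge0// exprn_gt0. Qed.

Lemma laplace_cos (k : R) :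
  \int[mu]_(t in `]0, +oo[) (expR (- (e * t)) * cos (k * t)) = e / (e ^+ 2 + k ^+ 2).
Proof.
(* The real part of [- e^(-(e - i k) t) / (e - i k)]; [laplace_sin] uses the imaginary part. *)
pose F t : R := expR (- (e * t)) * ((k * sin (k * t) - e * cos (k * t)) / (e ^+ 2 + k ^+ 2)).
have dF (x : R) : is_derive x 1 F (expR (- (e * x)) * cos (k * x)).
  by rewrite /F; derive_auto; field.
rewrite (@FTC2_oy _ 0 _ F (F 0) 0 (integrable_laplace_cos k)) //.
- by rewrite /F !mulr0 oppr0 expR0 sin0 cos0; field.
- by move=> x _; cont_auto.
- by apply: cvg_at_right_filter; exact: (is_derive_continuous _ _ _ (dF 0)).
- apply: (cvg_bounded_expR e ((`|k| + e) / (e ^+ 2 + k ^+ 2))) => // t.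
  have p : 0 < e ^+ 2 + k ^+ 2 by rewrite ltr_wpDr ?sqr_ge0// exprn_gt0.
  rewrite normrM normfV (gtr0_norm p) ler_pM2r ?invr_gt0//.
  rewrite (le_trans (ler_normB _ _))// !normrM (gtr0_norm e0) lerD//.
    by rewrite ler_piMr// sin_max.
  by rewrite ler_piMr ?cos_max// ltW.
Qed.

Lemma laplace_sin (k : R) :
  \int[mu]_(t in `]0, +oo[) (expR (- (e * t)) * sin (k * t)) = k / (e ^+ 2 + k ^+ 2).
Proof.
pose F t : R := expR (- (e * t)) * ((- e * sin (k * t) - k * cos (k * t)) / (e ^+ 2 + k ^+ 2)).
have dF (x : R) : is_derive x 1 F (expR (- (e * x)) * sin (k * x)).
  by rewrite /F; derive_auto; field.
rewrite (@FTC2_oy _ 0 _ F (F 0) 0 (integrable_laplace_sin k)) //.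
- by rewrite /F !mulr0 oppr0 expR0 sin0 cos0; field.
- by move=> x _; cont_auto.
- by apply: cvg_at_right_filter; exact: (is_derive_continuous _ _ _ (dF 0)).
- apply: (cvg_bounded_expR e ((e + `|k|) / (e ^+ 2 + k ^+ 2))) => // t.
  have p : 0 < e ^+ 2 + k ^+ 2 by rewrite ltr_wpDr ?sqr_ge0// exprn_gt0.
  rewrite normrM normfV (gtr0_norm p) ler_pM2r ?invr_gt0//.
  rewrite (le_trans (ler_normB _ _))// !normrM normrN (gtr0_norm e0) lerD//.
    by rewrite ler_piMr ?sin_max// ltW.
  by rewrite ler_piMr// cos_max.
Qed.

End laplace.

Lemma Rintegral_oneDsqrV {R : realType} :
  integ setT (fun q : R => (1 + q ^+ 2)^-1) /\ \int[mu]_q (1 + q ^+ 2)^-1 = pi :> R.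
Proof.
have c : continuous (fun q : R => (1 + q ^+ 2)^-1).
  move=> q; have n0 : 1 + q ^+ 2 != 0 by rewrite gt_eqF// ltr_wpDr// sqr_ge0.
  by cont_auto.
have p (q : R) : 0 <= (1 + q ^+ 2)^-1 by rewrite invr_ge0 addr_ge0// sqr_ge0.
have E : (\int[mu]_q ((1 + q ^+ 2)^-1)%:E = (pi : R)%:E)%E.
  rewrite ge0_symfun_integralT//; last by move=> q; rewrite /= sqrrN.
  rewrite (_ : [set x | 0 <= x] = `[(0 : R), +oo[%classic); last first.
    by apply/seteqP; split=> x; rewrite /= in_itv/= andbT.
  by rewrite integral0y_oneDsqr -EFinM mulrC divfK.
split; last by rewrite /Rintegral E.
apply/integrableP; split; first by apply: measurable_fun_EFin; exact: continuous_measurable_fun.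
under eq_integral do rewrite gee0_abs ?lee_fin ?p//.
by rewrite E ltry.
Qed.

(** * Poisson kernel and Fourier inversion *)

Section poisson_kernel.
Context {R : realType} (f : R -> R) (M v : R).
Context (cf : continuous f).
Context (f0 : forall r, 0 <= f r).
Context (fM : forall r, f r <= M).

Lemma poisson_substitution (e : R) : 0 < e ->
  \int[mu]_r (f r * (e / (e ^+ 2 + (r - v) ^+ 2))) =
  \int[mu]_q (f (v + e * q) / (1 + q ^+ 2)).
Proof.
move=> e0.
pose F q := v + e * q.
have dF (x : R) : is_derive x 1 F e by rewrite /F; derive_auto; ring.
have F'E : derive1 F = fun=> e by apply/funext => x; rewrite derive1E; have [_ ->] := dF x.
have n0 r : e ^+ 2 + (r - v) ^+ 2 != 0.
  by rewrite gt_eqF// ltr_wpDr ?sqr_ge0// exprn_gt0.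
rewrite /Rintegral; congr fine.
rewrite (@increasing_ge0_integration_by_substitutionT _ F).
- apply: eq_integral => q _; rewrite fctE /= F'E /F; congr EFin.
  have n1 : 1 + q ^+ 2 != 0 by rewrite gt_eqF// ltr_wpDr// sqr_ge0.
  have := n0 (v + e * q).
  by rewrite (_ : v + e * q - v = e * q); [|ring] => ?; field; rewrite n1 gt_eqF// ltr_wpDr ?sqr_ge0// exprn_gt0.
- by move=> x y xy; rewrite /F ltrD2l ltr_pM2l.
- by rewrite F'E => x; exact: cvg_cst.
- by rewrite F'E; exact: is_cvg_cst.
- by rewrite F'E; exact: is_cvg_cst.
- by move=> x; have [] := dF x.
- apply/cvgrNyPle => A; near=> x.
  rewrite /F -lerBrDl -ler_pdivlMl//.
- apply/cvgryPge => A; near=> x.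
  rewrite /F -lerBlDl -ler_pdivrMl//.
- move=> r; apply: cvgM; first exact: cf.
  have n0r := n0 r.
  have : {for r, continuous (fun r => e / (e ^+ 2 + (r - v) ^+ 2))} by cont_auto.
  exact.
- by move=> r; rewrite mulr_ge0// divr_ge0 ?addr_ge0 ?sqr_ge0// ltW.
Unshelve. all: by end_near. Qed.

(** After the substitution [r = v + e q] the kernel is the fixed function [1 / (1 + q^2)], of mass
    [pi]; only [f (v + e q)] depends on [e], and [M / (1 + q^2)] dominates. *)
Lemma poisson_cvg :
  \int[mu]_r (f r * (n.+1%:R^-1 / (n.+1%:R^-1 ^+ 2 + (r - v) ^+ 2))) @[n --> \oo] --> pi * f v.
Proof.
under eq_fun do rewrite poisson_substitution//.
have [oi oE] := @Rintegral_oneDsqrV R.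
have n1 (q : R) : 1 + q ^+ 2 != 0 by rewrite gt_eqF// ltr_wpDr// sqr_ge0.
have co : continuous (fun q : R => (1 + q ^+ 2)^-1).
  by move=> q; have n1q := n1 q; cont_auto.
rewrite mulrC -oE -RintegralZl//.
apply: (Rintegral_dominated _ (fun n q => f (v + n.+1%:R^-1 * q) / (1 + q ^+ 2)) _ (fun q => M * (1 + q ^+ 2)^-1) _ _ _ _ _).2 => //.
- move=> n; apply: measurable_funM; last exact: continuous_measurable_fun.
  apply: continuous_measurable_fun => q; apply: continuous_comp; last exact: cf.
  by cont_auto.
- move=> q _; apply: cvgM; last exact: cvg_cst.
  apply: continuous_cvg; first exact: cf.
  rewrite -[X in _ --> X]addr0; apply: cvgD; first exact: cvg_cst.
  by rewrite -[X in _ --> X](mul0r q); apply: cvgM; [exact: cvg_harmonic|exact: cvg_cst].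
- exact: integZ.
- move=> n q _; rewrite normrM normfV (ger0_norm (f0 _)) (@ger0_norm _ (1 + _)) ?addr_ge0 ?sqr_ge0//.
  by rewrite ler_wpM2r ?fM// invr_ge0 addr_ge0// sqr_ge0.
Qed.

End poisson_kernel.

Section fourier_inversion.
Context {R : realType} (f kc ks : R -> R) (M v : R).
Context (cf : continuous f).
Context (f0 : forall r, 0 <= f r).
Context (fM : forall r, f r <= M).
Context (fi : integ setT f).
Context (kcE : forall t, kc t = \int[mu]_r (f r * cos (t * r))).
Context (ksE : forall t, ks t = \int[mu]_r (f r * sin (t * r))).
Context (kci : integ `]0, +oo[ kc).
Context (ksi : integ `]0, +oo[ ks).

Let integ_f_bounded (g : R -> R) : continuous g -> (forall r, `|g r| <= 1) ->
  integ setT (fun r => f r * g r).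
Proof.
move=> cg g1; apply: (integrable_dominated _ _ _ _ _ fi) => //.
  by apply: measurable_funM; exact: continuous_measurable_fun.
by move=> r _; rewrite normrM (ger0_norm (f0 _)) ler_piMr.
Qed.

(** The factor [e^(-e t)] makes the double integral absolutely convergent. After the exchange the
    [t]-integral is the Laplace transform of [cos ((r - v) t)], that is, the Poisson kernel. *)
Let abel (e : R) : 0 < e ->
  \int[mu]_(t in `]0, +oo[) (expR (- (e * t)) * (kc t * cos (t * v) + ks t * sin (t * v))) =
  \int[mu]_r (f r * (e / (e ^+ 2 + (r - v) ^+ 2))).
Proof.
move=> e0.
transitivity (\int[mu]_(t in `]0, +oo[) \int[mu]_r (f r * (expR (- (e * t)) * cos ((r - v) * t)))).
  apply: eq_Rint => t _; rewrite kcE ksE.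
  have cc : continuous (fun r : R => cos (t * r)) by move=> r; cont_auto.
  have cs : continuous (fun r : R => sin (t * r)) by move=> r; cont_auto.
  have ic := integ_f_bounded _ cc (fun r => cos_max _).
  have isn := integ_f_bounded _ cs (fun r => sin_max _).
  rewrite -!RintegralZr// -RintegralD//; last 2 first.
    by apply: eq_integ (integZ _ _ (cos (t * v)) _ ic) => // r _; rewrite mulrC.
    by apply: eq_integ (integZ _ _ (sin (t * v)) _ isn) => // r _; rewrite mulrC.
  rewrite -RintegralZl//.
    apply: eq_Rint => r _; rewrite mulrBl cosB (mulrC r) (mulrC v); ring.
  apply: integD => //.
    by apply: eq_integ (integZ _ _ (cos (t * v)) _ ic) => // r _; rewrite mulrC.
  by apply: eq_integ (integZ _ _ (sin (t * v)) _ isn) => // r _; rewrite mulrC.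
rewrite (@Rintegral_fubini_product _ _ _ _ (fun t => expR (- (e * t))) f) => //.
- apply: eq_Rint => r _; rewrite RintegralZl ?laplace_cos//.
  exact: integrable_laplace_cos.
- have mf := @mf_continuous R _ _ [set: measurableTypeR R * measurableTypeR R] f snd cf measurable_snd.
  by meas_auto.
- exact: integrable_expRN.
- move=> t r _ _; rewrite normrM (ger0_norm (f0 _)) mulrC ler_wpM2r//.
  by rewrite normrM (ger0_norm (expR_ge0 _)) ler_piMr ?expR_ge0// cos_max.
Qed.

(** Let [e = 1 / (n + 1)] tend to [0] in [abel]: [|kc| + |ks|] dominates the left-hand side, and the
    right-hand side is [poisson_cvg]. The constant is [pi], not [2 pi], because [t] runs over a
    half-line. *)
Lemma fourier_inversion :
  \int[mu]_(t in `]0, +oo[) (kc t * cos (t * v) + ks t * sin (t * v)) = pi * f v.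
Proof.
have h1 := poisson_cvg f M v cf f0 fM.
have [||||_ h2] := Rintegral_dominated `]0, +oo[
  (fun n t => expR (- (n.+1%:R^-1 * t)) * (kc t * cos (t * v) + ks t * sin (t * v)))
  (fun t => kc t * cos (t * v) + ks t * sin (t * v)) (fun t => `|kc t| + `|ks t|) (measurable_oy 0).
- move=> n.
  have := integrable_measurable_fun _ _ kci; have := integrable_measurable_fun _ _ ksi => ? ?.
  by meas_auto.
- move=> t _; rewrite -[X in _ --> X]mul1r; apply: cvgM; last exact: cvg_cst.
  rewrite [X in _ --> X](_ : 1 = expR (- (0 * t))); last by rewrite mul0r oppr0 expR0.
  apply: (continuous_cvg _ (@continuous_expR _ _)); apply: cvgN; apply: cvgM; last exact: cvg_cst.
  exact: cvg_harmonic.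
- by apply: integD => //; exact: integrable_norm.
- move=> n t; rewrite /= in_itv/= andbT => t0; rewrite normrM (ger0_norm (expR_ge0 _)).
  rewrite -[leRHS]mul1r ler_pM ?expR_ge0//.
    by rewrite expR_le1 oppr_le0 mulr_ge0// ltW.
  rewrite (le_trans (ler_normD _ _))// !normrM lerD// ler_piMr ?cos_max ?sin_max//.
rewrite -(cvg_lim _ h1)//; apply/esym; apply: cvg_lim => //.
apply: cvg_trans h2; apply: near_eq_cvg; apply: nearW => n.
by rewrite abel.
Qed.

End fourier_inversion.

(** * Fourier inversion and Mellin transforms *)

(* [kc] and [ks] are the cosine and sine transforms of [f]. *)
Definition fourier_pair {R : realType} (f kc ks : R -> R) : Prop :=
  [/\ continuous f, (forall r, 0 <= f r <= 1), integ setT f,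
   (continuous kc /\ continuous ks) &
   forall t, [/\ kc t = \int[mu]_r (f r * cos (t * r)),
                 ks t = \int[mu]_r (f r * sin (t * r)),
                 `|kc t| <= 4 * (1 + t ^+ 2)^-1 & `|ks t| <= 4 * (1 + t ^+ 2)^-1]].

Section fourier_pair_theory.
Context {R : realType} (f kc ks : R -> R).
Context (fk : fourier_pair f kc ks).

Let cf : continuous f. Proof. by case: fk. Qed.
Let f0 r : 0 <= f r. Proof. by case: fk => _ /(_ r)/andP[]. Qed.
Let f1 r : f r <= 1. Proof. by case: fk => _ /(_ r)/andP[]. Qed.
Let fi : integ setT f. Proof. by case: fk. Qed.
Let ckc : continuous kc. Proof. by case: fk => _ _ _ []. Qed.
Let cks : continuous ks. Proof. by case: fk => _ _ _ []. Qed.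

Lemma integrable_fourier_pair : integ setT kc /\ integ setT ks.
Proof.
have [oi _] := @Rintegral_oneDsqrV R; have oi4 := integZ _ _ 4 measurableT oi.
case: fk => _ _ _ _ h; split.
- apply: (integrable_dominated _ _ _ _ _ oi4) => //.
    exact: continuous_measurable_fun.
  by move=> t _; have [] := h t.
- apply: (integrable_dominated _ _ _ _ _ oi4) => //.
    exact: continuous_measurable_fun.
  by move=> t _; have [] := h t.
Qed.

Let kcN t : kc (- t) = kc t.
Proof.
case: fk => _ _ _ _ h; have [-> _ _ _] := h (- t); have [-> _ _ _] := h t.
by apply: eq_Rint => r _; rewrite mulNr cosN.
Qed.

Let ksN t : ks (- t) = - ks t.
Proof.
case: fk => _ _ _ _ h; have [_ -> _ _] := h (- t); have [_ -> _ _] := h t.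
rewrite -[RHS]mulN1r -RintegralZl//; first by apply: eq_Rint => r _; rewrite mulNr sinN; ring.
apply: (integrable_dominated _ _ _ _ _ fi) => //.
  apply: measurable_funM; apply: continuous_measurable_fun => //.
  by move=> r; cont_auto.
by move=> r _; rewrite normrM (ger0_norm (f0 _)) ler_piMr// sin_max.
Qed.

Let integ_k_bounded (k g : R -> R) : continuous k -> integ setT k ->
  continuous g -> (forall r, `|g r| <= 1) -> integ setT (fun r => k r * g r).
Proof.
move=> ck ki cg g1; apply: (integrable_dominated _ _ _ _ _ (integrable_norm ki)) => //.
  by apply: measurable_funM; exact: continuous_measurable_fun.
by move=> r _; rewrite normrM ler_piMr.
Qed.

Let cosMr (v : R) : continuous (fun t : R => cos (t * v)).
Proof. by move=> t; cont_auto. Qed.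
Let sinMr (v : R) : continuous (fun t : R => sin (t * v)).
Proof. by move=> t; cont_auto. Qed.

(** [kc] is even and [ks] odd, so this integrand is even and the one of [fourier_pair_Im] odd:
    folding doubles the former and cancels the latter. *)
Lemma fourier_pair_Re v : \int[mu]_t (kc t * cos (t * v) + ks t * sin (t * v)) = 2 * pi * f v.
Proof.
have [kci ksi] := integrable_fourier_pair.
have ci := integ_k_bounded _ _ ckc kci (cosMr v) (fun r => cos_max _).
have si := integ_k_bounded _ _ cks ksi (sinMr v) (fun r => sin_max _).
rewrite Rintegral_fold; last 2 first.
  by move=> t; apply: cvgD; apply: cvgM; [exact: ckc|exact: cosMr|exact: cks|exact: sinMr].
  exact: integD.
rewrite -mulrA -(fourier_inversion f kc ks 1 v)//.
- rewrite -RintegralZl//; last by apply: integrableS (integD _ _ _ measurableT ci si).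
  by apply: eq_Rint => t _; rewrite kcN ksN !mulNr cosN sinN; ring.
- by move=> t; case: fk => _ _ _ _ /(_ t)[].
- by move=> t; case: fk => _ _ _ _ /(_ t)[].
- by apply: integrableS kci.
- by apply: integrableS ksi.
Qed.

Lemma fourier_pair_Im v : \int[mu]_t (ks t * cos (t * v) - kc t * sin (t * v)) = 0.
Proof.
have [kci ksi] := integrable_fourier_pair.
have ci := integ_k_bounded _ _ cks ksi (cosMr v) (fun r => cos_max _).
have si := integ_k_bounded _ _ ckc kci (sinMr v) (fun r => sin_max _).
rewrite Rintegral_fold; last 2 first.
  by move=> t; apply: cvgB; apply: cvgM; [exact: cks|exact: cosMr|exact: ckc|exact: sinMr].
  exact: integB.
rewrite (_ : \int[mu]_(t in _) _ = \int[mu]_(t in `]0, +oo[) (0 : R)); last first.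
  by apply: eq_Rint => t _; rewrite kcN ksN !mulNr cosN sinN; ring.
by rewrite /Rintegral integral0.
Qed.

Context (C x : R).
Context (C0 : 0 < C).

Let wgt u : R := gammad C u * expR (- (C * ln x)).

(** With [mellin_Im], the real and imaginary parts of [Gamma(C - i t) x^(-(C - i t)) (kc t + i ks
    t)] under Euler's integral; [u^(-i t) x^(i t)] has become a rotation by [- t (ln u - ln x)]. *)
Definition mellin_Re t : R := \int[mu]_(u in `]0, +oo[)
  (gammad C u * expR (- (C * ln x)) *
   (kc t * cos (t * (ln u - ln x)) + ks t * sin (t * (ln u - ln x)))).

Definition mellin_Im t : R := \int[mu]_(u in `]0, +oo[)
  (gammad C u * expR (- (C * ln x)) *
   (ks t * cos (t * (ln u - ln x)) - kc t * sin (t * (ln u - ln x)))).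

Let wgti : integ `]0, +oo[ wgt.
Proof.
apply: eq_integ (integZ _ _ (expR (- (C * ln x))) _ (integrable_gammad C C0)) => //.
by move=> u _; rewrite mulrC.
Qed.

Let ki : integ setT (fun t => `|kc t| + `|ks t|).
Proof.
by have [? ?] := integrable_fourier_pair; apply: integD => //; exact: integrable_norm.
Qed.

Let mkc := @mf_continuous R _ _ [set: measurableTypeR R * measurableTypeR R] kc fst ckc measurable_fst.
Let mks := @mf_continuous R _ _ [set: measurableTypeR R * measurableTypeR R] ks fst cks measurable_fst.

Let kbound (a b p q : R) : `|p| <= 1 -> `|q| <= 1 -> `|a * p + b * q| <= `|a| + `|b|.
Proof.
by move=> p1 q1; rewrite (le_trans (ler_normD _ _))// !normrM lerD// ler_piMr.
Qed.

Let wgt_ge0 u : 0 <= wgt u.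
Proof. by rewrite mulr_ge0 ?gammad_ge0 ?expR_ge0. Qed.

Let bndRe t u : `|wgt u * (kc t * cos (t * (ln u - ln x)) + ks t * sin (t * (ln u - ln x)))|
  <= (`|kc t| + `|ks t|) * wgt u.
Proof.
rewrite normrM (ger0_norm (wgt_ge0 _)) mulrC ler_wpM2r//.
by apply: kbound; rewrite ?cos_max ?sin_max.
Qed.

Let bndIm t u : `|wgt u * (ks t * cos (t * (ln u - ln x)) - kc t * sin (t * (ln u - ln x)))|
  <= (`|kc t| + `|ks t|) * wgt u.
Proof.
rewrite normrM (ger0_norm (wgt_ge0 _)) mulrC ler_wpM2r// addrC -mulrN.
by apply: kbound; rewrite ?normrN ?cos_max ?sin_max.
Qed.

Let mRe : measurable_fun [set: measurableTypeR R * measurableTypeR R]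
 (fun z => wgt z.2 * (kc z.1 * cos (z.1 * (ln z.2 - ln x)) + ks z.1 * sin (z.1 * (ln z.2 - ln x)))).
Proof. by rewrite /wgt /gammad; meas_auto. Qed.

Let mIm : measurable_fun [set: measurableTypeR R * measurableTypeR R]
 (fun z => wgt z.2 * (ks z.1 * cos (z.1 * (ln z.2 - ln x)) - kc z.1 * sin (z.1 * (ln z.2 - ln x)))).
Proof. by rewrite /wgt /gammad; meas_auto. Qed.

(** The product majorant is [(|kc t| + |ks t|) * wgt u]: the transform supplies the decay in [t],
    the gamma density that in [u]. This yields the absolute convergence of the contour integrals. *)
Lemma integrable_mellin : integ setT mellin_Re /\ integ setT mellin_Im.
Proof.
split.
- apply: (integrable_fubini_product _ _ (fun t u => wgt u * (kc t * cos (t * (ln u - ln x)) + ks t * sin (t * (ln u - ln x)))) _ _ _ _ mRe ki wgti) => //.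
- apply: (integrable_fubini_product _ _ (fun t u => wgt u * (ks t * cos (t * (ln u - ln x)) - kc t * sin (t * (ln u - ln x)))) _ _ _ _ mIm ki wgti) => //.
Qed.

(** After the exchange the inner integral in [t] is the inverse Fourier transform of [f] at
    [ln u - ln x]. *)
Lemma Rintegral_mellin_Re : \int[mu]_t mellin_Re t =
  2 * pi * \int[mu]_(u in `]0, +oo[) (gammad C u * expR (- (C * ln x)) * f (ln u - ln x)).
Proof.
rewrite (Rintegral_fubini_product _ _ (fun t u => wgt u * (kc t * cos (t * (ln u - ln x)) + ks t * sin (t * (ln u - ln x)))) _ _ _ _ mRe ki wgti)//.
have [kci ksi] := integrable_fourier_pair.
rewrite -RintegralZl//; last first.
  apply: (integrable_dominated _ _ _ _ _ wgti) => //.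
    apply: measurable_funM; first exact: integrable_measurable_fun.
    apply: measurable_funTS; apply: (mf_continuous f) => //; meas_auto.
  by move=> u _; rewrite normrM (ger0_norm (wgt_ge0 _)) (ger0_norm (f0 _)) ler_piMr.
apply: eq_Rint => u _; rewrite RintegralZl//; first by rewrite fourier_pair_Re /wgt; ring.
apply: integD => //.
- by apply: integ_k_bounded => //; first [exact: cosMr | move=> r; exact: cos_max].
- by apply: integ_k_bounded => //; first [exact: sinMr | move=> r; exact: sin_max].
Qed.

Lemma Rintegral_mellin_Im : \int[mu]_t mellin_Im t = 0.
Proof.
rewrite (Rintegral_fubini_product _ _ (fun t u => wgt u * (ks t * cos (t * (ln u - ln x)) - kc t * sin (t * (ln u - ln x)))) _ _ _ _ mIm ki wgti)//.
have [kci ksi] := integrable_fourier_pair.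
rewrite (_ : \int[mu]_(t in _) _ = \int[mu]_(t in `]0, +oo[) (0 : R)); last first.
  apply: eq_Rint => u _; rewrite RintegralZl//; first by rewrite fourier_pair_Im mulr0.
  apply: integB => //.
  - by apply: integ_k_bounded => //; first [exact: cosMr | move=> r; exact: cos_max].
  - by apply: integ_k_bounded => //; first [exact: sinMr | move=> r; exact: sin_max].
by rewrite /Rintegral integral0.
Qed.

End fourier_pair_theory.

Section exponential_kernels.
Context {R : realType}.
Implicit Types (t r v : R).

(* [1 / (w (1 - w))] on [Re w = 1/2] is the Fourier transform of [tent], and
   [1 / (w (w - 1))] on [Re w = 3/2] that of [ramp], which vanishes for [r <= 0];
   the latter is written with [(r + |r|) / 2] to make continuity evident. *)
Definition tent r : R := expR (- (2^-1 * `|r|)).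
Definition ramp r : R :=
  expR (- (2^-1 * ((r + `|r|) / 2))) - expR (- (3 / 2 * ((r + `|r|) / 2))).

Let tent_oy r : 0 < r -> tent r = expR (- (2^-1 * r)).
Proof. by move=> r0; rewrite /tent gtr0_norm. Qed.

Let ramp_oy r : 0 < r -> ramp r = expR (- (2^-1 * r)) - expR (- (3 / 2 * r)).
Proof. by move=> r0; rewrite /ramp gtr0_norm// (_ : (r + r) / 2 = r)//; field. Qed.

Let tentN r : tent (- r) = tent r. Proof. by rewrite /tent normrN. Qed.

Lemma ramp_le0 r : r <= 0 -> ramp r = 0.
Proof. by move=> r0; rewrite /ramp ler0_norm// subrr mul0r !mulr0 subrr. Qed.

Lemma ramp_gt0 r : 0 <= r -> ramp r = expR (- (2^-1 * r)) - expR (- (3 / 2 * r)).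
Proof. by move=> r0; rewrite /ramp ger0_norm// (_ : (r + r) / 2 = r)//; field. Qed.

Let rampN r : 0 < r -> ramp (- r) = 0.
Proof. by move=> r0; rewrite ramp_le0// oppr_le0 ltW. Qed.

Let cnorm : continuous (fun r => `|r|).
Proof. exact: norm_continuous. Qed.

Let continuous_expRM (g : R -> R) (c : R) : continuous g -> continuous (fun r => expR (- (c * g r))).
Proof.
move=> cg r; apply: continuous_comp; last exact: continuous_expR.
by apply: cvgN; apply: cvgM; [exact: cvg_cst|exact: cg].
Qed.

Let ctent : continuous tent.
Proof. exact: continuous_expRM. Qed.

Let cramp : continuous ramp.
Proof.
have c : continuous (fun r => (r + `|r|) / 2).
  move=> r; apply: cvgM; last exact: cvg_cst.
  by apply: cvgD; [exact: cvg_id|exact: cnorm].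
have c1 := continuous_expRM _ 2^-1 c; have c2 := continuous_expRM _ (3 / 2) c.
by move=> r; apply: cvgB; [exact: c1|exact: c2].
Qed.

Let tent01 r : 0 <= tent r <= 1.
Proof. by rewrite expR_ge0 expR_le1 oppr_le0 mulr_ge0 ?invr_ge0. Qed.

Let ramp_tent r : 0 <= ramp r <= tent r.
Proof.
have [r0|r0] := leP r 0.
  by rewrite ramp_le0// lexx; have /andP[] := tent01 r.
rewrite ramp_oy// tent_oy// subr_ge0 ler_expR lerN2 ler_wpM2r ?(ltW r0)//=; last by lra.
by rewrite gerBl expR_ge0.
Qed.

Let tenti : integ setT tent.
Proof.
apply/integrableP; split; first by apply: measurable_fun_EFin; exact: continuous_measurable_fun.
under eq_integral do rewrite gee0_abs ?lee_fin ?(proj1 (andP (tent01 _)))//.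
rewrite ge0_symfun_integralT//; last 2 first.
  by move=> x; have /andP[] := tent01 x.
  by move=> x /=; rewrite tentN.
rewrite (_ : [set x | 0 <= x] = `[(0 : R), +oo[%classic); last first.
  by apply/seteqP; split=> x; rewrite /= in_itv/= andbT.
rewrite -integral_itv_obnd_cbnd; last first.
  by apply: measurable_fun_EFin; apply: measurable_funTS; exact: continuous_measurable_fun.
have i2 : integ `]0, +oo[ tent.
  apply: eq_integ (integrable_expRN 2^-1 _) => //.
  by move=> x; rewrite /= in_itv/= andbT => x0; rewrite tent_oy.
have : (\int[mu]_(x in `]0%R, +oo[) (tent x)%:E)%E \is a fin_num by exact: integrable_fin_num.
by rewrite fin_numE => /andP[_ ny]; apply: lte_mul_pinfty => //; rewrite ltey.
Qed.

Let rampi : integ setT ramp.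
Proof.
apply: (integrable_dominated _ _ _ _ _ tenti) => //; first exact: continuous_measurable_fun.
by move=> r _; have /andP[r0 ?] := ramp_tent r; rewrite ger0_norm.
Qed.

Let n1 t : 2^-1 ^+ 2 + t ^+ 2 != 0.
Proof. by rewrite gt_eqF// ltr_wpDr ?sqr_ge0// exprn_gt0// invr_gt0. Qed.

Let n3 t : (3 / 2) ^+ 2 + t ^+ 2 != 0.
Proof. by rewrite gt_eqF// ltr_wpDr ?sqr_ge0// exprn_gt0// divr_gt0. Qed.

Let bounded_M (f g : R -> R) : continuous f -> continuous g -> integ setT f ->
  (forall r, `|g r| <= 1) -> integ setT (fun r => f r * g r).
Proof.
move=> cf cg fi gb; apply: (integrable_dominated _ _ _ _ _ (integrable_norm fi)) => //.
  by apply: measurable_funM; exact: continuous_measurable_fun.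
by move=> r _; rewrite normrM ler_piMr.
Qed.

Let cosMl t : continuous (fun r => cos (t * r)).
Proof. by move=> r; cont_auto. Qed.
Let sinMl t : continuous (fun r => sin (t * r)).
Proof. by move=> r; cont_auto. Qed.

Let fold_M (f g : R -> R) : continuous f -> continuous g -> integ setT f ->
  (forall r, `|g r| <= 1) ->
  \int[mu]_r (f r * g r) = \int[mu]_(r in `]0, +oo[) (f r * g r + f (- r) * g (- r)).
Proof.
move=> cf cg fi gb; rewrite Rintegral_fold//.
  by move=> r; apply: cvgM; [exact: cf|exact: cg].
exact: bounded_M.
Qed.

Let h0 : 0 < 2^-1 :> R. Proof. by rewrite invr_gt0. Qed.
Let h3 : 0 < 3 / 2 :> R. Proof. by rewrite divr_gt0. Qed.

Lemma fourier_pair_tent :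
  fourier_pair tent (fun t => (2^-1 ^+ 2 + t ^+ 2)^-1) (fun=> 0).
Proof.
split=> //.
- by split=> [t|t]; [have := n1 t => ?; cont_auto|exact: cvg_cst].
- move=> t; split.
  + rewrite fold_M//; last by move=> r; exact: cos_max.
    transitivity (\int[mu]_(r in `]0, +oo[) (2 * (expR (- (2^-1 * r)) * cos (t * r)))).
      rewrite RintegralZl ?laplace_cos//; last exact: integrable_laplace_cos.
      by rewrite mulrA mulfV ?mul1r.
    apply: eq_Rint => r; rewrite /= in_itv/= andbT => r0.
    by rewrite tentN tent_oy// mulrN cosN; ring.
  + rewrite fold_M//; last by move=> r; exact: sin_max.
    rewrite (_ : \int[mu]_(t in _) _ = \int[mu]_(t in `]0, +oo[) (0 : R)); last first.
      by apply: eq_Rint => r _; rewrite tentN mulrN sinN; ring.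
    by rewrite /Rintegral integral0.
  (* Here [4 (1/4 + t^2) >= 1 + t^2], with equality at [t = 0]: this forces the constant [4] in
     [fourier_pair]. *)
  + rewrite ger0_norm; last by rewrite invr_ge0 addr_ge0 ?sqr_ge0.
    rewrite -[leLHS]div1r ler_pdivrMr; last by rewrite lt0r n1 addr_ge0 ?sqr_ge0.
    by rewrite mulrAC ler_pdivlMr; [nra|nra].
  + by rewrite normr0 mulr_ge0// invr_ge0 addr_ge0 ?sqr_ge0.
Qed.

(** For [w = 3/2 - i t], [1 / (w (w - 1)) = 1 / (1/2 - i t) - 1 / (3/2 - i t)], the transform of
    [e^(-r/2) - e^(-3r/2)] on [r > 0]; the two formulas are its real and imaginary parts over the
    common denominator. *)
Lemma fourier_pair_ramp : fourier_pair ramp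
  (fun t => (3 / 4 - t ^+ 2) / ((2^-1 ^+ 2 + t ^+ 2) * ((3 / 2) ^+ 2 + t ^+ 2)))
  (fun t => 2 * t / ((2^-1 ^+ 2 + t ^+ 2) * ((3 / 2) ^+ 2 + t ^+ 2))).
Proof.
have n13 t : (2^-1 ^+ 2 + t ^+ 2) * ((3 / 2) ^+ 2 + t ^+ 2) != 0 by rewrite mulf_neq0.
split=> //.
- by move=> r; have /andP[-> /le_trans ->//] := ramp_tent r; have /andP[] := tent01 r.
- by split=> t; have := n13 t => ?; cont_auto.
- move=> t; split.
  + rewrite fold_M//; last by move=> r; exact: cos_max.
    transitivity (\int[mu]_(r in `]0, +oo[) (expR (- (2^-1 * r)) * cos (t * r) - expR (- (3 / 2 * r)) * cos (t * r))).
      rewrite RintegralB//; [|exact: integrable_laplace_cos|exact: integrable_laplace_cos].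
      by rewrite !laplace_cos//; field; have := sqr_ge0 t => ?; apply/andP; split; apply: lt0r_neq0; nra.
    apply: eq_Rint => r; rewrite /= in_itv/= andbT => r0.
    by rewrite rampN// ramp_oy//; ring.
  + rewrite fold_M//; last by move=> r; exact: sin_max.
    transitivity (\int[mu]_(r in `]0, +oo[) (expR (- (2^-1 * r)) * sin (t * r) - expR (- (3 / 2 * r)) * sin (t * r))).
      rewrite RintegralB//; [|exact: integrable_laplace_sin|exact: integrable_laplace_sin].
      by rewrite !laplace_sin//; field; have := sqr_ge0 t => ?; apply/andP; split; apply: lt0r_neq0; nra.
    apply: eq_Rint => r; rewrite /= in_itv/= andbT => r0.
    by rewrite rampN// ramp_oy//; ring.
  + rewrite normrM normfV (@ger0_norm _ (_ * _)); last by rewrite mulr_ge0// addr_ge0 ?sqr_ge0.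
    rewrite ler_pdivrMr; last by rewrite lt0r n13 mulr_ge0// addr_ge0 ?sqr_ge0.
    rewrite mulrAC ler_pdivlMr; last by nra.
    have : `|3 / 4 - t ^+ 2| <= 3 / 4 + t ^+ 2.
      rewrite (le_trans (ler_normB _ _))// (ger0_norm (sqr_ge0 _)) ger0_norm//; lra.
    have := sqr_ge0 t; have := normr_ge0 (3 / 4 - t ^+ 2).
    move: (`|_|) => a; nra.
  + rewrite normrM normfV (@ger0_norm _ (_ * (_ + _))); last by rewrite mulr_ge0// addr_ge0 ?sqr_ge0.
    rewrite ler_pdivrMr; last by rewrite lt0r n13 mulr_ge0// addr_ge0 ?sqr_ge0.
    rewrite mulrAC ler_pdivlMr; last by nra.
    have : `|2 * t| <= 1 + t ^+ 2.
      have := sqr_ge0 (1 - t); have := sqr_ge0 (1 + t).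
      by rewrite ler_norml => ? ?; apply/andP; split; nra.
    have := sqr_ge0 t; have := normr_ge0 (2 * t).
    move: (`|_|) => a; nra.
Qed.

End exponential_kernels.

(** * Reduction to the integral of [e^(-v) / (x + v)] *)

Section exponential_integral.
Context {R : realType} (x : R).
Context (x0 : 0 < x).

Definition mellin_tent : R := \int[mu]_(u in `]0, +oo[)
  (gammad 2^-1 u * expR (- (2^-1 * ln x)) * tent (ln u - ln x)).
Definition mellin_ramp : R := \int[mu]_(u in `]0, +oo[)
  (gammad (3 / 2) u * expR (- (3 / 2 * ln x)) * ramp (ln u - ln x)).

Let tail (u : R) := expR (- u) * (x^-1 - u^-1).

Let expN_ln (u : R) : 0 < u -> u^-1 = expR (- ln u).
Proof. by move=> u0; rewrite expRN lnK. Qed.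

(** [tent (ln u - ln x)] is the square root of [min(u, x) / max(u, x)], so that multiplication by
    [(u x)^(-1/2)] gives [1 / max(u, x)]. *)
Let tent_integrand (u : R) : 0 < u ->
  gammad 2^-1 u * expR (- (2^-1 * ln x)) * tent (ln u - ln x) =
  if u < x then expR (- u) * x^-1 else expR (- u) * u^-1.
Proof.
move=> u0; rewrite /gammad /tent; case: ltP => ux.
  have L : ln u - ln x < 0 by rewrite subr_lt0 ltr_ln.
  by rewrite (ltr0_norm L) (expN_ln _ x0) -!expRD; congr expR; field.
have L : 0 <= ln u - ln x by rewrite subr_ge0 ler_ln.
by rewrite (ger0_norm L) (expN_ln _ u0) -!expRD; congr expR; field.
Qed.

(** For [u >= x] the ramp is [(x/u)^(1/2) - (x/u)^(3/2)]; the factor [u^(1/2) x^(-3/2)] turns this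
    into [1/x - 1/u]. *)
Let ramp_integrand (u : R) : 0 < u ->
  gammad (3 / 2) u * expR (- (3 / 2 * ln x)) * ramp (ln u - ln x) =
  if u < x then 0 else tail u.
Proof.
move=> u0; rewrite /gammad /tail; case: ltP => ux.
  have L : ln u - ln x < 0 by rewrite subr_lt0 ltr_ln.
  by rewrite ramp_le0 ?mulr0// ltW.
have L : 0 <= ln u - ln x by rewrite subr_ge0 ler_ln.
rewrite ramp_gt0// (expN_ln _ x0) (expN_ln _ u0) [LHS]mulrBr [RHS]mulrBr -!expRD.
by congr (_ - _); congr expR; field.
Qed.

Let i1 : integ `]0, +oo[ (fun u : R => expR (- u)).
Proof.
apply: eq_integ (integrable_expRN 1 _) => // u _; by rewrite mul1r.
Qed.

Lemma Rintegral_expRN : \int[mu]_(u in `]0, +oo[) expR (- u) = 1 :> R.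
Proof.
have := laplace_cos 1 ltr01 (0 : R).
rewrite expr1n expr0n addr0 divr1 => <-; apply: eq_Rint => u _.
by rewrite mul0r cos0 mulr1 mul1r.
Qed.

Let tailB (u : R) : x < u -> 0 <= tail u <= expR (- u) * x^-1.
Proof.
move=> xu; have u0 : 0 < u by exact: lt_trans xu.
rewrite /tail mulr_ge0 ?expR_ge0//=; last by rewrite subr_ge0 lef_pV2 ?posrE// ltW.
by rewrite ler_wpM2l ?expR_ge0// gerBl invr_ge0 ltW.
Qed.

Let inv_le (u : R) : 0 < u -> (x + u)^-1 <= x^-1.
Proof. by move=> u0; rewrite lef_pV2 ?posrE ?addr_gt0// lerDl ltW. Qed.

Let i1x : integ `]0, +oo[ (fun u : R => expR (- u) * x^-1).
Proof. by apply: eq_integ (integZ _ _ x^-1 _ i1) => // u _; rewrite mulrC. Qed.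

Let cont_meas (h : R -> R) (c : R) : continuous h ->
  measurable_fun `](0:R), +oo[ (fun u => gammad c u * expR (- (c * ln x)) * h (ln u - ln x)).
Proof.
move=> ch; have mh : measurable_fun `](0:R), +oo[ (fun u => h (ln u - ln x)).
  by apply: (mf_continuous h) => //; meas_auto.
by rewrite /gammad; meas_auto.
Qed.

(** The two integrands add up to [e^(-u) / x] on either side of [u = x]. In terms of contours,
    [1 / x] is the contribution of the pole [w = 1] between the lines. *)
Lemma mellin_tent_ramp : mellin_tent + mellin_ramp = x^-1.
Proof.
have [ct _ _ _ _] := @fourier_pair_tent R; have [cr _ _ _ _] := @fourier_pair_ramp R.
have dom (u : R) : 0 < u -> (u < x) || (expR (- u) / u <= expR (- u) / x).
  by move=> u0; case: ltP => //= xu; rewrite ler_wpM2l ?expR_ge0// lef_pV2.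
rewrite -[RHS]mul1r -Rintegral_expRN -RintegralZr// /mellin_tent /mellin_ramp -RintegralD//.
- apply: eq_Rint => u; rewrite /= in_itv/= andbT => u0.
  rewrite tent_integrand// ramp_integrand// /tail; case: ltP => _; ring.
- apply: (integrable_dominated _ _ _ _ (cont_meas _ _ ct) i1x) => // u.
  rewrite /= in_itv/= andbT => u0; rewrite tent_integrand// ger0_norm; last first.
    by case: ifP; rewrite mulr_ge0 ?expR_ge0// invr_ge0 ltW.
  by case: ltP (dom u u0).
- apply: (integrable_dominated _ _ _ _ (cont_meas _ _ cr) i1x) => // u.
  rewrite /= in_itv/= andbT => u0; rewrite ramp_integrand//; case: ltP => [_|].
    by rewrite normr0 mulr_ge0 ?expR_ge0// invr_ge0 ltW.
  rewrite le_eqVlt => /predU1P[<-|xu]; last by have /andP[? ?] := tailB u xu; rewrite ger0_norm.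
  by rewrite /tail subrr mulr0 normr0 mulr_ge0 ?expR_ge0// invr_ge0 ltW.
Qed.

Let di : integ `]0, +oo[ (fun v => expR (- v) / (x + v)).
Proof.
have xun (u : R) : 0 < u -> x + u != 0 by move=> u0; rewrite gt_eqF// addr_gt0.
apply: (integrable_dominated _ _ (fun v => expR (- v) * x^-1)) => //.
- apply: open_continuous_measurable_fun => //= v /set_mem; rewrite /= in_itv/= andbT => v0.
  by have := xun v v0 => ?; cont_auto.
- move=> v; rewrite /= in_itv/= andbT => v0.
  rewrite ger0_norm; first by rewrite ler_wpM2l ?expR_ge0// inv_le.
  by rewrite mulr_ge0 ?expR_ge0// invr_ge0 ltW// addr_gt0.
Qed.

(** The integrand lives on [u > x]; with [u = x + v] the factor [e^x] cancels, leaving the integral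
    of [e^(-v) (1/x - 1/(x + v))]. *)
Lemma mellin_rampE : expR x * mellin_ramp = x^-1 - \int[mu]_(v in `]0, +oo[) (expR (- v) / (x + v)).
Proof.
have ctail (u : R) : 0 < u -> {for u, continuous tail}.
  by move=> u0; have un0 := lt0r_neq0 u0; rewrite /tail; cont_auto.
have mtail : measurable_fun `]x, +oo[ tail.
  apply: open_continuous_measurable_fun => //= u /set_mem; rewrite /= in_itv/= andbT => xu.
  by apply: ctail; exact: lt_trans xu.
pose F v := x + v.
have dF (v : R) : is_derive v 1 F 1 by rewrite /F; derive_auto; ring.
have F'E : derive1 F = fun=> 1 by apply/funext => v; rewrite derive1E; have [_ ->] := dF v.
have -> : mellin_ramp = \int[mu]_(v in `]0, +oo[) (expR (- (x + v)) * (x^-1 - (x + v)^-1)).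
  transitivity (\int[mu]_(u in `]x, +oo[) tail u).
    rewrite (_ : `]x, +oo[%classic = `]0, +oo[%classic `&` `]x, +oo[%classic); last first.
      apply/seteqP; split=> u; rewrite /= !in_itv/= !andbT; last by case.
      by move=> xu; split => //; exact: lt_trans xu.
    rewrite Rintegral_mkcondr; apply: eq_Rint => u; rewrite /= in_itv/= andbT => u0.
    rewrite ramp_integrand// patchE mem_setE in_itv/= andbT.
    by case: (ltgtP u x) => [||->]//; rewrite /tail subrr mulr0.
  rewrite /Rintegral !integral_itv_obnd_cbnd; last 2 first.
  - apply: measurable_fun_EFin; apply: open_continuous_measurable_fun => //= v /set_mem.
    rewrite /= in_itv/= andbT => v0.
    by have := lt0r_neq0 (addr_gt0 x0 v0) => ?; cont_auto.
  - exact: measurable_fun_EFin.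
  congr fine.
  have -> : (\int[mu]_(u in `[x, +oo[) (tail u)%:E = \int[mu]_(u in `[F 0%R, +oo[) (tail u)%:E)%E.
    by rewrite /F addr0.
  rewrite (@increasing_ge0_integration_by_substitutiony _ F).
  - by apply: eq_integral => v _; rewrite fctE /= F'E mulr1.
  - by move=> u v _ _ uv; rewrite ltrD2l.
  - by rewrite F'E => ? _; exact: cvg_cst.
  - by rewrite F'E; exact: is_cvg_cst.
  - by rewrite F'E; exact: is_cvg_cst.
  - split; first by move=> v _; have [] := dF v.
    by apply: cvg_at_right_filter; exact: (is_derive_continuous _ _ _ (dF 0)).
  - apply/cvgryPge => A; near=> v.
    by rewrite /F -lerBlDl; near: v; apply: nbhs_pinfty_ge; exact: num_real.
  - apply: continuous_in_subspaceT => u /set_mem; rewrite /= in_itv/= andbT /F addr0 => xu.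
    by apply: ctail; exact: lt_le_trans xu.
  - by move=> u; rewrite in_itv/= andbT /F addr0 => /tailB/andP[].
rewrite -RintegralZl//.
  rewrite -[X in X - _]mul1r -Rintegral_expRN -RintegralZr// -RintegralB//.
  by apply: eq_Rint => v _; rewrite mulrA -expRD opprD addrA subrr add0r mulrBr.
apply: eq_integ (integZ _ _ (expR (- x)) _ (integB _ _ _ _ i1x di)) => // v _.
by rewrite -mulrBr mulrA -expRD -opprD.
Unshelve. all: by end_near. Qed.

(** Integration by parts: [- e^(-u) ln (x + u)] has as derivative the difference of the two
    integrands, and its value at [0] produces [ln x]. *)
Lemma expR_ln_integral :
  integ `]0, +oo[ (fun u => expR (- u) * ln (x + u)) /\
  \int[mu]_(u in `]0, +oo[) (expR (- u) * ln (x + u)) =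
  ln x + \int[mu]_(v in `]0, +oo[) (expR (- v) / (x + v)).
Proof.
have xu (u : R) : 0 <= u -> 0 < x + u by move=> u0; rewrite ltr_wpDr.
have xun (u : R) : 0 <= u -> x + u != 0 by move=> /xu/lt0r_neq0.
have mln : measurable_fun `](0:R), +oo[ (fun u => expR (- u) * ln (x + u)) by meas_auto.
(* For [y = x + u], [ln y < y] and [- ln y < 1/y <= 1/x] give [|ln y| <= x + 1/x + u]; [gammad 2 u]
   is [u e^(-u)]. *)
have gi : integ `]0, +oo[ (fun u : R => (x + x^-1) * expR (- u) + gammad 2 u).
  apply: integD => //; last exact: integrable_gammad.
  exact: (integZ _ _ (x + x^-1) _ i1).
have li : integ `]0, +oo[ (fun u => expR (- u) * ln (x + u)).
  apply: (integrable_dominated _ _ _ _ mln gi) => // u.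
  rewrite /= in_itv/= andbT => u0; rewrite normrM ger0_norm ?expR_ge0//.
  rewrite /gammad (_ : (2 - 1) * ln u = ln u); last by ring.
  rewrite lnK ?posrE// [in leRHS]mulrC -mulrDr ler_wpM2l ?expR_ge0//.
  have p := xu u (ltW u0).
  have a := ln_sublinear p.
  have : ln (x + u)^-1 < (x + u)^-1 by apply: ln_sublinear; rewrite invr_gt0.
  rewrite lnV ?posrE// => b; have c := inv_le u u0.
  have : 0 < x^-1 by rewrite invr_gt0.
  have : 0 < (x + u)^-1 by rewrite invr_gt0.
  by move=> ? ?; rewrite ler_norml; apply/andP; split; lra.
(* A bound that visibly tends to [0] at infinity: half of the exponential absorbs the growth, since
   [1 <= e^(u/2)] and [u <= 2 e^(u/2)]. *)
have bnd (u : R) : 0 < u ->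
    `|expR (- u) * ln (x + u)| <= (x + x^-1 + 2) * expR (- (2^-1 * u)).
  move=> u0.
  rewrite normrM ger0_norm ?expR_ge0// (_ : - u = - (2^-1 * u) - 2^-1 * u); last by field.
  rewrite expRD mulrC mulrA ler_wpM2r ?expR_ge0// mulrC expRN ler_pdivrMl ?expR_gt0//.
  have p := xu u (ltW u0).
  have a := ln_sublinear p.
  have : ln (x + u)^-1 < (x + u)^-1 by apply: ln_sublinear; rewrite invr_gt0.
  rewrite lnV ?posrE// => b; have c := inv_le u u0.
  have : 0 < x^-1 by rewrite invr_gt0.
  have : 0 < (x + u)^-1 by rewrite invr_gt0.
  have : 1 + 2^-1 * u <= expR (2^-1 * u) by exact: expR_ge1Dx.
  move: (expR (2^-1 * u)) => w uw xu0 xi0.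
  have w1 : 1 <= w by rewrite (le_trans _ uw)// lerDl mulr_ge0// ltW.
  have : x + x^-1 <= w * (x + x^-1) by rewrite ler_peMl// addr_ge0// ltW.
  by move=> ?; rewrite ler_norml; apply/andP; split; lra.
split => //; apply/eqP; rewrite -subr_eq -RintegralB//; apply/eqP.
have dF (u : R) : 0 < u -> is_derive u 1 (fun u => - (expR (- u) * ln (x + u)))
    (expR (- u) * ln (x + u) - expR (- u) / (x + u)).
  by move=> u0; have := xu u (ltW u0) => ?; derive_auto; rewrite add0r; field; rewrite xun// ltW.
rewrite (FTC2_oy 0 _ _ (- (expR (- 0) * ln (x + 0))) (- 0) (integB _ _ _ _ li di) dF) //.
- by rewrite oppr0 expR0 addr0; ring.
- move=> u u0; have := xu u (ltW u0) => ?; have := xun u (ltW u0) => ?; by cont_auto.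
- apply: cvg_at_right_filter; have := xu 0 (lexx 0) => ?.
  have : {for 0, continuous (fun u => - (expR (- u) * ln (x + u)))} by cont_auto.
  by apply.
- apply: cvgN.
  have h : (x + x^-1 + 2) * expR (- (2^-1 * u)) @[u --> +oo] --> (0 : R).
    rewrite -[X in _ --> X](mulr0 (x + x^-1 + 2)); apply: cvgM; first exact: cvg_cst.
    exact: expR_cvg0.
  apply: norm_cvg0; apply: squeeze_cvgr (cvg_cst _) h.
  near=> u; rewrite normr_ge0/= bnd//.
Unshelve. all: by end_near. Qed.

End exponential_integral.

(** * The gamma function *)

Lemma exprn_1BM_le {R : realType} (u : R) (n : nat) : 0 <= u <= n.+1%:R ->
  (1 - u / n.+1%:R) ^+ n.+1 <= expR (- u).
Proof.
move=> /andP[u0 un].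
have -> : expR (- u) = expR (- (u / n.+1%:R)) ^+ n.+1.
  by rewrite -expRM_natr mulNr divfK.
apply: lerXn2r; rewrite ?nnegrE ?expR_ge0 ?expR_ge1Dx//.
by rewrite subr_ge0 ler_pdivrMr// mul1r.
Qed.

(** Squeeze between [e^(-u)] and [e^(-u / (1 - y))], [y = u / (n + 1)]. The lower bound is
    [1 + z <= e^z] at [z = y / (1 - y)], where [1 + z = 1 / (1 - y)]. *)
Lemma exprn_1BM_cvg {R : realType} (u : R) : 0 < u ->
  (1 - u / n.+1%:R) ^+ n.+1 @[n --> \oo] --> expR (- u).
Proof.
move=> u0.
have un : u / n.+1%:R @[n --> \oo] --> (0 : R).
  by rewrite -[X in _ --> X](mulr0 u); apply: cvgM; [exact: cvg_cst|exact: cvg_harmonic].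
have low : expR (- (u / (1 - u / n.+1%:R))) @[n --> \oo] --> expR (- u).
  apply: (continuous_cvg _ (@continuous_expR _ _)); apply: cvgN.
  rewrite -[X in _ --> X]mulr1; apply: cvgM; first exact: cvg_cst.
  rewrite -[X in _ --> X]invr1; apply: cvgV; first exact: oner_neq0.
  by rewrite -[X in _ --> X]subr0; apply: cvgB; [exact: cvg_cst|exact: un].
apply: (squeeze_cvgr _ low (cvg_cst _)).
near=> n.
have y1 : u / n.+1%:R < 1 by near: n; apply: (cvgr_lt _ un); exact: ltr01.
have y0 : 0 < u / n.+1%:R by rewrite divr_gt0.
apply/andP; split; last first.
  by apply: exprn_1BM_le; rewrite ltW//=; move: y1; rewrite ltr_pdivrMr// mul1r => /ltW.
have d0 : 0 < 1 - u / n.+1%:R by rewrite subr_gt0.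
have -> : expR (- (u / (1 - u / n.+1%:R))) =
    expR (- (u / n.+1%:R / (1 - u / n.+1%:R))) ^+ n.+1.
  by rewrite -expRM_natr mulNr mulrAC divfK.
apply: lerXn2r; rewrite ?nnegrE ?expR_ge0 ?(ltW d0)//.
rewrite expRN -[leRHS]invrK lef_pV2 ?posrE ?expR_gt0 ?invr_gt0//.
apply: le_trans (expR_ge1Dx _).
move: (lt0r_neq0 d0); move: (u / n.+1%:R) => y yn.
by rewrite (_ : 1 + y / (1 - y) = (1 - y)^-1)//; field.
Unshelve. all: by end_near. Qed.

(** * Complex powers, complex integrals and Euler's integral *)

Section complex_power.
Context {R : realType}.
Implicit Types (a b t : R) (s z : R[i]).

Lemma cReD s z : complex.Re (s + z) = complex.Re s + complex.Re z.
Proof. by case: s; case: z. Qed.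
Lemma cImD s z : complex.Im (s + z) = complex.Im s + complex.Im z.
Proof. by case: s; case: z. Qed.
Lemma cReB s z : complex.Re (s - z) = complex.Re s - complex.Re z.
Proof. by case: s; case: z. Qed.
Lemma cImB s z : complex.Im (s - z) = complex.Im s - complex.Im z.
Proof. by case: s; case: z. Qed.
Lemma cReM s z : complex.Re (s * z) =
  complex.Re s * complex.Re z - complex.Im s * complex.Im z.
Proof. by case: s; case: z. Qed.
Lemma cImM s z : complex.Im (s * z) =
  complex.Re s * complex.Im z + complex.Im s * complex.Re z.
Proof. by case: s; case: z. Qed.
Lemma cRe_nat (n : nat) : complex.Re (n%:R : R[i]) = n%:R.
Proof. by elim: n => // n IH; rewrite -!natr1 cReD IH. Qed.
Lemma cIm_nat (n : nat) : complex.Im (n%:R : R[i]) = 0.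
Proof. by elim: n => // n IH; rewrite -!natr1 cImD IH addr0. Qed.

Lemma complex_eq s z : complex.Re s = complex.Re z -> complex.Im s = complex.Im z -> s = z.
Proof. by case: s; case: z => /= ? ? ? ? -> ->. Qed.

Lemma cpowerE t s : cpower t s =
  (expR (complex.Re s * ln t) * cos (complex.Im s * ln t))
  +i* (expR (complex.Re s * ln t) * sin (complex.Im s * ln t)).
Proof. by rewrite /cpower; apply: complex_eq; rewrite ?cReM ?cImM /= !mul0r ?subr0 ?addr0. Qed.

Lemma cpowerD t s z : cpower t (s + z) = cpower t s * cpower t z.
Proof.
rewrite !cpowerE; apply: complex_eq; rewrite ?cReM ?cImM /= cReD cImD !mulrDl expRD.
  by rewrite cosD; ring.
by rewrite sinD; ring.
Qed.

Lemma cpower0 t : cpower t 0 = 1.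
Proof. by rewrite cpowerE /= !mul0r expR0 cos0 sin0 mulr1 mulr0. Qed.

Lemma cpowerN t s : cpower t s * cpower t (- s) = 1.
Proof. by rewrite -cpowerD subrr cpower0. Qed.

Lemma cpower_neq0 t s : cpower t s != 0.
Proof.
by apply/eqP => h; have := cpowerN t s; rewrite h mul0r => /esym/eqP; rewrite oner_eq0.
Qed.

Lemma cpowerNE t s : cpower t (- s) = (cpower t s)^-1.
Proof. by apply: (mulfI (cpower_neq0 t s)); rewrite cpowerN mulfV// cpower_neq0. Qed.

Lemma cpower_mul t t' s : 0 < t -> 0 < t' -> cpower (t * t') s = cpower t s * cpower t' s.
Proof.
move=> t0 t'0; rewrite !cpowerE; apply: complex_eq; rewrite ?cReM ?cImM /= lnM ?posrE// !mulrDr expRD.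
  by rewrite cosD; ring.
by rewrite sinD; ring.
Qed.

Lemma cpowerX t n s : 0 < t -> cpower (t ^+ n) s = cpower t (n%:R * s).
Proof.
move=> t0; rewrite !cpowerE cReM cImM cRe_nat cIm_nat lnXn// mul0r subr0 mul0r addr0.
have E (a : R) : a * (ln t *+ n) = n%:R * a * ln t by rewrite -mulr_natl; ring.
by rewrite !E.
Qed.

Lemma cpowerV t s : 0 < t -> cpower t^-1 s = cpower t (- s).
Proof.
by move=> t0; rewrite !cpowerE lnV ?posrE//; case: s => a b /=; rewrite !mulrN !mulNr.
Qed.

Lemma cpower_real t a : cpower t a%:C = (expR (a * ln t))%:C.
Proof. by rewrite cpowerE /= mul0r cos0 sin0 mulr1 mulr0. Qed.

Lemma cpower1 t : 0 < t -> cpower t 1 = t%:C.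
Proof. by move=> t0; rewrite (cpower_real t 1) mul1r lnK. Qed.

End complex_power.

Section complex_integral.
Context {R : realType}.
Implicit Types (D : set R) (F G : R -> R[i]) (c : R[i]).

Lemma cintegralB D F G : measurable D -> cintegrable D F -> cintegrable D G ->
  cintegral D (fun t => F t - G t) = cintegral D F - cintegral D G.
Proof.
move=> mD [F1 F2] [G1 G2]; apply: complex_eq; rewrite ?cReB ?cImB /=.
  by rewrite -RintegralB//; apply: eq_Rint => t _; rewrite cReB.
by rewrite -RintegralB//; apply: eq_Rint => t _; rewrite cImB.
Qed.

Lemma cintegrableZ D F c : measurable D -> cintegrable D F ->
  cintegrable D (fun t => c * F t).
Proof.
move=> mD [F1 F2]; split.
  apply: eq_integ (integB _ _ _ mD (integZ _ _ (complex.Re c) mD F1) (integZ _ _ (complex.Im c) mD F2)) => // t _.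
  by rewrite cReM.
apply: eq_integ (integD _ _ _ mD (integZ _ _ (complex.Re c) mD F2) (integZ _ _ (complex.Im c) mD F1)) => // t _.
by rewrite cImM.
Qed.

Lemma cintegralZ D F c : measurable D -> cintegrable D F ->
  cintegral D (fun t => c * F t) = c * cintegral D F.
Proof.
move=> mD [F1 F2]; apply: complex_eq; rewrite ?cReM ?cImM /=.
  rewrite -!RintegralZl// -RintegralB//; [|exact: integZ|exact: integZ].
  by apply: eq_Rint => t _; rewrite cReM.
rewrite -!RintegralZl// -RintegralD//; [|exact: integZ|exact: integZ].
by apply: eq_Rint => t _; rewrite cImM.
Qed.

Lemma eq_cintegral D F G : (forall t, D t -> F t = G t) ->
  cintegral D F = cintegral D G.
Proof. by move=> FG; congr (_ +i* _); apply: eq_Rint => t /FG ->. Qed.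

Lemma eq_cintegrable D F G : measurable D -> (forall t, D t -> F t = G t) ->
  cintegrable D F -> cintegrable D G.
Proof.
by move=> mD FG [F1 F2]; split; [apply: eq_integ F1 => //|apply: eq_integ F2 => //] => t /FG ->.
Qed.

End complex_integral.

Section euler_integral.
Context {R : realType}.
Implicit Types (s : R[i]) (a b u : R).

Lemma Re_euler_integrand s u :
  complex.Re (cpower u (s - 1) * (expR (- u))%:C) =
  gammad (complex.Re s) u * cos (complex.Im s * ln u).
Proof.
by rewrite cReM cpowerE /= cReB cImB /= mulr0 !subr0 /gammad; ring.
Qed.

Lemma Im_euler_integrand s u :
  complex.Im (cpower u (s - 1) * (expR (- u))%:C) =
  gammad (complex.Re s) u * sin (complex.Im s * ln u).
Proof.
by rewrite cImM cpowerE /= cReB cImB /= mulr0 !subr0 /gammad; ring.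
Qed.

Lemma integ_gammad_M a (g : R -> R) : 0 < a -> measurable_fun `](0:R), +oo[ g ->
  (forall u, `|g u| <= 1) -> integ `]0, +oo[ (fun u => gammad a u * g u).
Proof.
move=> a0 mg g1; apply: (integrable_dominated _ _ _ _ _ (integrable_gammad a a0)) => //.
  by apply: measurable_funM => //; exact: measurable_gammad.
by move=> u _; rewrite normrM ger0_norm ?gammad_ge0// ler_piMr ?gammad_ge0.
Qed.

Lemma integ_gammad_cos a b : 0 < a -> integ `]0, +oo[ (fun u => gammad a u * cos (b * ln u)).
Proof. by move=> a0; apply: integ_gammad_M => // [|u]; [meas_auto|exact: cos_max]. Qed.

Lemma integ_gammad_sin a b : 0 < a -> integ `]0, +oo[ (fun u => gammad a u * sin (b * ln u)).
Proof. by move=> a0; apply: integ_gammad_M => // [|u]; [meas_auto|exact: sin_max]. Qed.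

Lemma euler_integralE s : euler_integral s =
  (\int[mu]_(u in `]0, +oo[) (gammad (complex.Re s) u * cos (complex.Im s * ln u)))
  +i* (\int[mu]_(u in `]0, +oo[) (gammad (complex.Re s) u * sin (complex.Im s * ln u))).
Proof.
congr (_ +i* _); apply: eq_Rint => u _; first exact: Re_euler_integrand.
exact: Im_euler_integrand.
Qed.

Lemma gammadM_cvg0 a (g : R -> R) : 0 < a -> (forall u, `|g u| <= 1) ->
  gammad (a + 1) u * g u @[u --> 0^'+] --> (0 : R) /\
  gammad (a + 1) u * g u @[u --> +oo] --> (0 : R).
Proof.
move=> a0 g1; split.
- apply: norm_cvg0; apply: squeeze_cvgr (cvg_cst _) (expRln_cvg0 a a0).
  near=> u; rewrite normr_ge0 /= normrM ger0_norm ?gammad_ge0//.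
  have u0 : 0 < u by [].
  rewrite (le_trans (y := gammad (a + 1) u))// ?ler_piMr ?gammad_ge0//.
  by rewrite /gammad addrK ler_piMl ?expR_ge0// expR_le1 oppr_le0 ltW.
(* From [u^(2a) <= C e^u] follows [u^a <= (1 + C) e^(u/2)], because [C <= (1 + C)^2]; the remaining
   [e^(-u/2)] gives the limit. *)
- pose C := expR (2 * a * ln (2 * a) - 2 * a).
  have h : (1 + C) * expR (- (2^-1 * u)) @[u --> +oo] --> (0 : R).
    by rewrite -[X in _ --> X](mulr0 (1 + C)); apply: cvgM; [exact: cvg_cst|exact: expR_cvg0].
  apply: norm_cvg0; apply: squeeze_cvgr (cvg_cst _) h.
  near=> u; rewrite normr_ge0 /= normrM ger0_norm ?gammad_ge0//.
  have u0 : 0 < u by near: u; exact: nbhs_pinfty_gt.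
  rewrite (le_trans (y := gammad (a + 1) u))// ?ler_piMr ?gammad_ge0//.
  have := expRln_le (2 * a) u (mulr_gt0 (ltr0Sn R 1) a0) u0; rewrite -/C /gammad addrK.
  rewrite (_ : 2 * a * ln u = 2%:R * (a * ln u)); last by rewrite mulrA.
  rewrite expRM_natl; pose w := expR (2^-1 * u).
  have -> : expR (- u) = w^-1 * w^-1 by rewrite -expRN -expRD; congr expR; field.
  have -> : expR u = w ^+ 2 by rewrite -expRM_natl mulrA divff ?mul1r.
  have : 0 < expR (a * ln u) by exact: expR_gt0.
  have w0 : 0 < w by exact: expR_gt0.
  have : 0 < C by exact: expR_gt0.
  have -> : expR (- (2^-1 * u)) = w^-1 by rewrite expRN.
  move: (expR (a * ln u)) => p C0 p0 pC.
  rewrite mulrAC ler_pM2r ?invr_gt0// mulrC ler_pdivrMr//.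
  rewrite -(@ler_pXn2r _ 2)// ?nnegrE ?(ltW p0) ?mulr_ge0 ?addr_ge0 ?(ltW w0) ?(ltW C0)//.
  rewrite (le_trans pC)// exprMn ler_wpM2r ?exprn_ge0 ?(ltW w0)//.
  by nra.
Unshelve. all: by end_near. Qed.

Lemma gammadS a u : 0 < u -> gammad (a + 1) u = u * gammad a u.
Proof. move=> u0; rewrite /gammad addrK.
have -> : expR (a * ln u) = expR ((a - 1) * ln u) * u.
  by rewrite mulrBl mul1r expRB lnK ?posrE// divfK ?gt_eqF.
ring. Qed.

Let der_gammad a (g : R -> R) (g' : R) u : 0 < u -> is_derive u 1 g g' ->
  is_derive u 1 (fun u => gammad (a + 1) u * g u)
    ((a * gammad a u - gammad (a + 1) u) * g u + gammad (a + 1) u * g').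
Proof.
move=> u0 dg; have un := lt0r_neq0 u0; rewrite (gammadS a u u0).
apply: (@is_derive_eq _ _ _ _ _ _ _ ((a / u - 1) * (u * gammad a u) * g u + u * gammad a u * g')).
  by rewrite -(gammadS a u u0) /gammad addrK; derive_auto; field.
by field.
Qed.

(** Integration by parts: [e^(-u) u^s] has derivative [s e^(-u) u^(s-1) - e^(-u) u^s] and vanishes
    at both ends; [D1] and [D2] are its real and imaginary parts. *)
Lemma euler_integralS s : 0 < complex.Re s -> euler_integral (s + 1) = s * euler_integral s.
Proof.
move=> s0; rewrite !euler_integralE cReD cImD /= addr0.
set a := complex.Re s; set b := complex.Im s.
have a0 : 0 < a by [].
have a10 : 0 < a + 1 by rewrite addr_gt0.
have cM c : 0 < c -> forall u : R, 0 < u -> {for u, continuous (gammad c)}.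
  by move=> c0 u u0; rewrite /gammad; cont_auto.
have D1 (u : R) : 0 < u -> is_derive u 1 (fun u => gammad (a + 1) u * cos (b * ln u))
    (a * (gammad a u * cos (b * ln u)) - b * (gammad a u * sin (b * ln u))
     - gammad (a + 1) u * cos (b * ln u)).
  move=> u0; have dc : is_derive u 1 (fun u => cos (b * ln u)) (- sin (b * ln u) * (b / u)).
    by derive_auto; rewrite mul0r add0r mulr1.
  apply: (is_derive_eq (der_gammad a _ _ _ u0 dc)).
  by rewrite (gammadS a u u0); field; exact: lt0r_neq0.
have D2 (u : R) : 0 < u -> is_derive u 1 (fun u => gammad (a + 1) u * sin (b * ln u))
    (a * (gammad a u * sin (b * ln u)) + b * (gammad a u * cos (b * ln u))
     - gammad (a + 1) u * sin (b * ln u)).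
  move=> u0; have dc : is_derive u 1 (fun u => sin (b * ln u)) (cos (b * ln u) * (b / u)).
    by derive_auto; rewrite mul0r add0r mulr1.
  apply: (is_derive_eq (der_gammad a _ _ _ u0 dc)).
  by rewrite (gammadS a u u0); field; exact: lt0r_neq0.
have i1 := integ_gammad_cos a b a0; have i2 := integ_gammad_sin a b a0.
have i3 := integ_gammad_cos (a + 1) b a10; have i4 := integ_gammad_sin (a + 1) b a10.
have mo : measurable `](0:R), +oo[ by [].
have [l1 l2] := gammadM_cvg0 a _ a0 (fun u => cos_max (b * ln u)).
have [l3 l4] := gammadM_cvg0 a _ a0 (fun u => sin_max (b * ln u)).
have j1 := integB _ _ _ mo (integZ _ _ a mo i1) (integZ _ _ b mo i2).
have j2 := integD _ _ _ mo (integZ _ _ a mo i2) (integZ _ _ b mo i1).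
have c1 (u : R) : 0 < u -> {for u, continuous (fun u => a * (gammad a u * cos (b * ln u)) - b * (gammad a u * sin (b * ln u))
     - gammad (a + 1) u * cos (b * ln u))}.
  by move=> u0; rewrite /gammad; cont_auto.
have c2 (u : R) : 0 < u -> {for u, continuous (fun u => a * (gammad a u * sin (b * ln u)) + b * (gammad a u * cos (b * ln u))
     - gammad (a + 1) u * sin (b * ln u))}.
  by move=> u0; rewrite /gammad; cont_auto.
have := FTC2_oy 0 _ _ _ _ (integB _ _ _ mo j1 i3) D1 c1 l1 l2.
rewrite subrr RintegralB// RintegralB//; [|exact: integZ|exact: integZ].
rewrite !RintegralZl// => /eqP; rewrite subr_eq0 => /eqP E1.
have := FTC2_oy 0 _ _ _ _ (integB _ _ _ mo j2 i4) D2 c2 l3 l4.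
rewrite subrr RintegralB// RintegralD//; [|exact: integZ|exact: integZ].
rewrite !RintegralZl// => /eqP; rewrite subr_eq0 => /eqP E2.
by apply: complex_eq; rewrite ?cReM ?cImM /=.
Qed.

End euler_integral.

Lemma FTC2_0c {R : realType} (N : R) (f F : R -> R) (A : R) : 0 < N ->
  integ `]0, N] f ->
  (forall x : R, 0 < x -> is_derive x 1 F (f x)) ->
  (forall x : R, 0 < x -> {for x, continuous f}) ->
  F x @[x --> 0^'+] --> A ->
  \int[mu]_(x in `]0, N]) f x = F N - A.
Proof.
move=> N0 fi dF cf FA.
(* With [n.+1] in the denominator the interval at [n = 0] would be degenerate. *)
have an0 n : 0 < N / n.+2%:R by rewrite divr_gt0.
have an : N / n.+2%:R @[n --> \oo] --> (0 : R).
  rewrite -[X in _ --> X](mulr0 N); apply: cvgM; first exact: cvg_cst.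
  by rewrite (cvg_shiftS (fun n => n.+1%:R^-1 : R)); exact: cvg_harmonic.
apply: (@FTC2_exhaust _ _ f F (fun n => N / n.+2%:R) (fun=> N) (F N - A)) => //.
- by move=> n; rewrite ltr_pdivrMr// ltr_pMr// ltr1n.
- by move=> n x; rewrite /= !in_itv/= => /andP[+ ->]; rewrite andbT; exact: lt_le_trans.
- move=> x; rewrite /= in_itv/= => /andP[x0 xN]; near=> n.
  rewrite in_itv/= xN andbT; near: n; move/cvgr_le : an; exact.
- by move=> x; rewrite /= in_itv/= => /andP[x0 _]; exact: dF.
- by move=> x; rewrite /= in_itv/= => /andP[x0 _]; exact: cf.
- apply: cvgB; first exact: cvg_cst.
  by move/cvg_at_rightP : FA; apply.
Unshelve. all: by end_near. Qed.

(** * Beta integrals and Gauss's product *)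

Section beta_integral.
Context {R : realType}.
Implicit Types (s : R[i]) (N u : R) (n : nat).

(** For [N = n] the factor [(1 - u/n)^n] approximates the [e^(-u)] of Euler's integral; [N] is kept
    apart from [n] so that induction on [n] is possible. *)
Definition beta_integrand n N s u : R[i] := cpower u (s - 1) * ((1 - u / N) ^+ n)%:C.
Definition beta_integral n N s : R[i] := cintegral `]0, N] (beta_integrand n N s).

Lemma beta_integrandE n N s u : beta_integrand n N s u =
  (expR ((complex.Re s - 1) * ln u) * cos (complex.Im s * ln u) * (1 - u / N) ^+ n)
  +i* (expR ((complex.Re s - 1) * ln u) * sin (complex.Im s * ln u) * (1 - u / N) ^+ n).
Proof.
rewrite /beta_integrand cpowerE; apply: complex_eq; rewrite ?cReM ?cImM /= cReB cImB /= !subr0.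
  by rewrite mulr0 subr0.
by rewrite mulr0 add0r.
Qed.

Lemma cintegrable_beta n N s : 0 < N -> 0 < complex.Re s ->
  cintegrable `]0, N] (beta_integrand n N s).
Proof.
move=> N0 s0.
(* On []0, N]] one has [1 <= e^(N - u)], so [e^N] times the gamma density dominates the bare
   power. *)
have gi : integ `]0, N] (fun u => expR N * gammad (complex.Re s) u).
  apply: integZ => //; apply: integrableS (integrable_gammad _ s0) => //.
  by move=> u /=; rewrite !in_itv/= => /andP[->].
have B u (p : R) : 0 < u <= N -> `|p| <= 1 ->
    `|expR ((complex.Re s - 1) * ln u) * p * (1 - u / N) ^+ n| <= expR N * gammad (complex.Re s) u.
  move=> /andP[u0 uN] p1; rewrite !normrM (ger0_norm (expR_ge0 _)) /gammad mulrA -expRD.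
  have -> : expR ((complex.Re s - 1) * ln u) * `|p| * `|(1 - u / N) ^+ n| =
     (`|p| * `|(1 - u / N) ^+ n|) * expR ((complex.Re s - 1) * ln u) by ring.
  rewrite ler_wpM2r ?expR_ge0// (@le_trans _ _ 1)//; last by rewrite -[leLHS]expR0 ler_expR subr_ge0.
  rewrite mulr_ile1// normrX exprn_ile1// ger0_norm ?gerBl ?divr_ge0 ?(ltW u0) ?(ltW N0)//.
  by rewrite subr_ge0 ler_pdivrMr// mul1r.
split; apply: (integrable_dominated _ _ _ _ _ gi) => //.
- rewrite (_ : (fun t => _) = fun u => expR ((complex.Re s - 1) * ln u) * cos (complex.Im s * ln u) * (1 - u / N) ^+ n); last first.
    by apply/funext => u; rewrite beta_integrandE.
  by meas_auto.
- move=> u Du; have uN : 0 < u <= N by move: Du; rewrite /= in_itv.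
  rewrite beta_integrandE /=.
  by apply: B => //; exact: cos_max.
- rewrite (_ : (fun t => _) = fun u => expR ((complex.Re s - 1) * ln u) * sin (complex.Im s * ln u) * (1 - u / N) ^+ n); last first.
    by apply/funext => u; rewrite beta_integrandE.
  by meas_auto.
- move=> u Du; have uN : 0 < u <= N by move: Du; rewrite /= in_itv.
  rewrite beta_integrandE /=.
  by apply: B => //; exact: sin_max.
Qed.

Lemma Re_gt0_neq0 s : 0 < complex.Re s -> s != 0.
Proof. by move=> s0; apply/eqP => s00; move: s0; rewrite s00 ltxx. Qed.

Lemma beta_integral0 N s : 0 < N -> 0 < complex.Re s ->
  beta_integral 0 N s = cpower N s / s.
Proof.
move=> N0 s0; apply: (mulfI (Re_gt0_neq0 s s0)).
rewrite mulrCA divff ?Re_gt0_neq0// mulr1.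
have ci := cintegrable_beta 0 N s N0 s0.
have [c1 c2] := cintegrableZ _ _ s (measurable_itv _) ci.
rewrite -cintegralZ// cpowerE.
set a := complex.Re s in c1 c2 *; set b := complex.Im s in c1 c2 *.
have bnd (g : R -> R) : (forall u, `|g u| <= 1) -> expR (a * ln u) * g u @[u --> 0^'+] --> (0 : R).
  move=> g1; apply: norm_cvg0; apply: squeeze_cvgr (cvg_cst _) (expRln_cvg0 a s0).
  by near=> u; rewrite normr_ge0 /= normrM ger0_norm ?expR_ge0// ler_piMr ?expR_ge0.
have ReE u : complex.Re (s * beta_integrand 0 N s u) =
    a * expR ((a - 1) * ln u) * cos (b * ln u) - b * expR ((a - 1) * ln u) * sin (b * ln u).
  by rewrite cReM beta_integrandE /= expr0 -/a -/b; ring.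
have ImE u : complex.Im (s * beta_integrand 0 N s u) =
    a * expR ((a - 1) * ln u) * sin (b * ln u) + b * expR ((a - 1) * ln u) * cos (b * ln u).
  by rewrite cImM beta_integrandE /= expr0 -/a -/b; ring.
have pE u : 0 < u -> expR (a * ln u) / u = expR ((a - 1) * ln u).
  by move=> u0; rewrite mulrBl mul1r expRB lnK ?posrE.
have D1 (u : R) : 0 < u -> is_derive u 1 (fun u => expR (a * ln u) * cos (b * ln u))
    (a * expR ((a - 1) * ln u) * cos (b * ln u) - b * expR ((a - 1) * ln u) * sin (b * ln u)).
  move=> u0; have dp := is_derive_pow a u u0.
  by derive_auto; rewrite -pE//; field; exact: lt0r_neq0.
have D2 (u : R) : 0 < u -> is_derive u 1 (fun u => expR (a * ln u) * sin (b * ln u))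
    (a * expR ((a - 1) * ln u) * sin (b * ln u) + b * expR ((a - 1) * ln u) * cos (b * ln u)).
  move=> u0; have dp := is_derive_pow a u u0.
  by derive_auto; rewrite -pE//; field; exact: lt0r_neq0.
have mN : measurable `]0, N] by [].
have i1 := eq_integ _ _ _ mN (fun u _ => ReE u) c1; have i2 := eq_integ _ _ _ mN (fun u _ => ImE u) c2.
have C1 (u : R) : 0 < u -> {for u, continuous (fun u => a * expR ((a - 1) * ln u) * cos (b * ln u) - b * expR ((a - 1) * ln u) * sin (b * ln u))}.
  by move=> u0; cont_auto.
have C2 (u : R) : 0 < u -> {for u, continuous (fun u => a * expR ((a - 1) * ln u) * sin (b * ln u) + b * expR ((a - 1) * ln u) * cos (b * ln u))}.
  by move=> u0; cont_auto.
apply: complex_eq.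
- rewrite -[LHS]/(\int[mu]_(u in `]0, N]) complex.Re (s * beta_integrand 0 N s u)) (eq_Rint _ _ _ (fun u _ => ReE u)).
  by rewrite (FTC2_0c N _ _ 0 N0 i1 D1 C1 (bnd _ (fun u => cos_max _))) subr0.
- rewrite -[LHS]/(\int[mu]_(u in `]0, N]) complex.Im (s * beta_integrand 0 N s u)) (eq_Rint _ _ _ (fun u _ => ImE u)).
  by rewrite (FTC2_0c N _ _ 0 N0 i2 D2 C2 (bnd _ (fun u => sin_max _))) subr0.
Unshelve. all: by end_near. Qed.

(** One factor is split off, [(1 - u/N)^(n+1) = (1 - u/N)^n - (u/N) (1 - u/N)^n], and [u] is
    absorbed by the shift of [s]; this is why [beta_integralE] is proved by induction for all [s] at
    once. *)
Lemma beta_integralS n N s : 0 < N -> 0 < complex.Re s ->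
  beta_integral n.+1 N s = beta_integral n N s - N^-1%:C * beta_integral n N (s + 1).
Proof.
move=> N0 s0; have s10 : 0 < complex.Re (s + 1) by rewrite cReD /= addr_gt0.
have mN : measurable `]0, N] by [].
have c1 := cintegrable_beta n N s N0 s0; have c2 := cintegrable_beta n N (s + 1) N0 s10.
rewrite /beta_integral -cintegralZ// -cintegralB//; last exact: cintegrableZ.
apply: eq_cintegral => u; rewrite /= in_itv/= => /andP[u0 _].
have E : cpower u s = cpower u (s - 1) * u%:C by rewrite -[in LHS](subrK 1 s) (cpowerD u (s - 1) 1) cpower1.
rewrite /beta_integrand addrK E exprS rmorphM rmorphB rmorph1 rmorphM /=.
by ring.
Qed.

Lemma beta_integralE n N s : 0 < N -> 0 < complex.Re s ->
  beta_integral n N s = cpower N s * n`!%:R / \prod_(k < n.+1) (s + k%:R).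
Proof.
move=> N0; elim: n s => [|n IH] s s0.
  by rewrite beta_integral0// big_ord1 addr0 fact0 mulr1.
have s10 : 0 < complex.Re (s + 1) by rewrite cReD /= addr_gt0.
rewrite beta_integralS// !IH// cpowerD cpower1//.
have nz (z : R[i]) m : 0 < complex.Re z -> \prod_(k < m) (z + k%:R) != 0.
  move=> z0; apply/prodf_neq0 => k _; apply: Re_gt0_neq0.
  by rewrite cReD cRe_nat ltr_wpDr.
have E1 : \prod_(k < n.+2) (s + k%:R) = \prod_(k < n.+1) (s + k%:R) * (s + n.+1%:R).
  by rewrite big_ord_recr.
have E2 : \prod_(k < n.+2) (s + k%:R) = s * \prod_(k < n.+1) (s + 1 + k%:R).
  rewrite big_ord_recl addr0; congr (_ * _); apply: eq_bigr => k _.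
  by rewrite -addrA nat1r.
have P1 := nz s n.+1 s0; have P2 := nz (s + 1) n.+1 s10; have P3 := nz s n.+2 s0.
have sn0 : s + n.+1%:R != 0 by move: P3; rewrite E1 mulf_eq0 negb_or => /andP[].
have s00 := Re_gt0_neq0 s s0.
have Q1 : (\prod_(k < n.+1) (s + k%:R))^-1 = (s + n.+1%:R) / \prod_(k < n.+2) (s + k%:R).
  by rewrite E1 invfM mulrCA mulfV ?mulr1.
have Q2 : (\prod_(k < n.+1) (s + 1 + k%:R))^-1 = s / \prod_(k < n.+2) (s + k%:R).
  by rewrite E2 invfM mulrA mulfV ?mul1r.
have NN : N^-1%:C * N%:C = 1 by rewrite -rmorphM /= mulVf ?gt_eqF.
rewrite Q1 Q2 factS natrM.
(* Over the common denominator the numerator is [(s + n + 1) - s = n + 1], the factor that raises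
   the factorial. *)
transitivity (cpower N s * n`!%:R * (s + n.+1%:R - (N^-1%:C * N%:C) * s) / \prod_(k < n.+2) (s + k%:R)).
  by ring.
by rewrite NN; ring.
Qed.

End beta_integral.

Section gauss_limit.
Context {R : realType}.
Implicit Types (s z : R[i]) (u v : nat -> R[i]) (n : nat).

Definition cvgC u z : Prop :=
  complex.Re (u n) @[n --> \oo] --> complex.Re z /\
  complex.Im (u n) @[n --> \oo] --> complex.Im z.

Lemma cvgCM u v z s : cvgC u z -> cvgC v s -> cvgC (fun n => u n * v n) (z * s).
Proof.
move=> [u1 u2] [v1 v2]; split.
  rewrite cReM; under eq_fun do rewrite cReM.
  by apply: cvgB; apply: cvgM.
rewrite cImM; under eq_fun do rewrite cImM.
by apply: cvgD; apply: cvgM.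
Qed.

Lemma cvgC_unique u z s : cvgC u z -> cvgC u s -> z = s.
Proof.
move=> [u1 u2] [v1 v2]; apply: complex_eq.
  by rewrite -(cvg_lim _ u1)// -(cvg_lim _ v1).
by rewrite -(cvg_lim _ u2)// -(cvg_lim _ v2).
Qed.

Lemma cvgC_subseq u z (f : nat -> nat) : f n @[n --> \oo] --> \oo ->
  cvgC u z -> cvgC (u \o f) z.
Proof.
move=> ff [u1 u2]; split.
  exact: (cvg_comp f (fun n => complex.Re (u n)) ff u1).
exact: (cvg_comp f (fun n => complex.Im (u n)) ff u2).
Qed.

Lemma cvgC_eq u v z : u =1 v -> cvgC u z -> cvgC v z.
Proof. by move=> /funext ->. Qed.

(** Gauss's product [N^s N! / (s (s + 1) ... (s + N))] with [N = n + 1], the shift avoiding the base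
    [0]. *)
Definition gauss n s : R[i] :=
  cpower n.+1%:R s * n.+1`!%:R / \prod_(k < n.+2) (s + k%:R).

Let dominated (g : R -> R) (a : R) : 0 < a -> measurable_fun setT g ->
  (forall x, `|g x| <= 1) ->
  \int[mu]_(x in `]0, n.+1%:R]) (expR ((a - 1) * ln x) * g x * (1 - x / n.+1%:R) ^+ n.+1)
    @[n --> \oo] --> \int[mu]_(x in `]0, +oo[) (gammad a x * g x).
Proof.
move=> a0 mg g1.
pose h n x := expR ((a - 1) * ln x) * g x * (1 - x / n.+1%:R) ^+ n.+1.
have mh n : measurable_fun `](0:R), +oo[ (h n).
  have mg' : measurable_fun `](0:R), +oo[ g by exact: measurable_funTS.
  by rewrite /h; meas_auto.
have [||||_ +] := Rintegral_dominated `]0, +oo[ (fun n => h n \_ `]0, n.+1%:R])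
  (fun x => gammad a x * g x) (gammad a) (measurable_itv _).
- by move=> n; apply: measurable_fun_patch.
- move=> x; rewrite /= in_itv/= andbT => x0.
  have l : h n x @[n --> \oo] --> gammad a x * g x.
    rewrite /h /gammad (_ : expR (- x) * _ * _ = expR ((a - 1) * ln x) * g x * expR (- x)); last by ring.
    by apply: cvgM; [exact: cvg_cst|exact: exprn_1BM_cvg].
  apply: cvg_trans l; apply: near_eq_cvg; near=> n.
  rewrite patchE mem_set// /= in_itv/= x0/=.
  have : x <= n%:R by near: n; exact: nbhs_infty_ger.
  by move=> /le_trans; apply; rewrite ler_nat.
- exact: integrable_gammad.
- move=> n x; rewrite /= in_itv/= andbT => x0; rewrite patchE; case: ifPn; last first.
    by rewrite normr0 gammad_ge0.
  rewrite inE /= in_itv/= => /andP[_ xn].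
  have y0 : 0 <= 1 - x / n.+1%:R by rewrite subr_ge0 ler_pdivrMr// mul1r.
  rewrite /h /gammad -mulrA normrM (ger0_norm (expR_ge0 _)) mulrC ler_wpM2r ?expR_ge0//.
  rewrite normrM normrX (ger0_norm y0) -[leRHS]mul1r ler_pM ?exprn_ge0//.
  by apply: exprn_1BM_le; rewrite ltW.
- apply: cvg_trans; apply: near_eq_cvg; apply: nearW => n.
  rewrite -Rintegral_mkcondr; congr (Rintegral _ _ _).
  apply/seteqP; split=> x; rewrite /= !in_itv/= andbT; first by case.
  by move=> /andP[-> ->].
Unshelve. all: by end_near. Qed.

(** [gauss n s] is the beta integral with [n = N]; by [exprn_1BM_le] the gamma density dominates its
    integrand. *)
Lemma gauss_cvg s : 0 < complex.Re s -> cvgC (gauss ^~ s) (euler_integral s).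
Proof.
move=> s0; rewrite euler_integralE.
have E n : gauss n s = beta_integral n.+1 n.+1%:R s by rewrite beta_integralE.
split=> /=.
- under eq_fun do rewrite E.
  rewrite (_ : (fun n => _) = fun n => \int[mu]_(x in `]0, n.+1%:R]) (expR ((complex.Re s - 1) * ln x) * cos (complex.Im s * ln x) * (1 - x / n.+1%:R) ^+ n.+1)); last first.
    by apply/funext => n; apply: eq_Rint => x _; rewrite beta_integrandE.
  by apply: (dominated (fun x => cos (complex.Im s * ln x))) => // [|x]; [meas_auto|exact: cos_max].
- under eq_fun do rewrite E.
  rewrite (_ : (fun n => _) = fun n => \int[mu]_(x in `]0, n.+1%:R]) (expR ((complex.Re s - 1) * ln x) * sin (complex.Im s * ln x) * (1 - x / n.+1%:R) ^+ n.+1)); last first.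
    by apply/funext => n; apply: eq_Rint => x _; rewrite beta_integrandE.
  by apply: (dominated (fun x => sin (complex.Im s * ln x))) => // [|x]; [meas_auto|exact: sin_max].
Qed.

(** The squared modulus as an element of [R], whereas the norm on [R[i]] has values in [R[i]]. *)
Definition sqnorm z : R := complex.Re z ^+ 2 + complex.Im z ^+ 2.

Lemma sqnormM z s : sqnorm (z * s) = sqnorm z * sqnorm s.
Proof. by rewrite /sqnorm cReM cImM; ring. Qed.

Lemma sqnorm1 : sqnorm 1 = 1.
Proof. by rewrite /sqnorm /= expr1n expr0n addr0. Qed.

Lemma sqnormV z : sqnorm z^-1 = (sqnorm z)^-1.
Proof.
have [->|z0] := eqVneq z 0; first by rewrite invr0 /sqnorm /= expr0n addr0 invr0.
have h : sqnorm z * sqnorm z^-1 = 1 by rewrite -sqnormM mulfV// sqnorm1.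
have zn : sqnorm z != 0 by apply/eqP => e; move: h; rewrite e mul0r => /esym/eqP; rewrite oner_eq0.
by apply: (mulfI zn); rewrite h mulfV.
Qed.

Lemma sqnorm_prod n (F : nat -> R[i]) :
  sqnorm (\prod_(k < n) F k) = \prod_(k < n) sqnorm (F k).
Proof.
by elim: n => [|n IH]; [rewrite !big_ord0 sqnorm1|rewrite !big_ord_recr /= sqnormM IH].
Qed.

Lemma sqnorm_cpower t s : sqnorm (cpower t s) = expR (complex.Re s * ln t) ^+ 2.
Proof.
by rewrite /sqnorm cpowerE /= !exprMn -mulrDr cos2Dsin2 mulr1.
Qed.

Lemma cvg_sqnorm u z : cvgC u z -> sqnorm (u n) @[n --> \oo] --> sqnorm z.
Proof. by move=> [u1 u2]; apply: cvgD; rewrite !expr2; under eq_fun do rewrite expr2; apply: cvgM. Qed.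

(** Telescoping, from [1 / (y + 1)^2 <= 1 / y - 1 / (y + 1)]; the term [k = 0] is kept as it is. *)
Lemma sum_inv_sqr_le (a : R) n : 0 < a ->
  \sum_(k < n.+1) (a + k%:R) ^- 2 <= a ^- 2 + a^-1 - (a + n%:R)^-1.
Proof.
move=> a0; elim: n => [|n IH]; first by rewrite big_ord1 addr0; lra.
rewrite big_ord_recr /= -natr1 addrA; move: IH; set S := \sum_(_ < _) _ => IH.
have p : 0 < a + n%:R by rewrite ltr_wpDr.
have q : 0 < a + n%:R + 1 by rewrite addr_gt0.
suff : (a + n%:R + 1) ^- 2 <= (a + n%:R)^-1 - (a + n%:R + 1)^-1 by lra.
move: (a + n%:R) p q => y p q.
rewrite (_ : y^-1 - (y + 1)^-1 = (y * (y + 1))^-1); last by field; rewrite !gt_eqF.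
by rewrite lef_pV2 ?posrE ?mulr_gt0 ?exprn_gt0//; nra.
Qed.

(** For [s = a + i b] each squared factor is [(a + k)^2 (1 + b^2 / (a + k)^2)]. The product of the
    second factors is at most [exp (b^2 sum 1 / (a + k)^2)], bounded independently of [n], so the
    comparison with the real point [a] survives in the limit. *)
Lemma sqnorm_gauss_ge n s : 0 < complex.Re s ->
  sqnorm (gauss n (complex.Re s)%:C) *
    expR (- (complex.Im s ^+ 2 * (complex.Re s ^- 2 + (complex.Re s)^-1))) <= sqnorm (gauss n s).
Proof.
move=> s0.
have E z : sqnorm (gauss n z) = expR (complex.Re z * ln n.+1%:R) ^+ 2 *
    (sqnorm n.+1`!%:R / \prod_(k < n.+2) sqnorm (z + k%:R)).
  rewrite -sqnorm_cpower -(sqnorm_prod _ (fun k => z + k%:R)) /gauss.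
  by move: (cpower _ _) => c; rewrite !sqnormM sqnormV mulrA.
rewrite !E /= -!(mulrA (expR _ ^+ 2)) -!(mulrA (sqnorm _)).
apply: ler_wpM2l; first by rewrite exprn_ge0 ?expR_ge0.
apply: ler_wpM2l; first by rewrite /sqnorm addr_ge0 ?sqr_ge0.
set a := complex.Re s in s0 *; set b := complex.Im s.
have kp (k : nat) : 0 < a + k%:R by rewrite ltr_wpDr.
have E1 k : sqnorm (a%:C + k%:R) = (a + k%:R) ^+ 2.
  by rewrite /sqnorm cReD cImD cRe_nat cIm_nat /= addr0 expr0n addr0.
have E2 k : sqnorm (s + k%:R) = (a + k%:R) ^+ 2 * (1 + b ^+ 2 * (a + k%:R) ^- 2).
  rewrite /sqnorm cReD cImD cRe_nat cIm_nat /= addr0 -/a -/b; field; exact: lt0r_neq0.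
under eq_bigr do rewrite E1.
under [in leRHS]eq_bigr do rewrite E2.
rewrite [in leRHS]big_split /= [leRHS]invfM; apply: ler_wpM2l.
  by rewrite invr_ge0 prodr_ge0// => i _; exact: sqr_ge0.
have pp : 0 < \prod_(i < n.+2) (1 + b ^+ 2 * (a + i%:R) ^- 2).
  apply: prodr_gt0 => i _; rewrite ltr_wpDr// mulr_ge0 ?sqr_ge0// invr_ge0 exprn_ge0// ltW//.
rewrite expRN lef_pV2 ?posrE ?expR_gt0//.
apply: (@le_trans _ _ (\prod_(i < n.+2) expR (b ^+ 2 * (a + i%:R) ^- 2))).
  apply: ler_prod => i _; rewrite expR_ge1Dx andbT addr_ge0// mulr_ge0 ?sqr_ge0//.
  by rewrite invr_ge0 exprn_ge0// ltW.
rewrite -expR_sum ler_expR -mulr_sumr ler_wpM2l ?sqr_ge0//.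
apply: le_trans (sum_inv_sqr_le a n.+1 s0) _.
by rewrite gerBl invr_ge0 ltW.
Qed.

Lemma Rintegral_0oo_gt0 (f : R -> R) (m : R) : 0 < m ->
  integ `]0, +oo[ f -> (forall x, 0 < x -> 0 <= f x) ->
  (forall x, 1 <= x <= 2 -> m <= f x) -> 0 < \int[mu]_(x in `]0, +oo[) f x.
Proof.
move=> m0 fi f0 fm.
have sub : `[(1:R), 2] `<=` `]0, +oo[.
  by move=> x; rewrite /= !in_itv/= andbT => /andP[x1 _]; exact: lt_le_trans x1.
have mi : measurable `[(1:R), 2] by [].
have fi12 : integ `[(1:R), 2] f by apply: integrableS fi.
apply: (@lt_le_trans _ _ (\int[mu]_(x in `[(1:R), 2]) m)).
  rewrite Rintegral_cst//= lebesgue_measure_itv/= lte_fin ltr1n/=.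
  by rewrite mulr_gt0//; lra.
apply: (@le_trans _ _ (\int[mu]_(x in `[(1:R), 2]) f x)).
  have im : integ `[(1:R), 2] (fun=> m).
    apply: (integrable_dominated _ _ _ _ _ fi12) => //.
    by move=> x; rewrite /= in_itv/= => x12; rewrite ger0_norm ?(ltW m0)//; exact: fm.
  by apply: le_Rintegral => // x; rewrite /= in_itv/=; exact: fm.
have -> : `[(1:R), 2]%classic = `]0, +oo[ `&` `[1, 2] by rewrite setIC; apply/esym/setIidPl.
rewrite Rintegral_mkcondr; apply: le_Rintegral => //.
- apply: (integrable_dominated _ _ _ _ _ fi) => //.
    by apply: measurable_fun_patch => //; exact: integrable_measurable_fun.
  move=> x; rewrite /= in_itv/= andbT => x0; rewrite patchE.
  by case: ifPn => _; rewrite ?normr0 ?f0// ger0_norm// f0.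
- move=> x; rewrite /= in_itv/= andbT => x0; rewrite patchE.
  by case: ifPn => // _; exact: f0.
Qed.

Lemma gammad_ge (a u : R) : 1 <= u <= 2 -> expR (- 2) * expR (- `|a - 1|) <= gammad a u.
Proof.
move=> /andP[u1 u2]; have u0 : 0 < u by exact: lt_le_trans u1.
apply: ler_pM; rewrite ?expR_ge0// ler_expR ?lerN2//.
have l0 : 0 <= ln u by exact: ln_ge0.
have l1 : ln u <= 1.
  have -> : u = 1 + (u - 1) by ring.
  by apply: (le_trans (le_ln1Dx _)); lra.
have : `|(a - 1) * ln u| <= `|a - 1| by rewrite normrM (ger0_norm l0) ler_piMr.
by rewrite ler_norml => /andP[].
Qed.

Lemma euler_real_gt0 (a : R) : 0 < a -> 0 < complex.Re (euler_integral a%:C).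
Proof.
move=> a0; rewrite euler_integralE /=.
under eq_Rintegral do rewrite mul0r cos0 mulr1.
apply: (Rintegral_0oo_gt0 _ (expR (- 2) * expR (- `|a - 1|))).
- by rewrite mulr_gt0 ?expR_gt0.
- exact: integrable_gammad.
- by move=> x _; exact: gammad_ge0.
- by move=> x; exact: gammad_ge.
Qed.

(** In the limit of [sqnorm_gauss_ge], the squared modulus at [s] is at least a positive multiple of
    that at [Re s], where Euler's integral is positive. *)
Lemma euler_integral_neq0 s : 0 < complex.Re s -> euler_integral s != 0.
Proof.
move=> s0; apply/eqP => e0.
have e1 := euler_real_gt0 (complex.Re s) s0.
set C := expR (- (complex.Im s ^+ 2 * (complex.Re s ^- 2 + (complex.Re s)^-1))).
have l1 : sqnorm (gauss n (complex.Re s)%:C) * C @[n --> \oo] -->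
    sqnorm (euler_integral (complex.Re s)%:C) * C.
  by apply: cvgM; [apply: cvg_sqnorm; exact: gauss_cvg|exact: cvg_cst].
have l2 : sqnorm (gauss n s) @[n --> \oo] --> sqnorm (euler_integral s).
  by apply: cvg_sqnorm; exact: gauss_cvg.
have : sqnorm (euler_integral (complex.Re s)%:C) * C <= sqnorm (euler_integral s).
  rewrite -(cvg_lim _ l1)// -(cvg_lim _ l2)//; apply: ler_lim.
  - by apply/cvg_ex; eexists; exact: l1.
  - by apply/cvg_ex; eexists; exact: l2.
  - by apply: nearW => n; exact: sqnorm_gauss_ge.
rewrite e0 {2}/sqnorm /= expr0n addr0 leNgt => /negP; apply.
by rewrite mulr_gt0 ?expR_gt0// /sqnorm ltr_wpDr ?sqr_ge0// exprn_gt0.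
Qed.

End gauss_limit.

Section gamma_half.
Context {R : realType}.
Import gauss_integral_proof.

(* FTC for [2 erf (sqrt u)], up to normalisation. *)
Lemma euler_integral_half : euler_integral (2^-1)%:C = (Num.sqrt pi)%:C :> R[i].
Proof.
rewrite euler_integralE /=; apply: complex_eq => /=; last first.
  under eq_Rintegral do rewrite mul0r sin0 mulr0.
  by rewrite /Rintegral integral0.
under eq_Rintegral do rewrite mul0r cos0 mulr1.
pose q (u : R) := expR (2^-1 * ln u).
have q0 u : 0 < q u by exact: expR_gt0.
have qq u : 0 < u -> q u ^+ 2 = u by move=> u0; rewrite /q -expRM_natl mulrA divff// mul1r lnK.
have dG (x : R) : 0 < x -> is_derive x 1 integral0_gauss (gauss_fun x).
  move=> x0.
  have [//|||//|] := @continuous_FTC1 R gauss_fun (BLeft 0) x (x + 1).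
  - by rewrite ltrDl.
  - apply: continuous_compact_integrable; first exact: segment_compact.
    by apply: continuous_subspaceT; exact: continuous_gauss_fun.
  - by rewrite /= lte_fin.
  - exact: continuous_gauss_fun.
  - by move=> dG <-; rewrite derive1E; split.
have D (u : R) : 0 < u -> is_derive u 1 (fun u => 2 * integral0_gauss (q u)) (gammad 2^-1 u).
  move=> u0; have dq : is_derive u 1 q (2^-1 * expR ((2^-1 - 1) * ln u)) by exact: is_derive_pow.
  have dGq := is_derive1_comp (dG _ (q0 u)) dq.
  apply: (is_derive_eq (derM _ _ _ _ _ (derC _ 2) dGq)).
  by rewrite mul0r add0r /gauss_fun qq// /gammad; field.
have cvgG : @integral0_gauss R y @[y --> +oo] --> Num.sqrt pi / 2.
  have : Num.sqrt (@integral0_gauss R y ^+ 2) @[y --> +oo] --> Num.sqrt (pi / 4).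
    by apply: continuous_cvg; [exact: sqrt_continuous|exact: cvg_integral0_gauss_sqr].
  rewrite sqrtrM ?pi_ge0// sqrtrV// (_ : 4 = 2 ^+ 2 :> R); last by ring.
  rewrite sqrtr_sqr ger0_norm// (_ : (fun _ => Num.sqrt _) = integral0_gauss)//.
  by apply/funext => r; rewrite sqrtr_sqr// ger0_norm// integral0_gauss_ge0.
rewrite (FTC2_oy 0 (gammad 2^-1) (fun u => 2 * integral0_gauss (q u)) 0 (2 * (Num.sqrt pi / 2))) //.
- by field.
- exact: integrable_gammad.
- by move=> u u0; rewrite /gammad; cont_auto.
- rewrite -[X in _ --> X](mulr0 2); apply: cvgM; first exact: cvg_cst.
  apply: (squeeze_cvgr _ (cvg_cst 0) (expRln_cvg0 2^-1 _)) => //.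
  near=> u; rewrite integral0_gauss_ge0 /=.
  have -> : expR (2^-1 * ln u) = \int[mu]_(x in `[0, q u]) (1 : R).
    by rewrite Rintegral_cst//= lebesgue_measure_itv/= lte_fin q0 /= subr0 mul1r.
  apply: le_Rintegral => //.
  + apply: continuous_compact_integrable; first exact: segment_compact.
    by apply: continuous_subspaceT; exact: continuous_gauss_fun.
  + apply: continuous_compact_integrable; first exact: segment_compact.
    by apply: continuous_subspaceT => ?; exact: cvg_cst.
  + by move=> x _; exact: gauss_fun_le1.
- apply: cvgM; first exact: cvg_cst.
  by apply: (cvg_comp q integral0_gauss _ cvgG); exact: expRln_cvgy.
Unshelve. all: by end_near. Qed.

End gamma_half.

(** * Legendre's duplication formula *)

Section duplication.
Context {R : realType}.
Implicit Types (s z : R[i]) (n : nat).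

Lemma half_complexE : 2^-1 = (2^-1 : R)%:C :> R[i].
Proof. by rewrite fmorphV rmorph_nat. Qed.

Lemma natr_complexE n : n%:R = (n%:R : R)%:C :> R[i].
Proof. by rewrite rmorph_nat. Qed.

(** The part of the finite duplication formula that does not depend on [s]. Its limit can therefore
    be read off at one value of [s]. *)
Let dup_factor n : R :=
  expR (2^-1 * ln n.+1%:R) * n.+1`!%:R ^+ 2 * 4 ^+ n.+2 / (n.*2.+3)`!%:R.

Lemma big_ord_double n (F : nat -> R[i]) :
  \prod_(j < n.*2) F j = \prod_(k < n) (F k.*2 * F k.*2.+1).
Proof.
elim: n => [|n IH]; first by rewrite !big_ord0.
by rewrite doubleS !big_ord_recr /= IH mulrA.
Qed.

(** [(2s + 2k) (2s + 2k + 1) = 4 (s + k) (s + 1/2 + k)] pairs the denominators; [n + 2] pairs make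
    [2n + 4] factors, which is [gauss] at index [n.*2.+2]. The ratio under [cpower] tends to [1/2]
    and yields [2^(-2s)]. *)
Lemma gauss_duplication n s : gauss n s * gauss n (s + 2^-1) =
  gauss n.*2.+2 (2 * s) * cpower (n.+1%:R / n.*2.+3%:R) (2 * s) * (dup_factor n)%:C.
Proof.
rewrite /gauss cpower_mul ?invr_gt0// cpowerV// cpowerNE.
have -> : \prod_(k < n.*2.+4) (2 * s + k%:R) =
    4 ^+ n.+2 * (\prod_(k < n.+2) (s + k%:R) * \prod_(k < n.+2) (s + 2^-1 + k%:R)).
  rewrite -[n.*2.+4]/(n.+2.*2) (big_ord_double _ (fun k => 2 * s + k%:R)).
  have -> : 4 ^+ n.+2 = \prod_(k < n.+2) 4 :> R[i] by rewrite prodr_const card_ord.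
  rewrite -!big_split /=.
  apply: eq_bigr => k _; rewrite -[k.*2.+1%:R]natr1 -mul2n natrM.
  by field.
rewrite half_complexE cpowerD cpower_real -half_complexE.
rewrite (_ : 2 * s = s + s); last by ring.
have -> : (dup_factor n)%:C = (expR (2^-1 * ln n.+1%:R))%:C * n.+1`!%:R ^+ 2 * 4 ^+ n.+2
    / (n.*2.+3)`!%:R :> R[i].
  by rewrite /dup_factor !natr_complexE -fmorphV -!rmorphXn -!rmorphM.
rewrite !cpowerD.
have c0 := cpower_neq0 n.*2.+3%:R s.
have f0 : (n.*2.+3)`!%:R != 0 :> R[i] by rewrite pnatr_eq0 -lt0n fact_gt0.
have p0 : 4 ^+ n.+2 != 0 :> R[i] by rewrite expf_neq0// pnatr_eq0.
move: c0 f0 p0; move: (cpower n.*2.+3%:R s) (cpower _ s) (n.*2.+3)`!%:R (4 ^+ n.+2) => c c' f p c0 f0 p0.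
move: (\prod_(k < _) _) (\prod_(k < _) _) => P Q.
rewrite (invfM p) (invfM Q) (invfM c'); move: P^-1 Q^-1 => P' Q'.
by field; rewrite c0 f0 p0.
Qed.

Lemma cvgCV (u : nat -> R[i]) z : z != 0 -> cvgC u z -> cvgC (fun n => (u n)^-1) z^-1.
Proof.
move=> z0 uz.
have ReV w : complex.Re w^-1 = complex.Re w / sqnorm w by case: w.
have ImV w : complex.Im w^-1 = - complex.Im w / sqnorm w by case: w => a b; rewrite mulNr.
have n0 : sqnorm z != 0.
  apply/eqP => e; have := sqnormM z z^-1; rewrite e mul0r mulfV// sqnorm1 => /eqP.
  by rewrite oner_eq0.
have [u1 u2] := uz; have lV : (sqnorm (u n))^-1 @[n --> \oo] --> (sqnorm z)^-1.
  by apply: cvgV => //; exact: cvg_sqnorm.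
split.
  by rewrite ReV; under eq_fun do rewrite ReV; apply: cvgM.
by rewrite ImV; under eq_fun do rewrite ImV; apply: cvgM => //; exact: cvgN.
Qed.

Let doubleSS_cvg : n.*2.+2 @[n --> \oo] --> \oo.
Proof.
apply/cvgnyPge => A; near=> n.
have : (A <= n)%N by near: n; exact: nbhs_infty_ge.
by move=> /leq_trans; apply; rewrite -addnn -addn2 -addnA leq_addr.
Unshelve. all: by end_near. Qed.

Let half_cvg : n.+1%:R / n.*2.+3%:R @[n --> \oo] --> (2^-1 : R).
Proof.
have h : n.*2.+3%:R^-1 @[n --> \oo] --> (0 : R).
  exact: (cvg_comp _ (fun n => n.+1%:R^-1) doubleSS_cvg (@cvg_harmonic R)).
rewrite (_ : (fun n => _) = fun n => 2^-1 * (1 - n.*2.+3%:R^-1)).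
  rewrite -[X in _ --> X]mulr1; apply: cvgM; first exact: cvg_cst.
  by rewrite -[X in _ --> X]subr0; apply: cvgB; [exact: cvg_cst|exact: h].
apply/funext => n; have : n.*2.+3%:R != 0 :> R by rewrite pnatr_eq0.
have -> : n.*2.+3%:R = 2 * n.+1%:R + 1 :> R by rewrite -natrM natr1 mul2n.
by move=> ?; field.
Qed.

Let cpower_half_cvg z : cvgC (fun n => cpower (n.+1%:R / n.*2.+3%:R) z) (cpower 2^-1 z).
Proof.
have h : (0 : R) < 2^-1 by [].
split; rewrite cpowerE; under eq_fun do rewrite cpowerE.
- have c : {for (2^-1 : R), continuous (fun t => expR (complex.Re z * ln t) * cos (complex.Im z * ln t))}.
    by cont_auto.
  exact: (cvg_comp _ _ half_cvg c).
- have c : {for (2^-1 : R), continuous (fun t => expR (complex.Re z * ln t) * sin (complex.Im z * ln t))}.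
    by cont_auto.
  exact: (cvg_comp _ _ half_cvg c).
Qed.

Let gauss_double_cvg s : 0 < complex.Re s ->
  cvgC (fun n => gauss n.*2.+2 (2 * s) * cpower (n.+1%:R / n.*2.+3%:R) (2 * s))
    (euler_integral (2 * s) * cpower 2^-1 (2 * s)).
Proof.
move=> s0; apply: cvgCM (cpower_half_cvg _).
apply: (cvgC_subseq (gauss ^~ (2 * s)) _ _ doubleSS_cvg).
apply: gauss_cvg.
by rewrite cReM cRe_nat cIm_nat mul0r subr0 mulr_gt0.
Qed.

Let Re_addhalf s : 0 < complex.Re s -> 0 < complex.Re (s + 2^-1).
Proof. by move=> s0; rewrite half_complexE cReD /= addr_gt0. Qed.

Lemma euler_integral_duplication s : 0 < complex.Re s ->
  euler_integral s * euler_integral (s + 2^-1) =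
  (2 * Num.sqrt pi)%:C * cpower 2^-1 (2 * s) * euler_integral (2 * s).
Proof.
move=> s0.
have h0 : 0 < complex.Re (2^-1 : R[i]) by rewrite half_complexE /=.
have hh : 2^-1 + 2^-1 = 1 :> R[i] by field.
have h2 : 2 * 2^-1 = 1 :> R[i] by field.
have e1 : euler_integral (1 : R[i]) != 0 by exact: euler_integral_neq0.
have Lim z : 0 < complex.Re z ->
    cvgC (fun n => gauss n z * gauss n (z + 2^-1)) (euler_integral z * euler_integral (z + 2^-1)).
  by move=> z0; apply: cvgCM; apply: gauss_cvg => //; exact: Re_addhalf.
(* At [s = 1/2] all values are known or cancel: [Gamma(1/2) Gamma(1) / (Gamma(1) / 2)] is
   [2 sqrt(pi)]. *)
have dl : cvgC (fun n => (dup_factor n)%:C) (2 * Num.sqrt pi)%:C.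
  have nz : euler_integral (2 * 2^-1) * cpower 2^-1 (2 * 2^-1) != 0 :> R[i].
    by rewrite mulf_neq0 ?cpower_neq0// h2.
  have l := cvgCM _ _ _ _ (Lim _ h0) (cvgCV _ _ nz (gauss_double_cvg _ h0)).
  have -> : (2 * Num.sqrt pi)%:C = euler_integral 2^-1 * euler_integral (2^-1 + 2^-1)
      / (euler_integral (2 * 2^-1) * cpower 2^-1 (2 * 2^-1)) :> R[i].
    rewrite hh h2 cpower1// {1}half_complexE euler_integral_half -half_complexE rmorphM rmorph_nat.
    by field.
  apply: cvgC_eq l => n; rewrite gauss_duplication.
  have g0 : gauss n.*2.+2 (2 * 2^-1) * cpower (n.+1%:R / n.*2.+3%:R) (2 * 2^-1) != 0 :> R[i].
    apply: mulf_neq0; last exact: cpower_neq0.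
    apply: mulf_neq0; first apply: mulf_neq0; first exact: cpower_neq0.
      by rewrite pnatr_eq0 -lt0n fact_gt0.
    rewrite h2.
    rewrite invr_eq0; apply/prodf_neq0 => k _; apply: Re_gt0_neq0.
    by rewrite cReD cRe_nat ltr_wpDr.
  by rewrite mulrAC mulfV// mul1r.
apply: cvgC_unique (Lim s s0) _.
have -> : (2 * Num.sqrt pi)%:C * cpower 2^-1 (2 * s) * euler_integral (2 * s) =
  euler_integral (2 * s) * cpower 2^-1 (2 * s) * (2 * Num.sqrt pi)%:C :> R[i] by rewrite mulrC mulrA mulrAC.
apply: (cvgC_eq (fun n => gauss n.*2.+2 (2 * s) * cpower (n.+1%:R / n.*2.+3%:R) (2 * s) * (dup_factor n)%:C)).
  by move=> n; rewrite gauss_duplication.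
exact: cvgCM (gauss_double_cvg _ s0) dl.
Qed.

Lemma cGammaE s : 0 < complex.Re s -> cGamma s = euler_integral s.
Proof.
move=> s0; rewrite /cGamma.
(* The truncation of a negative number is [0], so [N = 1] and the single division by [s] undoes the
   functional equation. *)
have -> : Num.truncn (- complex.Re s) = 0%N.
  by apply/truncn0Pn; rewrite -ltNge; lra.
rewrite big_ord1 addr0 euler_integralS//.
by rewrite mulrAC mulfV ?mul1r// Re_gt0_neq0.
Qed.

End duplication.

(** * The Meijer functions *)

Section vertical_line.
Context {R : realType}.
Implicit Types (c t : R) (p : R[i]).

(** The factor [2^-1] makes [w = - 2 s] equal to [C - i t] when [c = - C / 2], so [t] is the Fourier
    variable itself. *)
Definition vertical_line c t : R[i] := c +i* (2^-1 * t).

Lemma velocity_line c t : velocity (vertical_line c) t = 0 +i* 2^-1.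
Proof.
rewrite /velocity /vertical_line /=; congr (_ +i* _); rewrite derive1E.
  exact: derive_cst.
have d : is_derive t 1 (fun u : R => 2^-1 * u) 2^-1 by derive_auto; ring.
by case: d.
Qed.

Lemma is_contour_line c : is_contour (vertical_line c).
Proof.
have d t : is_derive t 1 (fun u : R => 2^-1 * u) 2^-1 by derive_auto; ring.
split.
- by split=> t /=; [exact: derivable_cst|case: (d t)].
- rewrite (_ : (fun t => complex.Re (velocity _ t)) = cst 0); last first.
    by apply/funext => u; rewrite velocity_line.
  rewrite (_ : (fun t => complex.Im (velocity _ t)) = cst 2^-1); last first.
    by apply/funext => u; rewrite velocity_line.
  by split=> t; exact: cvg_cst.
- by exists `|c| => t.
- apply/cvgrNyPle => A; near=> t; rewrite /= ler_pdivrMl; last by [].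
  by near: t; apply: nbhs_ninfty_le; exact: num_real.
- apply/cvgryPge => A; near=> t; rewrite /= ler_pdivlMl; last by [].
  by near: t; apply: nbhs_pinfty_ge; exact: num_real.
Unshelve. all: by end_near. Qed.

Let constant_path c p : complex.Re p != c -> avoiding_path (vertical_line c) (fun=> p).
Proof.
move=> pc; split=> [t|t|u t _]; try exact: cvg_cst.
by move=> e; move: pc; rewrite e eqxx.
Qed.

(** A point off a vertical line already lies in the required half-plane, so a constant path is
    enough. *)
Lemma right_of_line c p : c < complex.Re p -> right_of (vertical_line c) p.
Proof. by move=> cp; exists (fun=> p) => //; apply: constant_path; rewrite gt_eqF. Qed.

Lemma left_of_line c p : complex.Re p < c -> left_of (vertical_line c) p.
Proof. by move=> cp; exists (fun=> p) => //; apply: constant_path; rewrite lt_eqF. Qed.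

End vertical_line.

Section meijer_mellin.
Context {R : realType}.
Implicit Types (C t x : R) (s w z : R[i]).

Lemma cintegrable_euler s : 0 < complex.Re s ->
  cintegrable `]0, +oo[ (fun t => cpower t (s - 1) * (expR (- t))%:C).
Proof.
move=> s0; split.
  apply: eq_integ (integ_gammad_cos (complex.Re s) (complex.Im s) s0) => // u _.
  by rewrite Re_euler_integrand.
apply: eq_integ (integ_gammad_sin (complex.Re s) (complex.Im s) s0) => // u _.
by rewrite Im_euler_integrand.
Qed.

Lemma mellin_euler kc ks C x t : 0 < C ->
  euler_integral (C -i* t) * cpower x (- (C -i* t)) * (kc t +i* ks t) =
  mellin_Re kc ks C x t +i* mellin_Im kc ks C x t.
Proof.
move=> C0; rewrite -mulrA mulrC /euler_integral -cintegralZ//; last exact: cintegrable_euler.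
set P := cpower x _ * _.
have PR : complex.Re P = expR (- (C * ln x)) * (kc t * cos (t * ln x) - ks t * sin (t * ln x)).
  by rewrite /P (cpowerE x) cReM /= !(mulNr, opprK); ring.
have PI : complex.Im P = expR (- (C * ln x)) * (ks t * cos (t * ln x) + kc t * sin (t * ln x)).
  by rewrite /P (cpowerE x) cImM /= !(mulNr, opprK); ring.
congr (_ +i* _); apply: eq_Rint => u _.
  rewrite (cReM P) PR PI Re_euler_integrand Im_euler_integrand /=.
  by rewrite (mulrBr t) cosB sinB mulNr sinN cosN; ring.
rewrite (cImM P) PR PI Re_euler_integrand Im_euler_integrand /=.
by rewrite (mulrBr t) cosB sinB mulNr sinN cosN; ring.
Qed.

(** The constants combine to [(8 K) (i / 2) (2 pi) / (2 pi i) = 4 K]: [i / 2] is the velocity of the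
    line and [2 pi] comes from Fourier inversion. *)
Lemma meijerG_mellin m n (a b : seq R[i]) (z x C K : R) (f kc ks : R -> R) :
  0 < C -> fourier_pair f kc ks ->
  separates_poles m n a b (vertical_line (- C / 2)) ->
  (forall t, meijer_integrand m n a b z (vertical_line (- C / 2) t) =
     (8 * K)%:C * (mellin_Re kc ks C x t +i* mellin_Im kc ks C x t)) ->
  is_meijerG m n a b z
    (4 * K * \int[mu]_(u in `]0, +oo[) (gammad C u * expR (- (C * ln x)) * f (ln u - ln x)))%:C.
Proof.
move=> C0 fk sep E; exists (vertical_line (- C / 2)).
set A := \int[mu]_(u in _) _.
pose M t : R[i] := mellin_Re kc ks C x t +i* mellin_Im kc ks C x t.
have FE t : meijer_integrand m n a b z (vertical_line (- C / 2) t) * velocity (vertical_line (- C / 2)) t =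
    (0 +i* (4 * K)) * M t.
  rewrite E velocity_line -/(M t) mulrAC; congr (_ * _).
  by apply: complex_eq => /=; field.
have cM : cintegrable setT M by exact: (integrable_mellin f kc ks fk C x C0).
split=> //.
- exact: is_contour_line.
- by apply: eq_cintegrable (cintegrableZ _ _ (0 +i* (4 * K)) _ cM) => // t _; rewrite FE.
- rewrite (eq_cintegral _ _ (fun t => (0 +i* (4 * K)) * M t)); last by move=> t _; exact: FE.
  rewrite cintegralZ// (_ : cintegral setT M = (2 * pi * A)%:C); last first.
    by apply: complex_eq; [exact: (Rintegral_mellin_Re f kc ks fk C x C0)|exact: (Rintegral_mellin_Im f kc ks fk C x C0)].
  have p0 : 0 +i* (2 * pi) != 0 :> R[i].
    apply/eqP => -[] /eqP; rewrite mulf_eq0 pnatr_eq0 /= => /eqP p0.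
    by have := pi_gt0 R; rewrite p0 ltxx.
  apply: (mulfI p0); rewrite mulrA mulfV// mul1r.
  by apply: complex_eq => /=; ring.
Qed.

End meijer_mellin.

Section meijer_integrands.
Context {R : realType} (x : R) (x0 : 0 < x).
Implicit Types (w : R[i]).

Let cpower_quarter w : cpower (x ^+ 2 / 4) (- w / 2) = cpower x (- w) * cpower 2^-1 (- w).
Proof.
rewrite (_ : x ^+ 2 / 4 = (x * 2^-1) ^+ 2); last by field.
by rewrite cpowerX ?divr_gt0// mulrCA mulfV ?pnatr_eq0// mulr1 cpower_mul// invr_gt0.
Qed.

Let cpower_half1 : cpower 2^-1 1 = (2^-1) :> R[i].
Proof. by rewrite cpower1// half_complexE. Qed.

Let Re_half w : complex.Re (w / 2) = complex.Re w / 2.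
Proof. by rewrite half_complexE cReM /= mulr0 subr0. Qed.

Let meijer_integrand31 a1 a2 b1 b2 b3 b4 z (s : R[i]) :
  meijer_integrand 3 1 [:: a1; a2] [:: b1; b2; b3; b4] z s =
  cGamma (b1 - s) * (cGamma (b2 - s) * cGamma (b3 - s)) * cGamma (1 - a1 + s)
  / (cGamma (1 - b4 + s) * cGamma (a2 - s)) * cpower z s.
Proof.
rewrite /meijer_integrand /=; move: (@cGamma R) (cpower z s) => G P.
by rewrite !big_cons !big_nil !mulr1.
Qed.

Let meijer_integrand30 a1 b1 b2 b3 z (s : R[i]) :
  meijer_integrand 3 0 [:: a1] [:: b1; b2; b3] z s =
  cGamma (b1 - s) * (cGamma (b2 - s) * cGamma (b3 - s)) / cGamma (a1 - s) * cpower z s.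
Proof.
rewrite /meijer_integrand /=; move: (@cGamma R) (cpower z s) => G P.
by rewrite !big_cons !big_nil !mulr1 mul1r.
Qed.

(** Two quotients of the form [Gamma(z) / Gamma(z + 1) = 1 / z] produce [4 / (w (1 - w))] and leave
    [Gamma(w/2) Gamma(w/2 + 1/2)]. Duplication supplies [2 sqrt(pi) 2^(-w)], and [2^(-w)] cancels
    against [(x^2/4)^(-w/2)]. In the strip every gamma argument has positive real part. *)
Lemma meijer_integrand_tent w : 0 < complex.Re w < 1 ->
  meijer_integrand 3 1 [:: 2^-1; 1] [:: 0; 0; 2^-1; - 2^-1] (x ^+ 2 / 4) (- w / 2) =
  (8 * Num.sqrt pi)%:C * (euler_integral w * cpower x (- w) / (w * (1 - w))).
Proof.
move=> /andP[w0 w1].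
have p1 : 0 < complex.Re (w / 2) by rewrite Re_half; lra.
have p2 : 0 < complex.Re ((1 - w) / 2) by rewrite Re_half cReB /=; lra.
have p3 : 0 < complex.Re (w / 2 + 1) by rewrite cReD /=; lra.
have p4 : 0 < complex.Re (w / 2 + 2^-1) by rewrite cReD Re_half half_complexE /=; lra.
have p5 : 0 < complex.Re ((1 - w) / 2 + 1) by rewrite cReD /=; lra.
rewrite meijer_integrand31.
rewrite (_ : 0 - - w / 2 = w / 2); last by ring.
rewrite (_ : 2^-1 - - w / 2 = w / 2 + 2^-1); last by ring.
rewrite (_ : 1 - - w / 2 = w / 2 + 1); last by ring.
rewrite (_ : 1 - 2^-1 + - w / 2 = (1 - w) / 2); last by field.
rewrite (_ : 1 - - 2^-1 + - w / 2 = (1 - w) / 2 + 1); last by field.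
rewrite !cGammaE// !euler_integralS//.
have e1 := euler_integral_neq0 _ p1; have e2 := euler_integral_neq0 _ p2.
rewrite euler_integral_duplication// cpower_quarter (cpowerNE 2^-1).
rewrite (_ : 2 * (w / 2) = w); last by field.
have c0 := cpower_neq0 2^-1 w.
have w00 : w != 0 by exact: Re_gt0_neq0.
have w10 : 1 - w != 0 by apply: Re_gt0_neq0; rewrite cReB /=; lra.
rewrite (_ : 8 * Num.sqrt pi = 4 * (2 * Num.sqrt pi)); last by ring.
rewrite (rmorphM _ 4) rmorph_nat.
move: e1 e2 c0; move: (euler_integral _) (euler_integral _) (cpower 2^-1 w) => e f c e1 e2 c0.
by field; rewrite e1 e2 c0 w00 w10.
Qed.

(** [Gamma(w/2) / Gamma(w/2 + 1)] gives [2 / w]. Duplication at [(w - 1) / 2] gives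
    [Gamma(w - 1) = Gamma(w) / (w - 1)] and one more factor [2], hence again [8 sqrt(pi)]. *)
Lemma meijer_integrand_ramp w : 1 < complex.Re w ->
  meijer_integrand 3 0 [:: 1] [:: - 2^-1; 0; 0] (x ^+ 2 / 4) (- w / 2) =
  (8 * Num.sqrt pi)%:C * (euler_integral w * cpower x (- w) / (w * (w - 1))).
Proof.
move=> w1.
have w10 : 0 < complex.Re (w - 1) by rewrite cReB /=; lra.
have p1 : 0 < complex.Re (w / 2) by rewrite Re_half; lra.
have p2 : 0 < complex.Re ((w - 1) / 2) by rewrite Re_half; lra.
have p3 : 0 < complex.Re (w / 2 + 1) by rewrite cReD /=; lra.
rewrite meijer_integrand30.
rewrite (_ : 0 - - w / 2 = w / 2); last by ring.
rewrite (_ : - 2^-1 - - w / 2 = (w - 1) / 2); last by field.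
rewrite (_ : 1 - - w / 2 = w / 2 + 1); last by ring.
rewrite !cGammaE// !euler_integralS//.
have e1 := euler_integral_neq0 _ p1.
have e2 := euler_integral_duplication _ p2.
rewrite (_ : (w - 1) / 2 + 2^-1 = w / 2) in e2; last by field.
rewrite (_ : 2 * ((w - 1) / 2) = w - 1) in e2; last by field.
rewrite mulrA e2 cpower_quarter (cpowerNE 2^-1).
have -> : euler_integral w = (w - 1) * euler_integral (w - 1) by rewrite -[in LHS](subrK 1 w) euler_integralS.
have -> : cpower 2^-1 w = cpower 2^-1 (w - 1) / 2 by rewrite -[in LHS](subrK 1 w) (cpowerD _ (w - 1) 1) cpower_half1.
have c0 := cpower_neq0 2^-1 (w - 1).
have w00 : w != 0 by apply: Re_gt0_neq0; lra.
have w10' := Re_gt0_neq0 _ w10.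
rewrite (_ : 8 * Num.sqrt pi = 4 * (2 * Num.sqrt pi)); last by ring.
rewrite (rmorphM _ 4) rmorph_nat.
move: e1 c0; move: (euler_integral (w / 2)) (euler_integral _) (cpower 2^-1 _) => e f c e1 c0.
by field; rewrite e1 c0 w00 w10'.
Qed.

(** [C = 1/2] is the line [Re s = - 1/4], halfway between the rightmost left-hand pole [-1/2] and
    the leftmost right-hand pole [0]. *)
Lemma meijerG_tent : is_meijerG 3 1 [:: 2^-1; 1] [:: 0; 0; 2^-1; - 2^-1]
  (x ^+ 2 / 4) (4 * Num.sqrt pi * mellin_tent x)%:C.
Proof.
apply: (meijerG_mellin _ _ _ _ _ _ 2^-1 _ _ _ _ _ (@fourier_pair_tent R)) => //.
- split=> [beta k|alpha k]; rewrite !inE.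
    move=> /or3P[]/eqP->; apply: right_of_line; rewrite ?half_complexE cReD cRe_nat /=;
      have : 0 <= k%:R :> R by []; lra.
  move=> /eqP ->; apply: left_of_line; rewrite half_complexE !cReB cRe_nat /=.
  by have : 0 <= k%:R :> R by []; lra.
- move=> t; rewrite -mellin_euler//.
  have -> : vertical_line (- 2^-1 / 2) t = - (2^-1 -i* t) / 2.
    by rewrite half_complexE; apply: complex_eq; rewrite ?cReM ?cImM /=; field.
  rewrite meijer_integrand_tent; last by rewrite /=; lra.
  congr (_ * (_ * _)).
  have p0 : 2^-1 ^+ 2 + t ^+ 2 != 0 by apply: lt0r_neq0; have := sqr_ge0 t; nra.
  rewrite (_ : (2^-1 -i* t) * (1 - (2^-1 -i* t)) = (2^-1 ^+ 2 + t ^+ 2)%:C); last first.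
    by apply: complex_eq; rewrite ?cReM ?cImM !cReB !cImB /=; field.
  by rewrite -fmorphV.
Qed.

(** [C = 3/2] is the line [Re s = - 3/4], to the left of the leftmost pole [-1/2]; with [n = 0]
    there are only right-hand poles. *)
Lemma meijerG_ramp : is_meijerG 3 0 [:: 1] [:: - 2^-1; 0; 0]
  (x ^+ 2 / 4) (4 * Num.sqrt pi * mellin_ramp x)%:C.
Proof.
apply: (meijerG_mellin _ _ _ _ _ _ (3 / 2) _ _ _ _ _ (@fourier_pair_ramp R)) => //.
- split=> [beta k|//]; rewrite !inE.
  move=> /or3P[]/eqP->; apply: right_of_line; rewrite ?half_complexE cReD cRe_nat /=;
    have : 0 <= k%:R :> R by []; lra.
- move=> t; rewrite -mellin_euler//.
  have -> : vertical_line (- (3 / 2) / 2) t = - (3 / 2 -i* t) / 2.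
    by rewrite half_complexE; apply: complex_eq; rewrite ?cReM ?cImM /=; field.
  rewrite meijer_integrand_ramp; last by rewrite /=; lra.
  congr (_ * (_ * _)).
  have p0 : 2^-1 ^+ 2 + t ^+ 2 != 0 by apply: lt0r_neq0; have := sqr_ge0 t; nra.
  have p1 : (3 / 2) ^+ 2 + t ^+ 2 != 0 by apply: lt0r_neq0; have := sqr_ge0 t; nra.
  have nz : (3 / 2 -i* t) * (3 / 2 -i* t - 1) != 0.
    by rewrite mulf_neq0//; apply: Re_gt0_neq0; rewrite ?cReB /=; lra.
  apply: (mulfI nz); rewrite mulfV//.
  by apply: complex_eq => /=; field; repeat (apply/andP; split); apply: lt0r_neq0; have := sqr_ge0 t; nra.
Qed.

End meijer_integrands.

(** * The Whittaker function *)

Section tricomi_unique.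
Context {R : realType}.
Implicit Types (a b x y : R) (f g : R -> R).

Lemma MVT_gt0 (F F' : R -> R) x y : 0 < x -> x < y ->
  (forall u : R, 0 < u -> is_derive u 1 F (F' u)) ->
  exists2 c, x < c < y & F y - F x = F' c * (y - x).
Proof.
move=> x0 xy dF.
have [||c cxy E] := @MVT R F F' x y xy.
- by move=> u; rewrite in_itv/= => /andP[xu _]; apply: dF; exact: lt_trans xu.
- apply: derivable_within_continuous => u; rewrite in_itv/= => /andP[xu _].
  by have [] := dF u (lt_le_trans x0 xu).
- by exists c => //; move: cxy; rewrite in_itv.
Qed.

Lemma is_derive0_cst_gt0 (F : R -> R) x y :
  (forall u : R, 0 < u -> is_derive u 1 F 0) -> 0 < x -> 0 < y -> F x = F y.
Proof.
move=> dF; wlog xy : x y / x < y => [h|] x0 y0.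
  have [/h->//|/h<-//|->//] := ltgtP x y.
have [c _] := MVT_gt0 F (fun=> 0) x y x0 xy dF.
by rewrite mul0r => /eqP; rewrite subr_eq0 => /eqP.
Qed.

(** [ln z <= z - 1] at [z = y / (2 n)] bounds [n ln y] by [y / 2] plus a constant, so half of [y]
    survives in the exponent. *)
Lemma expRDln_cvgy (m : R) : expR (y + m * ln y) @[y --> +oo] --> +oo.
Proof.
pose n := `|m| + 1.
have n0 : 0 < n by rewrite ltr_wpDl.
have nm : `|m| <= n by rewrite lerDl.
apply/cvgryPge => A; near=> y.
have y1 : 1 <= y by near: y; apply: nbhs_pinfty_ge; exact: num_real.
have y0 : 0 < y by exact: lt_le_trans y1.
have yA : 2 * (A + n * ln (2 * n)) <= y.
  by near: y; apply: nbhs_pinfty_ge; exact: num_real.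
have l0 : 0 <= ln y by exact: ln_ge0.
have h1 : - (n * ln y) <= m * ln y.
  rewrite -mulNr ler_wpM2r//; move: nm; rewrite ler_norml => /andP[+ _].
  by move=> ?; lra.
have h2 : n * ln y <= y / 2 - n + n * ln (2 * n).
  have d0 : 0 < y / (2 * n) by rewrite divr_gt0 ?mulr_gt0.
  have : ln (1 + (y / (2 * n) - 1)) <= y / (2 * n) - 1 by apply: le_ln1Dx; lra.
  rewrite addrC subrK ln_div ?posrE ?mulr_gt0// -(ler_pM2l n0) !mulrBr mulr1.
  have -> : n * (y / (2 * n)) = y / 2 by field; exact: lt0r_neq0.
  by move=> ?; lra.
apply: le_trans (expR_ge1Dx _).
by lra.
Unshelve. all: by end_near. Qed.

Lemma kummer_solutionP a b f : kummer_solution a b f <->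
  exists f1 f2 : R -> R, forall x, 0 < x ->
    [/\ is_derive x 1 f (f1 x), is_derive x 1 f1 (f2 x) &
        x * f2 x + (b - x) * f1 x - a * f x = 0].
Proof.
split=> [k|[f1 [f2 k]] x x0].
  exists (derive1 f), (derive1n 2 f) => x x0; have [d1 d2 E] := k x x0.
  split; [|apply: (DeriveDef d2)|exact: E].
    by apply: (DeriveDef d1); rewrite derive1E.
  by rewrite -[RHS]/(derive1 (derive1 f) x) [RHS]derive1E.
have [d1 d2 E] := k x x0.
have near_f1 : \forall y \near x, f1 y = derive1 f y.
  near=> y; have y0 : 0 < y by near: y; exact: lt_nbhsr.
  by have [[_ <-] _ _] := k y y0; rewrite derive1E.
have d2' : is_derive x 1 (derive1 f) (f2 x) by exact: near_eq_is_derive d2.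
have -> : derive1n 2 f x = f2 x by rewrite -[LHS]/(derive1 (derive1 f) x) derive1E; case: d2'.
have -> : derive1 f x = f1 x by rewrite derive1E; case: d1.
by split.
Unshelve. all: by end_near. Qed.

Lemma is_tricomi_unique a b f g : is_tricomi a b f -> is_tricomi a b g ->
  (forall x, 0 < x -> 0 < g x) -> forall x, 0 < x -> f x = g x.
Proof.
move=> [/kummer_solutionP[f1 [f2 kf]] fa] [/kummer_solutionP[g1 [g2 kg]] ga] g0.
(* The integrating factor [y^b e^(-y)] of Abel's identity: Kummer's equation gives
   [w' = (1 - b / y) w]. *)
pose P y := expR (b * ln y - y).
pose w y := f y * g1 y - f1 y * g y.
have dw (y : R) : 0 < y -> is_derive y 1 (fun y => w y * P y) 0.
  move=> y0; have [df1 df2 Ef] := kf y y0; have [dg1 dg2 Eg] := kg y y0.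
  have yn := lt0r_neq0 y0.
  rewrite /w /P; derive_auto.
  rewrite -/(P y); move: (P y) => p.
  have -> : f2 y = ((y - b) * f1 y + a * f y) / y.
    by apply: (mulfI yn); rewrite mulrCA mulfV// mulr1; lra.
  have -> : g2 y = ((y - b) * g1 y + a * g y) / y.
    by apply: (mulfI yn); rewrite mulrCA mulfV// mulr1; lra.
  by field.
pose C := w 1 * P 1.
have wE y : 0 < y -> w y = C * expR (y - b * ln y).
  move=> y0; rewrite /C -(is_derive0_cst_gt0 _ _ _ dw y0 ltr01) /P -mulrA -expRD.
  by rewrite (_ : b * ln y - y + (y - b * ln y) = 0) ?expR0 ?mulr1//; ring.
pose q y := f y / g y.
have dq (y : R) : 0 < y -> is_derive y 1 q (- (C * expR (y - b * ln y)) / g y ^+ 2).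
  move=> y0; have [df1 _ _] := kf y y0; have [dg1 _ _] := kg y y0.
  have gn := lt0r_neq0 (g0 y y0).
  rewrite /q; derive_auto; rewrite -wE// /w.
  by field.
have q1 : q y @[y --> +oo] --> (1 : R).
  have : f y * y `^ a / (g y * y `^ a) @[y --> +oo] --> (1 : R).
    rewrite -[X in _ --> X](divr1 1); apply: cvgM; first exact: fa.
    by apply: cvgV; [exact: oner_neq0|exact: ga].
  apply: cvg_trans; apply: near_eq_cvg; near=> y.
  have y0 : 0 < y by near: y; apply: nbhs_pinfty_gt; exact: num_real.
  have gn := lt0r_neq0 (g0 y y0).
  have yn : y `^ a != 0 by rewrite lt0r_neq0// powR_gt0.
  by rewrite /q; field; rewrite gn yn.
have C0 : C = 0.
  apply/eqP; apply: contraT => Cn.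
  have Cp : 0 < `|C| by rewrite normr_gt0.
  (* The constants match: for large [c], [|q'(c)|] is at least [|C| (4 / |C|) / 2^2 = 1], whereas
     [near1] at [y] and [y + 1] keeps the increment of [q], equal to [q'(c)] by the mean value
     theorem, below [1]. *)
  have near1 : \forall y \near +oo, `|1 - q y| < 2^-1.
    by move/cvgrPdist_lt : q1; apply.
  have near2 : \forall y \near +oo, g y * y `^ a < 2.
    by apply: (cvgr_lt _ ga); lra.
  have near3 : \forall y \near +oo, 4 / `|C| <= expR (y + (2 * a - b) * ln y).
    by move/cvgryPge : (expRDln_cvgy (2 * a - b)); exact.
  have [M [_ HM]] := filterI near1 (filterI near2 near3).
  pose y := Num.max M 0 + 1.
  have y0 : 0 < y by rewrite ltr_wpDl// le_max lexx orbT.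
  have My : M < y by rewrite ltr_pwDr// le_max lexx.
  have yy1 : y < y + 1 by rewrite ltrDl.
  have [c /andP[yc cy] E] := MVT_gt0 q _ y (y + 1) y0 yy1 dq.
  have c0 : 0 < c by exact: lt_trans yc.
  have [q_y _] := HM y My.
  have [q_y1 _] := HM (y + 1) (lt_trans My yy1).
  have [_ [gc ec]] := HM c (lt_trans My yc).
  have : `|q (y + 1) - q y| < 1.
    rewrite (_ : q (y + 1) - q y = (1 - q y) - (1 - q (y + 1))); last by ring.
    by rewrite (le_lt_trans (ler_normB _ _))//; lra.
  rewrite E addrAC subrr add0r mulr1 ltNge => /negP; case.
  rewrite normrM normrN normrM (ger0_norm (expR_ge0 _)) normfV normrX (gtr0_norm (g0 c c0)).
  have gp := g0 c c0.
  rewrite ler_pdivlMr ?exprn_gt0// mul1r.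
  have pE : c `^ a = expR (a * ln c) by rewrite /powR gt_eqF.
  have h4 : 4 <= `|C| * expR (c + (2 * a - b) * ln c).
    by move: ec; rewrite ler_pdivrMr// mulrC.
  have h5 : expR (c + (2 * a - b) * ln c) = expR (c - b * ln c) * (c `^ a) ^+ 2.
    by rewrite pE -expRM_natl -expRD; congr expR; ring.
  have p0 : 0 < c `^ a by rewrite powR_gt0.
  have h6 : (g c * c `^ a) ^+ 2 <= 4.
    rewrite (_ : 4 = 2 ^+ 2 :> R); last by ring.
    by rewrite lerXn2r ?nnegrE ?mulr_ge0 ?(ltW gp) ?(ltW p0) ?(ltW gc).
  have p20 : 0 < (c `^ a) ^+ 2 by rewrite exprn_gt0.
  rewrite -(ler_pM2r p20) -exprMn (le_trans h6)// (le_trans h4)// h5.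
  by rewrite mulrA.
have qcst x y : 0 < x -> 0 < y -> q x = q y.
  apply: is_derive0_cst_gt0 => u u0; apply: (is_derive_eq (dq u u0)).
  by rewrite C0 mul0r oppr0 mul0r.
move=> x x0; have : q x = 1.
  have l : q y @[y --> +oo] --> q x.
    have c : (fun _ : R => q x) y @[y --> +oo] --> q x by exact: cvg_cst.
    apply: cvg_trans c; apply: near_eq_cvg; near=> y.
    by apply: qcst => //; near: y; apply: nbhs_pinfty_gt; exact: num_real.
  by rewrite -(cvg_lim _ q1)// (cvg_lim _ l).
by rewrite /q => /(congr1 ( *%R^~ (g x))); rewrite divfK ?mul1r// lt0r_neq0// g0.
Unshelve. all: by end_near. Qed.

(** The function picked by [xget] satisfies [is_tricomi] because [g] does; uniqueness then
    identifies the two on the half-line. *)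
Lemma tricomiUE a b g x : is_tricomi a b g -> (forall x, 0 < x -> 0 < g x) ->
  0 < x -> tricomiU a b x = g x.
Proof.
move=> tg g0 x0; apply: (is_tricomi_unique a b) => //.
by apply: (@xgetPex _ _ [set f | is_tricomi a b f]); exists g.
Qed.

End tricomi_unique.

Lemma is_derive_under_integral {R : realType} (D : set R) (f df : R -> R -> R)
    (G : R -> R) (a u v : R) : measurable D -> u < a < v ->
  (forall x, u < x < v -> integ D (f x)) ->
  (forall x y : R, u < x < v -> D y -> is_derive x 1 (f^~ y) (df x y)) ->
  integ D G -> (forall x y, u < x < v -> D y -> `|df x y| <= G y) ->
  is_derive a 1 (fun x => \int[mu]_(y in D) f x y) (\int[mu]_(y in D) df a y).
Proof.
move=> mD uav fi fd Gi dfG.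
have dfE x y : u < x < v -> D y -> partial1of2 f x y = df x y.
  by move=> uxv Dy; rewrite partial1of2E; have [_] := fd x y uxv Dy.
have Ia : `]u, v[%classic a by rewrite /= in_itv.
have nGi : integ D (fun y => `|G y|) by exact: integrable_norm.
have I x : `]u, v[%classic x -> u < x < v by rewrite /= in_itv.
have fi' x : `]u, v[%classic x -> integ D (f x) by move=> /I; exact: fi.
have fd' x y : `]u, v[%classic x -> D y -> derivable (f^~ y) x 1.
  by move=> /I Ix Dy; have [] := fd x y Ix Dy.
have G0 y : 0 <= `|G y| by [].
have dG' x y : `]u, v[%classic x -> D y -> `|partial1of2 f x y| <= `|G y|.
  by move=> /I Ix Dy; rewrite dfE// (le_trans (dfG x y Ix Dy))// ler_norm.
apply: DeriveDef; first exact: (@derivable_under_integral R _ _ lebesgue_measure f D mD a u v Ia fi' fd' _ G0 nGi dG').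
rewrite -derive1E (@differentiation_under_integral R _ _ lebesgue_measure f D mD a u v Ia fi' fd' _ G0 nGi dG').
by apply: eq_Rint => y Dy; exact: dfE.
Qed.

(** * Integral representation of [U(-k, 0, x)] *)

Section tricomi_integral.
Context {R : realType} (k : R) (k1 : k < 1).
Implicit Types (p x u : R).

Let weight := gammad (1 - k).

Let w0 : 0 < 1 - k. Proof. by rewrite subr_gt0. Qed.

Let wi : integ `]0, +oo[ weight. Proof. exact: integrable_gammad. Qed.

(** The integral of [e^(-u) u^(-k) (x + u)^p]. The case [p = k] is [Gamma(1 - k) U(-k, 0, x)]; each
    differentiation in [x] lowers [p] by one, hence the separate exponent. *)
Definition tricomi_moment p x : R :=
  \int[mu]_(u in `]0, +oo[) (weight u * expR (p * ln (x + u))).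

Let mint p x : measurable_fun `](0:R), +oo[ (fun u => weight u * expR (p * ln (x + u))).
Proof. by apply: measurable_funM; [exact: measurable_gammad|meas_auto]. Qed.

Let expR_anti p x y : p <= 0 -> 0 < x -> x <= y -> expR (p * ln y) <= expR (p * ln x).
Proof.
move=> p0 x0 xy; rewrite ler_expR ler_wnM2l// ler_ln// posrE//.
exact: lt_le_trans xy.
Qed.

Let expRlnS p x : 0 < x -> expR (p * ln x) = x * expR ((p - 1) * ln x).
Proof. by move=> x0; rewrite mulrBl mul1r expRB lnK ?posrE// mulrCA mulfV ?mulr1// gt_eqF. Qed.

(** For [p <= 1], [(x + u)^p <= (x + u) x^(p-1)], which reduces the claim to the gamma densities at
    [1 - k] and [2 - k]. *)
Lemma integrable_tricomi_moment p x : p <= 1 -> 0 < x ->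
  integ `]0, +oo[ (fun u => weight u * expR (p * ln (x + u))).
Proof.
move=> p1 x0.
have mo : measurable `](0:R), +oo[ by [].
have wi' : integ `]0, +oo[ (gammad (1 - k + 1)) by apply: integrable_gammad; rewrite addr_gt0.
have gi := integZ _ _ (expR ((p - 1) * ln x)) mo
  (integD _ _ _ mo (integZ _ _ x mo wi) wi').
apply: (integrable_dominated _ _ _ _ _ gi) => //.
move=> u; rewrite /= in_itv/= andbT => u0.
have xu : 0 < x + u by rewrite addr_gt0.
rewrite ger0_norm ?mulr_ge0 ?gammad_ge0 ?expR_ge0//.
rewrite (gammadS _ u u0) -mulrDl expRlnS// mulrCA [leRHS]mulrCA.
rewrite ler_wpM2l// ?(ltW xu)// [leRHS]mulrC ler_wpM2l ?gammad_ge0//.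
by apply: expR_anti; rewrite ?subr_le0// lerDl ltW.
Qed.

Lemma is_derive_tricomi_moment p x : p <= 1 -> 0 < x ->
  is_derive x 1 (tricomi_moment p) (p * tricomi_moment (p - 1) x).
Proof.
move=> p1 x0.
have mo : measurable `](0:R), +oo[ by [].
rewrite -RintegralZl//; last by apply: integrable_tricomi_moment => //; lra.
(* Differentiation takes place on []x/2, x + 1[], where [(y + u)^(p-1) <= (x/2)^(p-1)] uniformly in
   [y] and [u]. *)
apply: (is_derive_under_integral _ (fun x u => weight u * expR (p * ln (x + u)))
    (fun x u => p * (weight u * expR ((p - 1) * ln (x + u))))
    (fun u => `|p| * expR ((p - 1) * ln (x / 2)) * weight u) x (x / 2) (x + 1)).
- exact: mo.
- by rewrite ltrDl ltr01 ltr_pdivrMr// ltr_pMr// ltr1n.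
- move=> y /andP[xy _]; apply: integrable_tricomi_moment => //.
  by apply: lt_trans xy; rewrite divr_gt0.
- move=> y u /andP[xy _]; rewrite /= in_itv/= andbT => u0.
  have yu : 0 < y + u by rewrite addr_gt0// (lt_trans _ xy)// divr_gt0.
  derive_auto; rewrite (expRlnS p)//; field; exact: lt0r_neq0.
- exact: integZ.
- move=> y u /andP[xy _]; rewrite /= in_itv/= andbT => u0.
  have x20 : 0 < x / 2 by rewrite divr_gt0.
  have wu : 0 <= weight u by exact: gammad_ge0.
  rewrite normrM (ger0_norm (mulr_ge0 wu (expR_ge0 _))) -mulrA.
  rewrite ler_wpM2l// mulrC ler_wpM2r ?gammad_ge0//.
  by apply: expR_anti; rewrite ?subr_le0// (le_trans (ltW xy))// lerDl ltW.
Qed.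

(* The integrand of the left-hand side is the derivative of
   [u |-> - e^(-u) u^(1-k) (x + u)^(k-1)]. *)
Lemma tricomi_moment_ode x : 0 < x ->
  x * ((k - 1) * tricomi_moment (k - 1 - 1) x) - x * tricomi_moment (k - 1) x
    + tricomi_moment k x = 0.
Proof.
move=> x0.
have mo : measurable `](0:R), +oo[ by [].
have i0 := integrable_tricomi_moment k x (ltW k1) x0.
have k11 : k - 1 <= 1 by rewrite lerBlDr (le_trans (ltW k1))// lerDr.
have i1 : integ `]0, +oo[ (fun u => weight u * expR ((k - 1) * ln (x + u))).
  exact: integrable_tricomi_moment.
have i2 : integ `]0, +oo[ (fun u => weight u * expR ((k - 1 - 1) * ln (x + u))).
  by apply: integrable_tricomi_moment => //; rewrite lerBlDr (le_trans k11)// lerDr.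
have i3 := integB _ _ _ mo (integZ _ _ (x * (k - 1)) mo i2) (integZ _ _ x mo i1).
rewrite mulrA /tricomi_moment -!RintegralZl// -RintegralB//; [|exact: integZ|exact: integZ].
rewrite -RintegralD//.
have xu u : 0 < u -> 0 < x + u by move=> u0; rewrite addr_gt0.
pose F u := - (gammad (1 - k + 1) u * expR ((k - 1) * ln (x + u))).
have dF (u : R) : 0 < u -> is_derive u 1 F
    (x * (k - 1) * (weight u * expR ((k - 1 - 1) * ln (x + u)))
     - x * (weight u * expR ((k - 1) * ln (x + u))) + weight u * expR (k * ln (x + u))).
  move=> u0; have un := lt0r_neq0 u0; have xu0 := xu u u0; have xun := lt0r_neq0 xu0.
  have dg : is_derive u 1 (gammad (1 - k + 1)) ((1 - k - u) * weight u).
    rewrite (_ : gammad (1 - k + 1) = fun u => expR (- u) * expR ((1 - k) * ln u)); last first.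
      by apply/funext => v; rewrite /gammad addrK.
    derive_auto; rewrite /weight /gammad (expRlnS (1 - k))//.
    by field.
  rewrite /F; derive_auto.
  rewrite (gammadS _ u u0) -/weight (expRlnS k)// (expRlnS (k - 1))//.
  by field.
have cF u : 0 < u -> {for u, continuous (fun u => x * (k - 1) * (weight u * expR ((k - 1 - 1) * ln (x + u)))
     - x * (weight u * expR ((k - 1) * ln (x + u))) + weight u * expR (k * ln (x + u)))}.
  by move=> u0; have := xu u u0 => ?; rewrite /weight /gammad; cont_auto.
have n1 (u : R) : `|1 : R| <= 1 by rewrite normr1.
have [g0 gy] := gammadM_cvg0 (1 - k) (fun=> 1) w0 n1.
pose M := expR ((k - 1) * ln x).
have FM u : 0 < u -> `|F u| <= gammad (1 - k + 1) u * 1 * M.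
  move=> u0; rewrite normrN ger0_norm ?mulr_ge0 ?gammad_ge0 ?expR_ge0// mulr1.
  rewrite ler_wpM2l ?gammad_ge0//; apply: expR_anti => //; last by rewrite lerDl ltW.
  by rewrite subr_le0 ltW.
have F0 : F u @[u --> 0^'+] --> (0 : R).
  have l : gammad (1 - k + 1) u * 1 * M @[u --> 0^'+] --> (0 : R).
    by rewrite -[X in _ --> X](mul0r M); apply: cvgM; [exact: g0|exact: cvg_cst].
  apply: norm_cvg0; apply: squeeze_cvgr (cvg_cst _) l.
  by near=> u; rewrite normr_ge0 /=; apply: FM.
have Fy : F u @[u --> +oo] --> (0 : R).
  have l : gammad (1 - k + 1) u * 1 * M @[u --> +oo] --> (0 : R).
    by rewrite -[X in _ --> X](mul0r M); apply: cvgM; [exact: gy|exact: cvg_cst].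
  apply: norm_cvg0; apply: squeeze_cvgr (cvg_cst _) l.
  near=> u; rewrite normr_ge0 /=; apply: FM.
  by near: u; apply: nbhs_pinfty_gt; exact: num_real.
by rewrite (FTC2_oy 0 _ F 0 0 (integD _ _ _ mo i3 i0) dF cF F0 Fy) subrr.
Unshelve. all: by end_near. Qed.

Context (kN1 : -1 <= k).

(** This is [Gamma(1 - k)], the limit of [x^(-k) tricomi_moment k x] at infinity. *)
Definition tricomi_norm : R := \int[mu]_(u in `]0, +oo[) weight u.

(** From above, [y^k <= y] as [k < 1]; from below, [y^k >= 1 - ln y >= 2 - y] as [-1 <= k]. *)
Let expR_ln_near1 y : 1 <= y -> `|expR (k * ln y) - 1| <= y - 1.
Proof.
move=> y1; have y0 : 0 < y by exact: lt_le_trans y1.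
have l0 : 0 <= ln y by exact: ln_ge0.
have up : expR (k * ln y) <= y.
  by rewrite -[leRHS]lnK// ler_expR -[leRHS]mul1r ler_wpM2r// ltW.
have low : 1 - (y - 1) <= expR (k * ln y).
  have h : ln (1 + (y - 1)) <= y - 1 by apply: le_ln1Dx; lra.
  rewrite addrC subrK in h.
  have h2 : - ln y <= k * ln y by rewrite -mulN1r ler_wpM2r.
  by have := expR_ge1Dx (k * ln y); lra.
by rewrite ler_norml; lra.
Qed.

(** [|(1 + u/x)^k - 1| <= u/x] bounds the error by [K / x] with [K = Gamma(2 - k)]. *)
Lemma tricomi_moment_cvg :
  expR (- (k * ln x)) * tricomi_moment k x @[x --> +oo] --> tricomi_norm.
Proof.
have mo : measurable `](0:R), +oo[ by [].
have wi' : integ `]0, +oo[ (gammad (1 - k + 1)) by apply: integrable_gammad; rewrite addr_gt0.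
pose K := \int[mu]_(u in `]0, +oo[) gammad (1 - k + 1) u.
apply/cvgrPdist_le => e e0; near=> x.
have x0 : 0 < x by near: x; apply: nbhs_pinfty_gt; exact: num_real.
have Kx : K / e <= x by near: x; apply: nbhs_pinfty_ge; exact: num_real.
have i0 := integZ _ _ (expR (- (k * ln x))) mo (integrable_tricomi_moment k x (ltW k1) x0).
rewrite /tricomi_norm /tricomi_moment -RintegralZl//; last exact: integrable_tricomi_moment (ltW k1) x0.
rewrite -RintegralB//.
apply: (@le_trans _ _ (\int[mu]_(u in `]0, +oo[) `|weight u - expR (- (k * ln x)) * (weight u * expR (k * ln (x + u)))|)).
  by apply: le_normr_Rintegral => //; exact: integB.
apply: (@le_trans _ _ (\int[mu]_(u in `]0, +oo[) (x^-1 * gammad (1 - k + 1) u))); last first.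
  by rewrite RintegralZl// -/K mulrC ler_pdivrMr// mulrC -ler_pdivrMr.
apply: le_Rintegral => //.
- by apply: integrable_norm => //; exact: integB.
- exact: integZ.
move=> u; rewrite /= in_itv/= andbT => u0.
have ux : 1 <= 1 + u / x by rewrite lerDl divr_ge0 ?ltW.
have -> : weight u - expR (- (k * ln x)) * (weight u * expR (k * ln (x + u))) =
    - (weight u * (expR (k * ln (1 + u / x)) - 1)).
  rewrite (_ : x + u = x * (1 + u / x)); last by field; exact: lt0r_neq0.
  rewrite lnM ?posrE//; last exact: lt_le_trans ux.
  rewrite mulrDr expRD expRN; field; exact: lt0r_neq0 (expR_gt0 _).
rewrite normrN normrM (ger0_norm (gammad_ge0 _ _)) (gammadS _ u u0) -/weight.
rewrite mulrA mulrC ler_wpM2r ?gammad_ge0// (le_trans (expR_ln_near1 _ ux))//.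
by rewrite addrAC subrr add0r mulrC.
Unshelve. all: by end_near. Qed.

Lemma tricomi_norm_gt0 : 0 < tricomi_norm.
Proof.
have := euler_real_gt0 _ w0; rewrite euler_integralE /=.
by under eq_Rintegral do rewrite mul0r cos0 mulr1.
Qed.

Lemma tricomi_moment_gt0 x : 0 < x -> 0 < tricomi_moment k x.
Proof.
move=> x0; apply: (Rintegral_0oo_gt0 _ (expR (- 2) * expR (- `|1 - k - 1|) * expR (- ln (x + 2)))).
- by rewrite !mulr_gt0 ?expR_gt0.
- exact: integrable_tricomi_moment (ltW k1) x0.
- by move=> u _; rewrite mulr_ge0 ?gammad_ge0 ?expR_ge0.
move=> u /andP[u1 u2]; apply: ler_pM; rewrite ?mulr_ge0 ?expR_ge0//.
  by apply: gammad_ge; rewrite u1.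
have xu : 1 <= x + u by rewrite (le_trans u1)// lerDr ltW.
have l0 : 0 <= ln (x + u) by exact: ln_ge0.
have l1 : ln (x + u) <= ln (x + 2).
  by rewrite ler_ln ?posrE ?lerD2l//; [exact: lt_le_trans xu|rewrite addr_gt0].
rewrite ler_expR; have : - ln (x + u) <= k * ln (x + u) by rewrite -mulN1r ler_wpM2r.
by lra.
Qed.

(** For [a = - k] and [b = 0], Kummer's equation is [k / Gamma(1 - k)] times
    [tricomi_moment_ode]. *)
Lemma is_tricomi_moment :
  is_tricomi (- k) 0 (fun x => tricomi_norm^-1 * tricomi_moment k x).
Proof.
have W0 := lt0r_neq0 tricomi_norm_gt0.
have k11 : k - 1 <= 1 by rewrite lerBlDr (le_trans (ltW k1))// lerDr.
split.
  apply/kummer_solutionP.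
  exists (fun x => tricomi_norm^-1 * (k * tricomi_moment (k - 1) x)).
  exists (fun x => tricomi_norm^-1 * (k * ((k - 1) * tricomi_moment (k - 1 - 1) x))).
  move=> x x0; have d0 := is_derive_tricomi_moment k x (ltW k1) x0.
  have d1 := is_derive_tricomi_moment (k - 1) x k11 x0.
  split; [by derive_auto; rewrite mul0r add0r|by derive_auto; rewrite !mul0r !add0r|].
  move: (tricomi_norm^-1) (tricomi_moment k x) (tricomi_moment (k - 1) x)
    (tricomi_moment (k - 1 - 1) x) (tricomi_moment_ode x x0) => W t0 t1 t2 e.
  transitivity (W * k * (x * ((k - 1) * t2) - x * t1 + t0)); first by ring.
  by rewrite e mulr0.
have l : tricomi_norm^-1 * (expR (- (k * ln x)) * tricomi_moment k x) @[x --> +oo] --> (1 : R).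
  by rewrite -(mulVf W0); apply: cvgM; [exact: cvg_cst|exact: tricomi_moment_cvg].
apply: cvg_trans l; apply: near_eq_cvg; near=> x.
have x0 : 0 < x by near: x; apply: nbhs_pinfty_gt; exact: num_real.
by rewrite /powR gt_eqF// mulNr mulrA mulrAC.
Unshelve. all: by end_near. Qed.

End tricomi_integral.

(* Kummer's transformation [U(a, b, x) = x^(1-b) U(a - b + 1, 2 - b, x)] at [b = 0]. *)
Lemma is_tricomi_divX {R : realType} (k : R) (f : R -> R) :
  is_tricomi (- k) 0 f -> is_tricomi (1 - k) 2 (fun x => x^-1 * f x).
Proof.
move=> [/kummer_solutionP[f1 [f2 E]] l]; split.
  apply/kummer_solutionP.
  exists (fun x => x^-1 * f1 x - x^-1 ^+ 2 * f x).
  exists (fun x => x^-1 * f2 x - 2 * (x^-1 ^+ 2 * f1 x) + 2 * (x^-1 ^+ 3 * f x)).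
  move=> x x0; have [d0 d1 e] := E x x0; have xn := lt0r_neq0 x0.
  split.
  - by derive_auto; field.
  - by derive_auto; field.
  - have -> : f2 x = (x * f1 x - k * f x) / x by apply: (mulfI xn); rewrite mulrCA mulfV// mulr1; lra.
    by field.
apply: cvg_trans l; apply: near_eq_cvg; near=> x.
have x0 : 0 < x by near: x; apply: nbhs_pinfty_gt; exact: num_real.
rewrite /powR gt_eqF// (_ : (1 - k) * ln x = ln x + - k * ln x); last by ring.
by rewrite expRD lnK ?posrE//; field; rewrite lt0r_neq0.
Unshelve. all: by end_near. Qed.

(** * Differentiation with respect to the first Whittaker index *)

Section kappa_derivative.
Context {R : realType}.
Implicit Types (k s u x : R) (phi : R -> R).

(** [|t| <= 4 e^(|t|/4)] and [|k t| <= |t|/2] add up to the exponent [3/4]. As it is less than [1],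
    the resulting majorants [u^(-3/4) e^(-u)] remain integrable at [0]. *)
Let abs_expR_le k t : - 2^-1 < k < 2^-1 ->
  `|t * expR (k * t)| <= 4 * (expR (3 / 4 * t) + expR (- (3 / 4) * t)).
Proof.
move=> /andP[k1 k2]; rewrite normrM (ger0_norm (expR_ge0 _)).
have h : `|t| * expR (k * t) <= 4 * expR (3 / 4 * `|t|).
  have -> : 3 / 4 * `|t| = 4^-1 * `|t| + 2^-1 * `|t| by field.
  rewrite expRD mulrA; apply: ler_pM; rewrite ?expR_ge0//.
    by have := expR_ge1Dx (4^-1 * `|t|); lra.
  rewrite ler_expR (le_trans (ler_norm _))// normrM ler_wpM2r//.
  by rewrite ler_norml; lra.
apply: (le_trans h); rewrite ler_wpM2l//.
have [t0|t0] := leP 0 t.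
  by rewrite ger0_norm// lerDl expR_ge0.
by rewrite ltr0_norm// mulrN -mulNr lerDr expR_ge0.
Qed.

(** Both the normalising constant, with [phi u = - ln u], and the moment, with
    [phi u = ln (x + u) - ln u], have this form, so one domination argument differentiates the
    two. *)
Lemma is_derive_expR_family phi :
  measurable_fun `](0:R), +oo[ phi ->
  (forall s, `|s| <= 3 / 4 -> integ `]0, +oo[ (fun u => expR (- u) * expR (s * phi u))) ->
  integ `]0, +oo[ (fun u => expR (- u) * phi u) /\
  is_derive (0 : R) 1 (fun k : R => \int[mu]_(u in `]0, +oo[) (expR (- u) * expR (k * phi u)))
    (\int[mu]_(u in `]0, +oo[) (expR (- u) * phi u)).
Proof.
move=> mphi int.
have mo : measurable `](0:R), +oo[ by [].
have i1 : integ `]0, +oo[ (fun u => expR (- u) * expR (3 / 4 * phi u)).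
  by apply: int; rewrite ger0_norm//; lra.
have i2 : integ `]0, +oo[ (fun u => expR (- u) * expR (- (3 / 4) * phi u)).
  by apply: int; rewrite normrN ger0_norm//; lra.
have i4 := integZ _ _ 4 mo (integD _ _ _ mo i1 i2).
have bnd k u : - 2^-1 < k < 2^-1 -> `|expR (- u) * (phi u * expR (k * phi u))| <=
    4 * (expR (- u) * expR (3 / 4 * phi u) + expR (- u) * expR (- (3 / 4) * phi u)).
  move=> kk; rewrite normrM (ger0_norm (expR_ge0 _)) -mulrDr mulrCA ler_wpM2l ?expR_ge0//.
  exact: abs_expR_le.
have z : - 2^-1 < (0 : R) < 2^-1 by lra.
have E u : expR (- u) * phi u = expR (- u) * (phi u * expR (0 * phi u)).
  by rewrite mul0r expR0 mulr1.
split.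
  apply: (integrable_dominated _ _ _ _ _ i4) => //; first by meas_auto.
  by move=> u _; rewrite E; exact: bnd.
apply: (is_derive_eq (is_derive_under_integral _ (fun k u => expR (- u) * expR (k * phi u))
  (fun k u => expR (- u) * (phi u * expR (k * phi u))) _ 0 (- 2^-1) 2^-1 mo z _ _ i4 _)).
- by move=> k /andP[k1 k2]; apply: int; rewrite ler_norml; lra.
- by move=> k u _ _; derive_auto; ring.
- by move=> k u kk _; exact: bnd.
- by apply: eq_Rint => u _; rewrite -E.
Qed.

(** At [k = 0] numerator and denominator equal [1], so the derivative of the quotient is the
    difference of the derivatives, in which the integral of [e^(-u) ln u], minus Euler's constant,
    cancels. *)
Lemma is_derive_tricomi_moment_k x : 0 < x ->
  is_derive (0 : R) 1 (fun k : R => (tricomi_norm k)^-1 * tricomi_moment k k x)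
    (\int[mu]_(u in `]0, +oo[) (expR (- u) * ln (x + u))).
Proof.
move=> x0.
have mo : measurable `](0:R), +oo[ by [].
have NE k : tricomi_norm k = \int[mu]_(u in `]0, +oo[) (expR (- u) * expR (k * - ln u)).
  apply: eq_Rint => u _; rewrite /gammad; congr (_ * expR _); ring.
have psiE k u : gammad (1 - k) u * expR (k * ln (x + u)) =
    expR (- u) * expR (k * (ln (x + u) - ln u)).
  by rewrite /gammad -mulrA -expRD; congr (_ * expR _); ring.
have TE k : tricomi_moment k k x = \int[mu]_(u in `]0, +oo[) (expR (- u) * expR (k * (ln (x + u) - ln u))).
  by apply: eq_Rint => u _; exact: psiE.
have [|s s1|iN dN] := is_derive_expR_family (fun u => - ln u).
- by meas_auto.
- apply: eq_integ (integrable_gammad (1 - s) _) => //.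
    by move=> u _; rewrite /gammad; congr (_ * expR _); ring.
  by move: s1; rewrite ler_norml; lra.
have [|s s1|iT dT] := is_derive_expR_family (fun u => ln (x + u) - ln u).
- by meas_auto.
- have /andP[s2 s3] : - (3 / 4) <= s <= 3 / 4 by rewrite -ler_norml.
  have s4 : s < 1 by lra.
  by apply: eq_integ (integrable_tricomi_moment s s4 s x (ltW s4) x0) => // u _; exact: psiE.
rewrite (_ : (fun k => _) = fun k => (\int[mu]_(u in `]0, +oo[) (expR (- u) * expR (k * - ln u)))^-1
    * \int[mu]_(u in `]0, +oo[) (expR (- u) * expR (k * (ln (x + u) - ln u)))); last first.
  by apply/funext => k; rewrite NE TE.
pose N k := \int[mu]_(u in `]0, +oo[) (expR (- u) * expR (k * - ln u)).
pose T k := \int[mu]_(u in `]0, +oo[) (expR (- u) * expR (k * (ln (x + u) - ln u))).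
have N0 : N 0 = 1.
  by rewrite -[RHS](@Rintegral_expRN R); apply: eq_Rint => u _; rewrite mul0r expR0 mulr1.
have T0 : T 0 = 1.
  by rewrite -[RHS](@Rintegral_expRN R); apply: eq_Rint => u _; rewrite mul0r expR0 mulr1.
have Nn : N 0 != 0 by rewrite N0 oner_neq0.
apply: (is_derive_eq (derM _ _ _ _ _ (derV _ _ _ Nn dN) dT)).
rewrite -/(N 0) -/(T 0) N0 T0 invr1 mul1r mulr1.
rewrite expr1n divr1 addrC -RintegralB//.
by apply: eq_Rint => u _; ring.
Qed.

(** For [m = 1/2] the prefactor [x] cancels the [1/x] in [U(1 - k, 2, x) = U(-k, 0, x) / x]; for
    [m = -1/2] the power of [x] is trivial and [U(-k, 0, x)] appears directly. *)
Lemma whittakerWE x k (m : R) : 0 < x -> - 2^-1 < k < 2^-1 -> m = 2^-1 \/ m = - 2^-1 ->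
  whittakerW k m x = expR (- x / 2) * ((tricomi_norm k)^-1 * tricomi_moment k k x).
Proof.
move=> x0 /andP[k1 k2] m12.
have kl : k < 1 by lra.
have kN : -1 <= k by lra.
have tg := is_tricomi_moment k kl kN.
have tg0 (y : R) : 0 < y -> 0 < (tricomi_norm k)^-1 * tricomi_moment k k y.
  move=> y0; rewrite mulr_gt0 ?invr_gt0//; first exact: tricomi_norm_gt0.
  exact: tricomi_moment_gt0.
have tg2 (y : R) : 0 < y -> 0 < y^-1 * ((tricomi_norm k)^-1 * tricomi_moment k k y).
  by move=> y0; rewrite mulr_gt0 ?invr_gt0//; exact: tg0.
have h : 2^-1 + 2^-1 = 1 :> R by field.
case: m12 => ->; rewrite /whittakerW.
  rewrite h mulfV ?pnatr_eq0// powRr1 ?(ltW x0)//.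
  rewrite -[1 + 1]/(2%:R) (tricomiUE _ _ _ _ (is_tricomi_divX _ _ tg) tg2 x0).
  by rewrite -mulrA mulVKf// gt_eqF.
rewrite addNr powRr0 mulr1 subrr sub0r mulrN mulfV ?pnatr_eq0// subrr.
by rewrite (tricomiUE _ _ _ _ tg tg0 x0).
Qed.

End kappa_derivative.

Theorem theorem5 (R : realType) (x : R) (hx : 0 < x) :
  exists G1 G2 : R,
    [/\ is_meijerG 3 1 [:: 2^-1; 1] [:: 0; 0; 2^-1; - 2^-1]
          (x ^+ 2 / 4) G1%:C,
        is_meijerG 3 0 [:: 1] [:: - 2^-1; 0; 0] (x ^+ 2 / 4) G2%:C
      & forall mu : R, mu = 2^-1 \/ mu = - 2^-1 ->
        is_derive (0 : R) (1 : R) (fun kappa : R => whittakerW kappa mu x)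
          (expR (- x / 2)
           * (ln x + (4 * Num.sqrt pi)^-1 * (G1 - (expR x - 1) * G2)))].
Proof.
exists (4 * Num.sqrt pi * mellin_tent x), (4 * Num.sqrt pi * mellin_ramp x).
split; [exact: meijerG_tent|exact: meijerG_ramp|move=> m m12].
have p0 : Num.sqrt pi != 0 :> R by rewrite lt0r_neq0// sqrtr_gt0 pi_gt0.
(* The integral formula is available for [|k| < 1/2]; agreement near [0] transfers the
   derivative. *)
have near0 : \forall k \near (0 : R), expR (- x / 2) * ((tricomi_norm k)^-1 * tricomi_moment k k x)
    = whittakerW k m x.
  near=> k; rewrite (whittakerWE x k)//; apply/andP; split.
    by near: k; apply: lt_nbhsr; lra.
  by near: k; apply: lt_nbhsl; lra.
apply: (near_eq_is_derive near0).
have dk := is_derive_tricomi_moment_k x hx.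
derive_auto; rewrite mul0r add0r; congr (_ * _).
have [_ ->] := expR_ln_integral x hx.
have e1 := mellin_tent_ramp x hx; have e2 := mellin_rampE x hx.
(* Regrouped as [(A1 + A2) - e^x A2], which is [1/x - (1/x - I) = I] by [e1] and [e2]. *)
have -> : (4 * Num.sqrt pi)^-1 * (4 * Num.sqrt pi * mellin_tent x
    - (expR x - 1) * (4 * Num.sqrt pi * mellin_ramp x)) =
    mellin_tent x + mellin_ramp x - expR x * mellin_ramp x by field.
by rewrite e1 e2; ring.
Unshelve. all: by end_near. Qed.
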